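(* Let $X$ be a Stein manifold and let $f:X\to\mathbb{C}^*$ be a continuous map, where $\mathbb{C}^*=\mathbb{C}\setminus\{0\}$. Then $f$ is homotopic to a holomorphic map; that is, there is a continuous map $F:X\times[0,1]\to\mathbb{C}^*$ such that $F(\cdot,0)=f$ and $F(\cdot,1):X\to\mathbb{C}^*$ is holomorphic.
   Context: Complex manifolds are taken to be connected and second countable. A complex manifold $X$ is Stein if (a) holomorphic functions on $X$ separate points, (b) for every $x\in X$ there are $\dim X$ holomorphic functions on $X$ that give local coordinates at $x$, and (c) $X$ is holomorphically convex: for every compact $K\subset X$, the hull $\{x\in X: |f(x)|\le\max_K|f| \text{ for all holomorphic } f:X\to\mathbb{C}\}$ is compact. *)

(* Defs.v *)
From HB Require Import structures.
From mathcomp Require Import all_boot all_order all_algebra.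
From mathcomp Require Import all_classical all_reals all_analysis.
From mathcomp Require Import complex.
Set Implicit Arguments.
Unset Strict Implicit.
Unset Printing Implicit Defensive.
Import Order.TTheory GRing.Theory Num.Theory.
Import numFieldNormedType.Exports.
Local Open Scope classical_set_scope.
Local Open Scope ring_scope.
Local Open Scope complex_scope.

(* The modulus topology on R[i], which makes 'rV[R[i]]_n a normed module over  *)
(* R[i]; [differentiable] below is thus complex Frechet differentiability.     *)
HB.instance Definition _ (R : rcfType) := NormedModule.copy R[i] R[i]^o.

(* Meaningful for U open: [differentiable f z] only depends on the germ of f   *)
(* at z, so the values of f outside U are irrelevant.                          *)
Definition holomorphic_on (R : realType) (n : nat) (V : normedModType R[i])
    (U : set 'rV[R[i]]_n) (f : 'rV[R[i]]_n -> V) : Prop :=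
  forall z, U z -> differentiable f z.

(* A homeomorphism from an open subset of X onto an open subset of C^n. Both   *)
(* maps are total functions whose values outside the given sets are junk.      *)
Record chart (R : realType) (X : topologicalType) (n : nat) := Chart {
  chart_dom : set X ;
  chart_cod : set 'rV[R[i]]_n ;
  chart_fun :> X -> 'rV[R[i]]_n ;
  chart_inv : 'rV[R[i]]_n -> X ;
  chart_dom_open : open chart_dom ;
  chart_cod_open : open chart_cod ;
  chart_funS : forall x, chart_dom x -> chart_cod (chart_fun x) ;
  chart_invS : forall z, chart_cod z -> chart_dom (chart_inv z) ;
  chart_funK : forall x, chart_dom x -> chart_inv (chart_fun x) = x ;
  chart_invK : forall z, chart_cod z -> chart_fun (chart_inv z) = z ;
  chart_fun_continuous : {within chart_dom, continuous chart_fun} ;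
  chart_inv_continuous : {within chart_cod, continuous chart_inv} }.

(* c' \o c^-1 is holomorphic on c (dom c `&` dom c').                          *)
Definition transition_holomorphic (R : realType) (X : topologicalType)
    (n : nat) (c c' : chart R X n) : Prop :=
  holomorphic_on (c @` (chart_dom c `&` chart_dom c')) (c' \o chart_inv c).

Definition compatible (R : realType) (X : topologicalType) (n : nat)
    (c c' : chart R X n) : Prop :=
  transition_holomorphic c c' /\ transition_holomorphic c' c.

(* The atlas need not be maximal. *)
Record complexManifold (R : realType) (n : nat) := ComplexManifold {
  manifold_space :> topologicalType ;
  atlas : set (chart R manifold_space n) ;
  atlas_cover : forall x, exists2 c, atlas c & chart_dom c x ;
  atlas_compatible :
    forall c c', atlas c -> atlas c' -> compatible c c' ;
  manifold_hausdorff : hausdorff_space manifold_space ;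
  manifold_second_countable : @second_countable manifold_space ;
  manifold_connected : connected [set: manifold_space] }.

Section holomorphic.
Context (R : realType) (n : nat) (X : complexManifold R n).

Definition holomorphic (f : X -> R[i]) : Prop :=
  forall c, atlas c -> holomorphic_on (chart_cod c) (f \o chart_inv c).

(* Near x, the map (f_0, ..., f_(n-1)) is a chart of the maximal atlas of X.   *)
Definition local_coordinates (f : 'I_n -> X -> R[i]) (x : X) : Prop :=
  exists c : chart R X n,
    [/\ chart_dom c x,
        forall c', atlas c' -> compatible c c' &
        forall y, chart_dom c y -> c y = \row_j f j y].

(* For K compact and nonempty, the supremum is a maximum; for K empty it is 0  *)
(* by convention, and the hull is empty since constants are holomorphic.       *)
Definition holomorphic_hull (K : set X) : set X :=
  [set x | forall f, holomorphic f ->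
     Normc.normc (f x) <= sup [set Normc.normc (f y) | y in K]].

Definition stein : Prop :=
  [/\ forall x y : X, x <> y -> exists2 f, holomorphic f & f x <> f y,
      forall x : X, exists2 f : 'I_n -> X -> R[i],
        (forall j, holomorphic (f j)) & local_coordinates f x &
      forall K : set X, compact K -> compact (holomorphic_hull K)].

End holomorphic.

(* Main.v *)
(* X is exhausted by compact analytic polyhedra K_j. Finitely many holomorphic
   functions embed a neighbourhood of K_j into C^N. If Y is the image of K_j and B
   a box around it, the hull of Y with respect to functions holomorphic on B is Y
   itself. This follows from Rossi's local maximum principle, since near each
   point of Y the image is cut out by equations z_i = F_i(z_1, ..., z_n).

   Y thus has a basis of neighbourhoods that are polyhedra in B. On polyhedra,
   Oka's induction on the number of defining functions (a function on {p in a
   square} is extended from the graph of p to one more dimension) yields the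
   solution of Cousin's additive problem and approximation by functions on B, all
   from Cauchy's formula on rectangles. Applying Cousin's problem to local
   logarithms of f gives a continuous phi_j near K_j with f exp(- phi_j)
   holomorphic. The difference phi_(j+1) - phi_j is a logarithm of a holomorphic
   function, so it is holomorphic itself, and by approximation it can be made
   smaller than 2^-j on K_j. With phi = lim phi_j, the map f exp(- phi) is
   holomorphic and f exp(- t phi) is the homotopy. *)

(* The obstacle is that K_j is a polyhedron in X, while functions are split by integrals over
   rectangles in C^N. A function near K_j must become one near Y, and this is what the equality of Y
   with its hull is for: every neighbourhood of Y then contains a polyhedron around Y whose defining
   functions live on the box. The map f is only continuous, so it is extended off the image by
   Tietze's theorem. The extension H need not be holomorphic, because the local logarithms of H /
   H(z) enter the Cousin problem through their differences alone, whose exponentials are locally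
   constant. Functions holomorphic near the whole box play the role of global functions: the box is
   taken large enough for the image of K_(j+1), so an approximant found on K_j can be subtracted on
   K_(j+1) too. Holomorphic means complex differentiable, with no assumption on the derivative,
   whence Goursat's bisection. Integrals are defined by primitives, which keeps measure theory out
   of all but one existence lemma. *)
From HB Require Import structures.
From mathcomp Require Import all_boot all_order all_algebra.
From mathcomp Require Import all_classical all_reals all_analysis.
From mathcomp Require Import complex ring lra.
Require Import Defs.
Set Implicit Arguments.
Unset Strict Implicit.
Unset Printing Implicit Defensive.
Import Order.TTheory GRing.Theory Num.Theory.
Import numFieldNormedType.Exports.
Local Open Scope classical_set_scope.
Local Open Scope ring_scope.
Local Open Scope complex_scope.

(** * The real-valued norm of a complex normed module *)

Section RealNorm.
Context {R : realType}.
Local Notation C := R[i].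

(** Norms over R[i] take their values in R[i]; the real part makes real arithmetic and [lra]
    available. *)
Definition rn {V : normedModType C} (v : V) : R := complex.Re `|v|.

Lemma rnE {V : normedModType C} (v : V) : `|v| = (rn v)%:C.
Proof. by rewrite /rn RRe_real // ger0_real. Qed.

Lemma rn_ge0 {V : normedModType C} (v : V) : 0 <= rn v.
Proof. by rewrite -ler0c -rnE. Qed.

Lemma rn0 {V : normedModType C} : rn (0 : V) = 0.
Proof. by rewrite /rn normr0. Qed.

Lemma rn_eq0 {V : normedModType C} (v : V) : (rn v == 0) = (v == 0).
Proof.
rewrite -(normr_eq0 v) (rnE v); apply/eqP/eqP => [->//|]; exact: (@complexI R _ 0).
Qed.

Lemma rn_gt0 {V : normedModType C} (v : V) : (0 < rn v) = (v != 0).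
Proof. by rewrite lt_neqAle rn_ge0 andbT eq_sym rn_eq0. Qed.

Lemma rnN {V : normedModType C} (v : V) : rn (- v) = rn v.
Proof. by rewrite /rn normrN. Qed.

Lemma rnB {V : normedModType C} (u v : V) : rn (u - v) = rn (v - u).
Proof. by rewrite /rn distrC. Qed.

Lemma ler_rnD {V : normedModType C} (u v : V) : rn (u + v) <= rn u + rn v.
Proof. by rewrite -lecR rmorphD /= -!rnE ler_normD. Qed.

Lemma ler_rnB {V : normedModType C} (u v : V) : rn (u - v) <= rn u + rn v.
Proof. by rewrite -(rnN v) ler_rnD. Qed.

Lemma ler_rn_sum {V : normedModType C} I r (P : pred I) (F : I -> V) :
  rn (\sum_(i <- r | P i) F i) <= \sum_(i <- r | P i) rn (F i).
Proof.
elim/big_ind2 : _ => [|x a y b xa yb|//]; first by rewrite rn0.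
by apply: le_trans (ler_rnD _ _) _; rewrite lerD.
Qed.

Lemma ler_rn_sub {V : normedModType C} (u v : V) : rn u - rn v <= rn (u - v).
Proof. by rewrite lerBlDr; apply: le_trans (ler_rnD _ _); rewrite subrK. Qed.

Lemma rnZ {V : normedModType C} (a : C) (v : V) : rn (a *: v) = rn a * rn v.
Proof. by apply: (@complexI R); rewrite rmorphM /= -!rnE normrZ. Qed.

Lemma rnM (a b : C) : rn (a * b) = rn a * rn b.
Proof. by apply: (@complexI R); rewrite rmorphM /= -!rnE normrM. Qed.

Lemma rn1 : rn (1 : C) = 1.
Proof. by rewrite /rn normr1. Qed.

Lemma rnV (a : C) : rn a^-1 = (rn a)^-1.
Proof.
by apply: (@complexI R); rewrite -rnE normfV rnE fmorphV.
Qed.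

Lemma rnX (a : C) n : rn (a ^+ n) = rn a ^+ n.
Proof. by elim: n => [|n IH]; rewrite ?expr0 ?rn1// !exprS rnM IH. Qed.

Lemma rnR (x : R) : rn (x%:C) = `|x|.
Proof. by rewrite /rn normc_def /= expr0n addr0 sqrtr_sqr. Qed.

Lemma rni : rn ('i : C) = 1.
Proof. by rewrite /rn normc_def /= expr0n add0r expr1n sqrtr1. Qed.

Lemma rn_sqr (z : C) : rn z ^+ 2 = complex.Re z ^+ 2 + complex.Im z ^+ 2.
Proof. by rewrite /rn normc_def /= sqr_sqrtr // addr_ge0 ?sqr_ge0. Qed.

Lemma ler_Re_rn (z : C) : `|complex.Re z| <= rn z.
Proof.
by rewrite /rn normc_def /= -sqrtr_sqr ler_wsqrtr // lerDl sqr_ge0.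
Qed.

Lemma ler_Im_rn (z : C) : `|complex.Im z| <= rn z.
Proof.
by rewrite /rn normc_def /= -sqrtr_sqr ler_wsqrtr // lerDr sqr_ge0.
Qed.

Lemma rn_le_ReIm (z : C) : rn z <= `|complex.Re z| + `|complex.Im z|.
Proof.
rewrite {1}(complexE z); apply: le_trans (ler_rnD _ _) _.
by rewrite rnM !rnR rni mul1r.
Qed.

Lemma rn_coord N (z : 'rV[C]_N) i : rn (z 0 i) <= rn z.
Proof.
rewrite -lecR -!rnE; change (`|z 0 i| <= mx_norm z).
rewrite mx_normE -[leLHS]nngE num_le.
exact: (le_bigmax _ (fun ij : 'I_1 * 'I_N => (`|z ij.1 ij.2|%:nng)%R) (0, i)).
Qed.

Lemma rn_le_coord N (z : 'rV[C]_N) (e : R) : 0 <= e ->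
  (forall i, rn (z 0 i) <= e) -> rn z <= e.
Proof.
move=> e0 h; have [->|z0] := eqVneq z 0; first by rewrite rn0.
have [|[a i] /= E] := @mx_norm_neq0 C 1 N z.
  by rewrite -(normr_eq0 z) in z0.
by rewrite /rn; change `|z| with (mx_norm z); rewrite E ord1; exact: h.
Qed.

Lemma nbhs_rnP {V : normedModType C} (z : V) (P : V -> Prop) :
  (\forall y \near z, P y) <->
  exists2 e : R, 0 < e & forall y, rn (y - z) < e -> P y.
Proof.
split.
  move=> /nbhs_ballP[e /= e0 h]; have er := gtr0_real e0.
  exists (complex.Re e); first by rewrite -ltcR RRe_real.
  move=> y yz; apply: h; rewrite -ball_normE /ball_ /= distrC rnE.
  by rewrite -(RRe_real er) ltcR.
move=> [e e0 h]; apply/nbhs_ballP; exists e%:C; first by rewrite /= ltcR.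
by move=> y; rewrite -ball_normE /ball_ /= distrC rnE ltcR; exact: h.
Qed.

Lemma near0P {V : normedModType C} (P : V -> Prop) :
  (\forall y \near (0 : V), P y) <->
  exists2 e : R, 0 < e & forall y, rn y < e -> P y.
Proof.
split=> [/nbhs_rnP[e e0 h]|[e e0 h]].
  by exists e => // y ye; apply: h; rewrite subr0.
by apply/nbhs_rnP; exists e => // y; rewrite subr0; exact: h.
Qed.

Lemma near_shiftP {V : normedModType C} (z : V) (P : V -> Prop) :
  (\forall y \near z, P y) <->
  exists2 e : R, 0 < e & forall k, rn k < e -> P (z + k).
Proof.
split=> [/nbhs_rnP[e e0 h]|[e e0 h]].
  by exists e => // k ke; apply: h; rewrite addrAC subrr add0r.
apply/nbhs_rnP; exists e => // y ye; rewrite -(subrK z y) addrC; exact: h.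
Qed.

Lemma ctsP {X : topologicalType} {W : normedModType C} (f : X -> W) x :
  {for x, continuous f} <->
  (forall e : R, 0 < e -> \forall y \near x, rn (f y - f x) < e).
Proof.
split=> [h e e0|h].
  apply: (h [set y | rn (y - f x) < e]).
  by apply/(nbhs_rnP (f x)); exists e.
move=> A /nbhs_rnP[e e0 hA]; have := h e e0.
by apply: filterS => y; exact: (hA (f y)).
Qed.

Lemma diffE_eps {V W : normedModType C} (f : V -> W) z : differentiable f z ->
  forall e : R, 0 < e -> exists2 d : R, 0 < d & forall k, rn k < d ->
  rn (f (z + k) - f z - 'd f z k) <= e * rn k.
Proof.
move=> /diff_locallyP[_ h] e e0.
have /eqaddoP H := h.
have := H e%:C; rewrite ltcR => /(_ e0) /near0P[d d0 hd].
exists d => // k /hd.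
by rewrite /= !fctE /= opprD addrA !rnE -rmorphM /= lecR (addrC k).
Qed.

Lemma diff_intro_lin {V W : normedModType C} (f : V -> W) z
    (L : {linear V -> W}) : continuous L ->
  (forall e : R, 0 < e -> exists2 d : R, 0 < d & forall k, rn k < d ->
  rn (f (z + k) - f z - L k) <= e * rn k) ->
  differentiable f z /\ forall k, 'd f z k = L k.
Proof.
move=> cL h.
have E : f \o shift z = cst (f z) + L +o_ (0 : V) id.
  apply/eqaddoP => e e0; have er := gtr0_real e0.
  have /h[d d0 hd] : 0 < complex.Re e by rewrite -ltcR RRe_real.
  suff H : \forall k \near (0 : V), `|f (z + k) - f z - L k| <= e * `|k|.
    apply: filterS H => k.
    by rewrite /= !fctE /= opprD addrA (addrC k).
  apply/near0P; exists d => // k /hd.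
  by rewrite !rnE -(RRe_real er) -rmorphM /= lecR.
have D := diff_unique cL E.
split; last by move=> k; rewrite D.
by apply/diff_locallyP; rewrite D; split => //.
Qed.

Lemma diff_intro_eps N (W : normedModType C) (f : 'rV[C]_N -> W) z
    (a : 'I_N -> W) :
  (forall e : R, 0 < e -> exists2 d : R, 0 < d & forall k, rn k < d ->
  rn (f (z + k) - f z - \sum_j (k 0 j) *: a j) <= e * rn k) ->
  differentiable f z /\ forall k, 'd f z k = \sum_j (k 0 j) *: a j.
Proof.
move=> h.
pose L (k : 'rV[C]_N) := \sum_j (k 0 j) *: a j.
have Llin : linear L.
  move=> c u v; rewrite /L scaler_sumr -big_split /=; apply: eq_bigr => j _.
  by rewrite !mxE scalerDl scalerA.
pose LL : {linear 'rV[C]_N -> W} :=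
  HB.pack L (GRing.isLinear.Build _ _ _ _ L Llin).
apply: (@diff_intro_lin _ _ f z LL) => // k; apply/ctsP => e e0.
pose A := 1 + \sum_j rn (a j).
have A0 : 0 < A by rewrite ltr_pwDl // sumr_ge0 // => j _; exact: rn_ge0.
apply/nbhs_rnP; exists (e / A); first by rewrite divr_gt0.
move=> y; rewrite ltr_pdivlMr // -linearB /= => yk.
apply: le_lt_trans yk; apply: le_trans (ler_rn_sum _ _ _) _.
rewrite mulrDr mulr_sumr ler_wpDl ?mulr1 ?rn_ge0 //.
by apply: ler_sum => j _; rewrite rnZ ler_wpM2r ?rn_ge0 // rn_coord.
Qed.

Lemma near_eq_differentiable {V W : normedModType C} (f g : V -> W) z :
  (\forall y \near z, f y = g y) -> differentiable f z -> differentiable g z.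
Proof.
move=> fg df; have cd : continuous ('d f z) by exact: diff_continuous.
have fgz : f z = g z by exact: nbhs_singleton fg.
apply: (proj1 (@diff_intro_lin _ _ g z _ cd _)) => e e0.
have [d d0 hd] := diffE_eps df e0; move/near_shiftP: fg => [d' d'0 hd'].
exists (Num.min d d'); first by rewrite lt_min d0.
move=> k; rewrite lt_min => /andP[kd kd'].
by rewrite -hd' // -fgz; exact: hd.
Qed.

Lemma differentiable_idfun {V : normedModType C} (z : V) :
  differentiable (fun x : V => x) z.
Proof. by case: (is_diff_id z). Qed.

Lemma differentiable_affine (c0 c1 z : C) :
  differentiable (fun u => c0 + c1 * u) z.
Proof.
apply: differentiableD; first exact: differentiable_cst.
apply: differentiableM; first exact: differentiable_cst.
exact: differentiable_idfun.
Qed.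

End RealNorm.

(** * Integrals along segments and rectangles *)

Section Prim.
Context {R : realType}.
Local Notation C := R[i].

Lemma is_derive_epsP (F : R -> R) (x d : R) :
  is_derive x 1 F d <->
  (forall e : R, 0 < e -> exists2 D : R, 0 < D & forall h, `|h| < D ->
    `|F (x + h) - F x - h * d| <= e * `|h|).
Proof.
split.
  move=> [dF Fd] e e0; have := deriv1E dF; move/derivable1_diffP: dF => dF dE.
  have /diff_locallyP[_ h] := dF; have /eqaddoP H := h.
  have /nbhs_ballP[D /= D0 hD] := H e e0.
  exists D => // k kD; have := hD k.
  rewrite -ball_normE /ball_ /= sub0r normrN => /(_ kD).
  rewrite !fctE /= opprD addrA (addrC k) dE derive1E Fd; exact.
move=> h.
have E : (fun k => k^-1 *: ((F \o shift x) (k *: (1 : R)) - F x)) @ (0 : R)^' --> d.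
  apply/cvgrPdist_le => e e0; have [D D0 hD] := h e e0.
  near=> k.
  have k0 : k != 0 by near: k; exact: nbhs_dnbhs_neq.
  have kD : `|k| < D by near: k; apply: dnbhs0_lt.
  have := hD k kD; rewrite -(ler_pM2l (_ : 0 < `|k|^-1)) ?invr_gt0 ?normr_gt0 //.
  rewrite mulrCA mulVf ?normr_eq0 // mulr1 -normfV -normrM distrC.
  by rewrite mulrBr mulKf //= [k%:A]mulr1 (addrC k).
split; first by apply: cvgP E.
exact: cvg_lim E.
Unshelve. all: end_near.
Qed.

Definition cont01 (g : R -> C) := forall s : R, 0 <= s <= 1 ->
  forall e : R, 0 < e -> exists2 d : R, 0 < d & forall t : R, 0 <= t <= 1 ->
  `|t - s| < d -> rn (g t - g s) < e.

Definition rprim (g G : R -> R) := forall s : R, 0 <= s <= 1 -> is_derive s 1 G (g s).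

Definition prim (g G : R -> C) :=
  rprim (@complex.Re R \o g) (@complex.Re R \o G) /\
  rprim (@complex.Im R \o g) (@complex.Im R \o G).

Lemma rprim_MVT (g G : R -> R) : rprim g G ->
  exists2 c : R, 0 <= c <= 1 & G 1 - G 0 = g c.
Proof.
move=> hG; have [||c] := @MVT_segment R G g 0 1 ler01.
- move=> x; rewrite in_itv /= => /andP[x0 x1]; apply: hG.
  by rewrite !ltW.
- apply: derivable_within_continuous => x; rewrite in_itv /= => xI.
  by have [] := hG _ xI.
by rewrite in_itv /= => cI ->; exists c => //; rewrite subr0 mulr1.
Qed.

Lemma rprim_bnd (g G : R -> R) m M : rprim g G ->
  (forall s : R, 0 <= s <= 1 -> m <= g s <= M) -> m <= G 1 - G 0 <= M.
Proof. by move=> /rprim_MVT[c c01 ->]; exact. Qed.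

Lemma rprimB (f F g G : R -> R) : rprim f F -> rprim g G ->
  rprim (fun x => f x - g x) (fun x => F x - G x).
Proof. by move=> hF hG s s01; apply: is_deriveB; [exact: hF|exact: hG]. Qed.

Lemma rprimD (f F g G : R -> R) : rprim f F -> rprim g G ->
  rprim (fun x => f x + g x) (fun x => F x + G x).
Proof. by move=> hF hG s s01; apply: is_deriveD; [exact: hF|exact: hG]. Qed.

Lemma rprimZ (c : R) (g G : R -> R) : rprim g G ->
  rprim (fun x => c * g x) (fun x => c * G x).
Proof.
move=> hG s s01; have H := hG _ s01; exact: (is_deriveZ c).
Qed.

Lemma rprim_uniq (g G H : R -> R) : rprim g G -> rprim g H ->
  G 1 - G 0 = H 1 - H 0.
Proof.
move=> hG hH; have := rprim_bnd (m := 0) (M := 0) (rprimB hG hH).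
move=> /(_ _)/andP[|]; first by move=> s _; rewrite subrr lexx.
lra.
Qed.

Definition clamp (x : R) : R := Num.max 0 (Num.min 1 x).

Lemma clampE x : 0 <= x <= 1 -> clamp x = x.
Proof.
by move=> /andP[x0 x1]; rewrite /clamp min_r // max_r.
Qed.

Lemma clamp01 x : 0 <= clamp x <= 1.
Proof. by rewrite /clamp le_max lexx /= ge_max ler01 ge_min lexx. Qed.

Lemma clamp_lip x y : `|clamp x - clamp y| <= `|x - y|.
Proof.
have P z : [\/ z <= 0 /\ clamp z = 0, 1 <= z /\ clamp z = 1 |
    0 <= z <= 1 /\ clamp z = z].
  case: (lerP z 0) => [z0|/ltW z0]; [apply: Or31|].
    split=> //; rewrite /clamp min_r ?max_l //; exact: le_trans ler01.
  case: (lerP 1 z) => [z1|/ltW z1]; [apply: Or32|apply: Or33].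
    by rewrite /clamp min_l // max_r.
  by rewrite clampE z0 ?z1.
have h1 := ler_norm (x - y); have h2 := ler_norm (y - x).
rewrite (distrC y) in h2; rewrite ler_norml.
by case: (P x) => -[? ->]; case: (P y) => -[? ->]; apply/andP; split; lra.
Qed.

(** Derivatives in [rprim] are two-sided even at 0 and 1. So g is extended by constants through
    [clamp] and integrated from -1, which makes [0, 1] interior to [-1, 2]. *)
Lemma rprim_ex (g : R -> R) :
  (forall s, 0 <= s <= 1 -> forall e : R, 0 < e -> exists2 d : R, 0 < d &
     forall t, 0 <= t <= 1 -> `|t - s| < d -> `|g t - g s| < e) ->
  exists G, rprim g G.
Proof.
move=> cg; pose h := g \o clamp.
have ch : continuous h.
  move=> x; apply/cvgrPdist_lt => e e0.
  have [d d0 hd] := cg _ (clamp01 x) _ e0.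
  apply/nbhs_ballP; exists d => // y xy; have {}xy : `|x - y| < d := xy.
  rewrite distrC; apply: hd; first exact: clamp01.
  by apply: le_lt_trans (clamp_lip _ _) _; rewrite distrC.
exists (fun x => \int[lebesgue_measure]_(t in [set` `[(-1)%R, x]]) h t)%R.
move=> s /[dup] s01 /andP[s0 s1].
have A1 : s < 2 by apply: le_lt_trans s1 _; rewrite ltr1n.
have A2 : lebesgue_measure.-integrable `[(-1)%R, 2%R] (EFin \o h).
  apply: continuous_compact_integrable; first exact: segment_compact.
  exact: continuous_subspaceT.
have A3 : -1 < s by lra.
have [dF F's] := @continuous_FTC1_closed R h (-1) s 2 A1 A2 A3 (ch s).
split; first exact: dF.
by rewrite -derive1E F's /h /= clampE.
Qed.

Lemma prim_ex (g : R -> C) : cont01 g -> exists G, prim g G.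
Proof.
move=> cg.
have [G1 h1] : exists G, rprim (@complex.Re R \o g) G.
  apply: rprim_ex => s s01 e /(cg s s01)[d d0 hd]; exists d => // t t01 /hd.
  by move=> /(_ t01); apply: le_lt_trans; rewrite /= -raddfB ler_Re_rn.
have [G2 h2] : exists G, rprim (@complex.Im R \o g) G.
  apply: rprim_ex => s s01 e /(cg s s01)[d d0 hd]; exists d => // t t01 /hd.
  by move=> /(_ t01); apply: le_lt_trans; rewrite /= -raddfB ler_Im_rn.
by exists (fun x => G1 x +i* G2 x).
Qed.

(** The increment of any primitive; [cintE] shows independence of the choice, and 0 is the junk
    value when no primitive exists. *)
Definition cint (g : R -> C) : C :=
  xget 0 [set w | exists2 G, prim g G & w = G 1 - G 0].

Lemma cReB (x y : C) : complex.Re (x - y) = complex.Re x - complex.Re y.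
Proof. by case: x; case: y. Qed.
Lemma cImB (x y : C) : complex.Im (x - y) = complex.Im x - complex.Im y.
Proof. by case: x; case: y. Qed.
Lemma cImN (x : C) : complex.Im (- x) = - complex.Im x.
Proof. by case: x. Qed.
Lemma cReD (x y : C) : complex.Re (x + y) = complex.Re x + complex.Re y.
Proof. by case: x; case: y. Qed.
Lemma cImD (x y : C) : complex.Im (x + y) = complex.Im x + complex.Im y.
Proof. by case: x; case: y. Qed.
Lemma cReM (x y : C) : complex.Re (x * y) =
  complex.Re x * complex.Re y - complex.Im x * complex.Im y.
Proof. by case: x; case: y. Qed.
Lemma cImM (x y : C) : complex.Im (x * y) =
  complex.Re x * complex.Im y + complex.Im x * complex.Re y.
Proof. by case: x => ? ?; case: y => ? ?. Qed.

Lemma eq_ReIm (x y : C) : complex.Re x = complex.Re y ->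
  complex.Im x = complex.Im y -> x = y.
Proof. by case: x => ? ?; case: y => ? ? /= -> ->. Qed.

Lemma cintE g G : prim g G -> cint g = G 1 - G 0.
Proof.
move=> hG; rewrite /cint; case: xgetP => [w _ [H hH ->]|/(_ (G 1 - G 0))[]].
  by apply: eq_ReIm; rewrite ?cReB ?cImB; [exact: rprim_uniq hH.1 hG.1|
    exact: rprim_uniq hH.2 hG.2].
by exists G.
Qed.

Lemma primD f F g G : prim f F -> prim g G ->
  prim (fun x => f x + g x) (fun x => F x + G x).
Proof.
move=> [f1 f2] [g1 g2]; split.
  move=> s s01; have := rprimD f1 g1 s01; rewrite /= -cReD.
  by congr (is_derive _ _ _ _); apply/funext => x /=; rewrite cReD.
move=> s s01; have := rprimD f2 g2 s01; rewrite /= -cImD.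
by congr (is_derive _ _ _ _); apply/funext => x /=; rewrite cImD.
Qed.

Lemma primZ (c : C) g G : prim g G -> prim (fun x => c * g x) (fun x => c * G x).
Proof.
move=> [g1 g2]; split.
  move=> s s01.
  have := rprimB (rprimZ (complex.Re c) g1) (rprimZ (complex.Im c) g2) s01.
  rewrite /= -cReM.
  by congr (is_derive _ _ _ _); apply/funext => x /=; rewrite cReM.
move=> s s01.
have := rprimD (rprimZ (complex.Re c) g2) (rprimZ (complex.Im c) g1) s01.
rewrite /= -cImM.
by congr (is_derive _ _ _ _); apply/funext => x /=; rewrite cImM.
Qed.

Lemma eq_cint f g : (forall s, 0 <= s <= 1 -> f s = g s) -> cint f = cint g.
Proof.
move=> fg; congr xget; apply/seteqP; split => w [G [h1 h2] ->];
  exists G => //; split => s s01 /=.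
- by rewrite -fg //; exact: h1.
- by rewrite -fg //; exact: h2.
- by rewrite fg //; exact: h1.
- by rewrite fg //; exact: h2.
Qed.

Lemma cintD f g : cont01 f -> cont01 g ->
  cint (fun s => f s + g s) = cint f + cint g.
Proof.
move=> /prim_ex[F hF] /prim_ex[G hG].
by rewrite (cintE (primD hF hG)) (cintE hF) (cintE hG); ring.
Qed.

Lemma cintZ c g : cont01 g -> cint (fun s => c * g s) = c * cint g.
Proof.
by move=> /prim_ex[G hG]; rewrite (cintE (primZ c hG)) (cintE hG); ring.
Qed.

Lemma cint0 : cint (fun=> 0) = 0.
Proof.
have : prim (fun=> 0) (fun=> 0 : C).
  by split => s _ /=; exact: is_derive_cst.
by move=> /cintE ->; rewrite subrr.
Qed.

Lemma cont01D f g : cont01 f -> cont01 g -> cont01 (fun s => f s + g s).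
Proof.
move=> cf cg s s01 e e0.
have e2 : 0 < e / 2 by rewrite divr_gt0.
have [d1 d10 h1] := cf s s01 _ e2; have [d2 d20 h2] := cg s s01 _ e2.
exists (Num.min d1 d2); first by rewrite lt_min d10.
move=> t t01; rewrite lt_min => /andP[t1 t2].
rewrite opprD addrACA (splitr e); apply: le_lt_trans (ler_rnD _ _) _.
by rewrite ltrD ?h1 ?h2.
Qed.

Lemma cont01Z c g : cont01 g -> cont01 (fun s => c * g s).
Proof.
move=> cg s s01 e e0.
have c1 : 0 < 1 + rn c by rewrite ltr_pwDl ?rn_ge0.
have [d d0 h] := cg s s01 (e / (1 + rn c)) (divr_gt0 e0 c1).
exists d => // t t01 /(h _ t01); rewrite ltr_pdivlMr // -mulrBr rnM => H.
by apply: le_lt_trans H; rewrite mulrDr mulr1 mulrC ler_wpDl ?rn_ge0.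
Qed.

Lemma cont01_sum I (r : seq I) (F : I -> R -> C) :
  (forall i, cont01 (F i)) -> cont01 (fun s => \sum_(i <- r) F i s).
Proof.
move=> cF; elim: r => [|i r IH].
  move=> s s01 e e0; exists 1 => // t _ _.
  by rewrite !big_nil subrr rn0.
rewrite (_ : (fun _ => _) = fun s => F i s + \sum_(j <- r) F j s).
  exact: cont01D.
by apply/funext => s; rewrite big_cons.
Qed.

Lemma cint_sum I (r : seq I) (F : I -> R -> C) : (forall i, cont01 (F i)) ->
  cint (fun s => \sum_(i <- r) F i s) = \sum_(i <- r) cint (F i).
Proof.
move=> cF; elim: r => [|i r IH].
  by rewrite big_nil -[RHS]cint0; apply: eq_cint => s _; rewrite big_nil.
rewrite big_cons -IH -cintD //; last exact: cont01_sum.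
by apply: eq_cint => s _; rewrite big_cons.
Qed.

(** The mean value theorem is applied to the real and imaginary parts separately, which costs a
    harmless factor 2. *)
Lemma cint_bnd (g : R -> C) M : cont01 g ->
  (forall s, 0 <= s <= 1 -> rn (g s) <= M) -> rn (cint g) <= 2 * M.
Proof.
move=> /prim_ex[G hG] hM; rewrite (cintE hG).
apply: le_trans (rn_le_ReIm _) _; rewrite cReB cImB.
have h1 : - M <= complex.Re (G 1) - complex.Re (G 0) <= M.
  apply: rprim_bnd hG.1 _ => s s01; rewrite -ler_norml /=.
  by apply: le_trans (ler_Re_rn _) (hM _ s01).
have h2 : - M <= complex.Im (G 1) - complex.Im (G 0) <= M.
  apply: rprim_bnd hG.2 _ => s s01; rewrite -ler_norml /=.
  by apply: le_trans (ler_Im_rn _) (hM _ s01).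
by rewrite mulrDl mul1r lerD // ler_norml.
Qed.

Lemma Im_cint_ge (g : R -> C) m : cont01 g ->
  (forall s, 0 <= s <= 1 -> m <= complex.Im (g s)) -> m <= complex.Im (cint g).
Proof.
move=> /prim_ex[G hG] hm; rewrite (cintE hG) cImB.
by have [c c01 /= ->] := rprim_MVT hG.2; exact: hm.
Qed.

End Prim.

Section Lint.
Context {R : realType}.
Local Notation C := R[i].

Lemma rprim_affine (g G : R -> R) (p q : R) : rprim g G ->
  (forall s : R, 0 <= s <= 1 -> 0 <= q + s * p <= 1) ->
  rprim (fun s => p * g (q + s * p)) (fun s => G (q + s * p)).
Proof.
move=> hG h s s01.
have d1 : is_derive s 1 (fun s => q + s * p) p.
  have := is_deriveD (is_derive_cst q s 1)
     (is_deriveM (is_derive_id s 1) (is_derive_cst p s 1)).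
  by rewrite /= scaler0 !add0r [_ *: _]mulr1.
have := @is_derive1_comp R G (fun s => q + s * p) s _ _ (hG _ (h _ s01)) d1.
by rewrite mulrC.
Qed.

Lemma prim_affine (g G : R -> C) (p q : R) : prim g G ->
  (forall s : R, 0 <= s <= 1 -> 0 <= q + s * p <= 1) ->
  prim (fun s => p%:C * g (q + s * p)) (fun s => G (q + s * p)).
Proof.
move=> [h1 h2] h; split=> s s01.
  have := rprim_affine h1 h s01.
  congr (is_derive _ _ _ _).
  by rewrite /= cReM /= mul0r subr0.
have := rprim_affine h2 h s01.
congr (is_derive _ _ _ _).
by rewrite /= cImM /= mul0r addr0.
Qed.

Lemma prim_sub (g G : R -> C) (p q : R) : prim g G ->
  (forall s : R, 0 <= s <= 1 -> 0 <= q + s * p <= 1) ->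
  cont01 g ->
  p%:C * cint (fun s => g (q + s * p)) = G (q + p) - G q.
Proof.
move=> hG h cg; rewrite -cintZ.
  rewrite (cintE (prim_affine hG h)).
  by rewrite mul1r mul0r addr0.
move=> s s01 e e0.
have p1 : 0 < 1 + `|p| by rewrite ltr_pwDl.
have [d d0 hd] := cg _ (h s s01) e e0.
exists (d / (1 + `|p|)); first by rewrite divr_gt0.
move=> t t01; rewrite ltr_pdivlMr // => ts; apply: hd; first exact: h.
rewrite opprD addrACA subrr add0r -mulrBl normrM.
apply: le_lt_trans ts; rewrite mulrDr mulr1 lerDr //.
Qed.

Definition seg (a b : C) (s : R) : C := a + s%:C * (b - a).

Definition lint (g : C -> C) (a b : C) : C := (b - a) * cint (g \o seg a b).

Definition cseg (g : C -> C) (a b : C) :=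
  forall s : R, 0 <= s <= 1 -> {for seg a b s, continuous g}.

Lemma cseg_cont01 g a b : cseg g a b -> cont01 (g \o seg a b).
Proof.
move=> cg s s01 e e0; have /ctsP/(_ e e0)/nbhs_rnP[d d0 hd] := cg s s01.
have p1 : 0 < 1 + rn (b - a) by rewrite ltr_pwDl ?rn_ge0.
exists (d / (1 + rn (b - a))); first by rewrite divr_gt0.
move=> t t01; rewrite ltr_pdivlMr // => ts; apply: hd.
rewrite /seg opprD addrACA subrr add0r -mulrBl -rmorphB rnM rnR.
by apply: le_lt_trans ts; rewrite mulrDr mulr1 lerDr normr_ge0.
Qed.

Lemma eq_lint f g a b : (forall s : R, 0 <= s <= 1 -> f (seg a b s) = g (seg a b s)) ->
  lint f a b = lint g a b.
Proof. by move=> fg; congr (_ * _); apply: eq_cint => s; exact: fg. Qed.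

Lemma lintD f g a b : cseg f a b -> cseg g a b ->
  lint (fun z => f z + g z) a b = lint f a b + lint g a b.
Proof.
move=> cf cg; rewrite /lint -mulrDr -cintD //; exact: cseg_cont01.
Qed.

Lemma lintZ c g a b : cseg g a b -> lint (fun z => c * g z) a b = c * lint g a b.
Proof. by move=> cg; rewrite /lint mulrCA; congr (_ * _); rewrite -cintZ //; exact: cseg_cont01. Qed.

Lemma lint_bnd g a b M : cseg g a b ->
  (forall s : R, 0 <= s <= 1 -> rn (g (seg a b s)) <= M) ->
  rn (lint g a b) <= 2 * M * rn (b - a).
Proof.
move=> /cseg_cont01 cg hM; rewrite /lint rnM mulrC ler_wpM2r ?rn_ge0 //.
exact: cint_bnd.
Qed.

Lemma lint_split g a c (t : R) : 0 <= t <= 1 -> cseg g a c ->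
  lint g a (seg a c t) + lint g (seg a c t) c = lint g a c.
Proof.
move=> /andP[t0 t1] /cseg_cont01 cg; have [G hG] := prim_ex cg.
have E1 : lint g a (seg a c t) = (c - a) * (G t - G 0).
  rewrite /lint {1}/seg addrAC subrr add0r mulrAC mulrC; congr (_ * _).
  rewrite -(add0r t) -(prim_sub hG) //; last first.
    move=> s /andP[s0 s1]; rewrite add0r mulr_ge0 //=.
    by rewrite mulr_ile1.
  congr (_ * _); rewrite ?add0r //; apply: eq_cint => s _ /=.
  by congr g; rewrite /seg add0r rmorphM /=; ring.
have E2 : lint g (seg a c t) c = (c - a) * (G 1 - G t).
  have -> : G 1 = G (t + (1 - t)) by congr G; ring.
  rewrite -(prim_sub hG) //; last first.
    move=> s /andP[s0 s1]; apply/andP; split; nra.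
  rewrite /lint mulrA; congr (_ * _).
    by rewrite /seg rmorphB rmorph1; ring.
  apply: eq_cint => s _ /=; congr g.
  by rewrite /seg rmorphD rmorphM rmorphB rmorph1 /=; ring.
by rewrite E1 E2 /lint (cintE hG); ring.
Qed.

Lemma prim_id : prim (fun s : R => s%:C) (fun s : R => (s ^+ 2 / 2)%:C).
Proof.
split=> s _ /=; last exact: is_derive_cst.
apply/is_derive_epsP => e e0; exists (2 * e); first by rewrite mulr_gt0.
move=> h he /=; rewrite (_ : _ - _ - _ = h / 2 * h); last by field.
rewrite normrM ler_wpM2r // normrM [X in _ * X]ger0_norm; lra.
Qed.

Lemma lint_affine c0 c1 a b :
  lint (fun z => c0 + c1 * z) a b = (b - a) * (c0 + c1 * (a + b) / 2).
Proof.
congr (_ * _).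
have P : prim (fun _ : R => c0 + c1 * a) (fun s : R => (c0 + c1 * a) * s%:C).
  have H : prim (fun _ : R => 1 : C) (fun s : R => s%:C).
    by split=> s _ /=; [exact: is_derive_id|exact: is_derive_cst].
  by have := primZ (c0 + c1 * a) H; rewrite mulr1.
rewrite (@eq_cint _ _ (fun s => (c0 + c1 * a) + (c1 * (b - a)) * s%:C)).
  rewrite (cintE (primD P (primZ (c1 * (b - a)) prim_id))).
  rewrite expr1n expr0n /= mul0r !mul1r rmorph0 rmorph1 fmorphV rmorph_nat.
  by field.
by move=> s _; rewrite /= /seg; ring.
Qed.

Lemma lint_scale g (p q : C) a b :
  lint g (p + q * a) (p + q * b) = q * lint (fun z => g (p + q * z)) a b.
Proof.
rewrite /lint mulrA; congr (_ * _); first by ring.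
by apply: eq_cint => s _ /=; congr g; rewrite /seg; ring.
Qed.

Lemma Im_lint_ge c g a b m : cseg g a b ->
  (forall s : R, 0 <= s <= 1 -> m <= complex.Im (c * (b - a) * g (seg a b s))) ->
  m <= complex.Im (c * lint g a b).
Proof.
move=> cg hm; rewrite /lint mulrA -cintZ; last exact: cseg_cont01.
apply: Im_cint_ge => //; apply: cont01Z; exact: cseg_cont01.
Qed.

Definition hint (g : C -> C) y x1 x2 := lint g (x1 +i* y) (x2 +i* y).
Definition vint (g : C -> C) x y1 y2 := lint g (x +i* y1) (x +i* y2).
Definition rint g x1 x2 y1 y2 :=
  hint g y1 x1 x2 - hint g y2 x1 x2 + vint g x2 y1 y2 - vint g x1 y1 y2.

Lemma rintE g x1 x2 y1 y2 : rint g x1 x2 y1 y2 =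
  hint g y1 x1 x2 - hint g y2 x1 x2 + vint g x2 y1 y2 - vint g x1 y1 y2.
Proof. by []. Qed.

Definition crect (g : C -> C) (x1 x2 y1 y2 : R) := forall z : C,
  x1 <= complex.Re z <= x2 -> y1 <= complex.Im z <= y2 -> {for z, continuous g}.

Definition rbd (x1 x2 y1 y2 : R) (z : C) :=
  [/\ x1 <= complex.Re z <= x2, y1 <= complex.Im z <= y2 &
     [\/ complex.Re z = x1, complex.Re z = x2, complex.Im z = y1 |
       complex.Im z = y2]].

(** Only the boundary counts, since the integrand of Cauchy's formula has a pole inside. *)
Definition cbd (g : C -> C) (x1 x2 y1 y2 : R) :=
  forall z, rbd x1 x2 y1 y2 z -> {for z, continuous g}.

Lemma crect_cbd g x1 x2 y1 y2 : crect g x1 x2 y1 y2 -> cbd g x1 x2 y1 y2.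
Proof. by move=> cg z [h1 h2 _]; exact: cg. Qed.

Lemma segh y x1 x2 s : seg (x1 +i* y) (x2 +i* y) s = (x1 + s * (x2 - x1)) +i* y.
Proof. by rewrite /seg; apply: eq_ReIm; rewrite /=; ring. Qed.
Lemma segv x y1 y2 s : seg (x +i* y1) (x +i* y2) s = x +i* (y1 + s * (y2 - y1)).
Proof. by rewrite /seg; apply: eq_ReIm; rewrite /=; ring. Qed.

Lemma conv_bnd (x1 x2 s : R) : x1 <= x2 -> 0 <= s <= 1 ->
  x1 <= x1 + s * (x2 - x1) <= x2.
Proof. by move=> ? /andP[? ?]; apply/andP; split; nra. Qed.

Lemma conv_ex (x1 x2 x : R) : x1 <= x <= x2 ->
  exists2 s : R, 0 <= s <= 1 & x = x1 + s * (x2 - x1).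
Proof.
move=> /andP[h1 h2]; have [E|x12] := eqVneq x1 x2.
  by exists 0; rewrite ?lexx ?ler01 // mul0r addr0; lra.
have d0 : 0 < x2 - x1 by lra.
exists ((x - x1) / (x2 - x1)); last by rewrite divfK ?gt_eqF //; lra.
by rewrite divr_ge0 ?ler_pdivrMr //; lra.
Qed.

Section rect.
Variables (g : C -> C) (x1 x2 y1 y2 : R).
Hypotheses (x12 : x1 <= x2) (y12 : y1 <= y2) (cg : cbd g x1 x2 y1 y2).

Lemma rbd_h y s : 0 <= s <= 1 -> y = y1 \/ y = y2 ->
  rbd x1 x2 y1 y2 (seg (x1 +i* y) (x2 +i* y) s).
Proof.
move=> s01 hy; rewrite segh; split => /=; first exact: conv_bnd.
  by case: hy => ->; rewrite lexx ?y12.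
by case: hy => ->; [apply: Or43|apply: Or44].
Qed.
Lemma rbd_v x s : 0 <= s <= 1 -> x = x1 \/ x = x2 ->
  rbd x1 x2 y1 y2 (seg (x +i* y1) (x +i* y2) s).
Proof.
move=> s01 hx; rewrite segv; split => /=; last 1 first.
- by case: hx => ->; [apply: Or41|apply: Or42].
- by case: hx => ->; rewrite lexx ?x12.
- exact: conv_bnd.
Qed.

Lemma cseg_h y : y = y1 \/ y = y2 -> cseg g (x1 +i* y) (x2 +i* y).
Proof. by move=> hy s s01; apply: cg; exact: rbd_h. Qed.
Lemma cseg_v x : x = x1 \/ x = x2 -> cseg g (x +i* y1) (x +i* y2).
Proof. by move=> hx s s01; apply: cg; exact: rbd_v. Qed.

(** The two integrals along the cut cancel whatever g does there, so only the outer edges are split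
    and continuity on the outer boundary suffices. *)
Lemma rint_splitx x : x1 <= x <= x2 ->
  rint g x1 x y1 y2 + rint g x x2 y1 y2 = rint g x1 x2 y1 y2.
Proof.
move=> /conv_ex[s s01 ->]; rewrite /rint.
have H y : y = y1 \/ y = y2 -> hint g y x1 (x1 + s * (x2 - x1)) +
    hint g y (x1 + s * (x2 - x1)) x2 = hint g y x1 x2.
  by move=> hy; rewrite /hint -segh; apply: lint_split => //; exact: cseg_h.
by rewrite -!H; [ring|right|left].
Qed.
Lemma rint_splity y : y1 <= y <= y2 ->
  rint g x1 x2 y1 y + rint g x1 x2 y y2 = rint g x1 x2 y1 y2.
Proof.
move=> /conv_ex[s s01 ->]; rewrite /rint.
have H x : x = x1 \/ x = x2 -> vint g x y1 (y1 + s * (y2 - y1)) +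
    vint g x (y1 + s * (y2 - y1)) y2 = vint g x y1 y2.
  by move=> hx; rewrite /vint -segv; apply: lint_split => //; exact: cseg_v.
by rewrite -!H; [ring|left|right].
Qed.

(** The 4 is the factor 2 of [cint_bnd] times two edges in each direction. *)
Lemma rint_bnd M : (forall z : C, rbd x1 x2 y1 y2 z -> rn (g z) <= M) ->
  rn (rint g x1 x2 y1 y2) <= 4 * M * ((x2 - x1) + (y2 - y1)).
Proof.
move=> hM.
have H y : y = y1 \/ y = y2 -> rn (hint g y x1 x2) <= 2 * M * (x2 - x1).
  move=> hy; apply: le_trans (lint_bnd (cseg_h hy) (M := M) _) _.
    by move=> s s01; apply: hM; exact: rbd_h.
  rewrite (_ : _ - _ = (x2 - x1)%:C); last by apply: eq_ReIm => /=; ring.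
  by rewrite rnR ger0_norm // subr_ge0.
have V x : x = x1 \/ x = x2 -> rn (vint g x y1 y2) <= 2 * M * (y2 - y1).
  move=> hx; apply: le_trans (lint_bnd (cseg_v hx) (M := M) _) _.
    by move=> s s01; apply: hM; exact: rbd_v.
  rewrite (_ : _ - _ = 'i * (y2 - y1)%:C); last by apply: eq_ReIm => /=; ring.
  by rewrite rnM rni mul1r rnR ger0_norm // subr_ge0.
rewrite /rint; apply: le_trans (ler_rnB _ _) _.
apply: le_trans (lerD (ler_rnD _ _) (V _ (or_introl erefl))) _.
apply: le_trans (lerD (lerD (ler_rnB _ _) (V _ (or_intror erefl))) (lexx _)) _.
have := H _ (or_introl erefl); have := H _ (or_intror erefl); lra.
Qed.
End rect.

Lemma rintD f g x1 x2 y1 y2 : x1 <= x2 -> y1 <= y2 ->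
  cbd f x1 x2 y1 y2 -> cbd g x1 x2 y1 y2 ->
  rint (fun z => f z + g z) x1 x2 y1 y2 = rint f x1 x2 y1 y2 + rint g x1 x2 y1 y2.
Proof.
move=> x12 y12 cf cg.
have H y : y = y1 \/ y = y2 -> hint (fun z => f z + g z) y x1 x2 =
    hint f y x1 x2 + hint g y x1 x2.
  move=> hy; apply: lintD; first exact: (cseg_h x12 y12 cf).
  exact: (cseg_h x12 y12 cg).
have V x : x = x1 \/ x = x2 -> vint (fun z => f z + g z) x y1 y2 =
    vint f x y1 y2 + vint g x y1 y2.
  move=> hx; apply: lintD; first exact: (cseg_v x12 y12 cf).
  exact: (cseg_v x12 y12 cg).
by rewrite /rint !H ?V; [ring|left|right|right|left].
Qed.

Lemma rintZ c g x1 x2 y1 y2 : x1 <= x2 -> y1 <= y2 -> cbd g x1 x2 y1 y2 ->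
  rint (fun z => c * g z) x1 x2 y1 y2 = c * rint g x1 x2 y1 y2.
Proof.
move=> x12 y12 cg.
have H y : y = y1 \/ y = y2 ->
    hint (fun z => c * g z) y x1 x2 = c * hint g y x1 x2.
  by move=> hy; apply: lintZ; exact: (cseg_h x12 y12 cg).
have V x : x = x1 \/ x = x2 ->
    vint (fun z => c * g z) x y1 y2 = c * vint g x y1 y2.
  by move=> hx; apply: lintZ; exact: (cseg_v x12 y12 cg).
by rewrite /rint !H ?V; [ring|left|right|right|left].
Qed.

Lemma eq_rint f g x1 x2 y1 y2 : x1 <= x2 -> y1 <= y2 ->
  (forall z, rbd x1 x2 y1 y2 z -> f z = g z) ->
  rint f x1 x2 y1 y2 = rint g x1 x2 y1 y2.
Proof.
move=> x12 y12 fg; rewrite /rint /hint /vint.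
congr (_ - _ + _ - _); apply: eq_lint => s s01; apply: fg.
- by apply: rbd_h => //; left.
- by apply: rbd_h => //; right.
- by apply: rbd_v => //; right.
- by apply: rbd_v => //; left.
Qed.

Lemma rint_square g (z : C) (r : R) :
  rint g (complex.Re z - r) (complex.Re z + r) (complex.Im z - r)
    (complex.Im z + r) =
  r%:C * rint (fun w => g (z + r%:C * w)) (-1) 1 (-1) 1.
Proof.
have E a b : z + r%:C * (a +i* b) =
    (complex.Re z + r * a) +i* (complex.Im z + r * b).
  by apply: eq_ReIm; rewrite ?cReD ?cImD ?cReM ?cImM /=; ring.
have F a b c d : lint g ((complex.Re z + r * a) +i* (complex.Im z + r * b))
    ((complex.Re z + r * c) +i* (complex.Im z + r * d)) =
    r%:C * lint (fun w => g (z + r%:C * w)) (a +i* b) (c +i* d).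
  by rewrite -!E lint_scale.
have N (x : R) : x - r = x + r * -1 by rewrite mulrN1.
have P (x : R) : x + r = x + r * 1 by rewrite mulr1.
by rewrite !N !P /rint /hint /vint !F; ring.
Qed.

Lemma rint_affine c0 c1 x1 x2 y1 y2 :
  rint (fun z => c0 + c1 * z) x1 x2 y1 y2 = 0.
Proof.
rewrite /rint /hint /vint !lint_affine.
have E x y : x +i* y = x%:C + 'i * y%:C :> C by apply: eq_ReIm => /=; ring.
by rewrite !E; field.
Qed.

End Lint.

(** * Goursat's lemma and Cauchy's formula on rectangles *)

Section Goursat.
Context {R : realType}.
Local Notation C := R[i].
Local Notation crect := (@crect R).
Local Notation rint := (@rint R).

Definition drect (g : C -> C) (x1 x2 y1 y2 : R) := forall z : C,
  x1 <= complex.Re z <= x2 -> y1 <= complex.Im z <= y2 -> differentiable g z.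

Lemma drect_crect g x1 x2 y1 y2 : drect g x1 x2 y1 y2 -> crect g x1 x2 y1 y2.
Proof. by move=> dg z hx hy; apply: differentiable_continuous; exact: dg. Qed.

Lemma crect_sub g x1 x2 y1 y2 u1 u2 v1 v2 : crect g x1 x2 y1 y2 ->
  x1 <= u1 -> u2 <= x2 -> y1 <= v1 -> v2 <= y2 -> crect g u1 u2 v1 v2.
Proof. by move=> dg a1 a2 b1 b2 z /andP[? ?] /andP[? ?]; apply: dg; lra. Qed.

Lemma linC (L : {linear C -> C}) k : L k = k * L 1.
Proof. by rewrite -[in LHS](mulr1 k); exact: linearZ. Qed.

(** The sides are written w + w and h + h, so that halving involves no division. *)
Lemma goursat_quarter (g : C -> C) (x y w h : R) : 0 <= w -> 0 <= h ->
  crect g x (x + (w + w)) y (y + (h + h)) ->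
  exists x' y', [/\ x' = x \/ x' = x + w, y' = y \/ y' = y + h &
    rn (rint g x (x + (w + w)) y (y + (h + h))) <=
      4 * rn (rint g x' (x' + w) y' (y' + h))].
Proof.
move=> w0 h0 cg.
have sub u1 u2 v1 v2 : x <= u1 -> u2 <= x + (w + w) -> y <= v1 ->
    v2 <= y + (h + h) -> cbd g u1 u2 v1 v2.
  by move=> *; apply: crect_cbd; exact: crect_sub cg _ _ _ _.
have -> : rint g x (x + (w + w)) y (y + (h + h)) =
  rint g x (x + w) y (y + h) + rint g x (x + w) (y + h) (y + h + h) +
  (rint g (x + w) (x + w + w) y (y + h) +
   rint g (x + w) (x + w + w) (y + h) (y + h + h)).
  have E1 := @rint_splitx R g x (x + (w + w)) y (y + (h + h)).
  have E2 := @rint_splity R g x (x + w) y (y + (h + h)).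
  have E3 := @rint_splity R g (x + w) (x + (w + w)) y (y + (h + h)).
  rewrite -!addrA.
  rewrite -(E1 _ _ _ (x + w)); [|lra|lra|apply: sub; lra|lra].
  rewrite -(E2 _ _ _ (y + h)); [|lra|lra|apply: sub; lra|lra].
  rewrite -(E3 _ _ _ (y + h)); [|lra|lra|apply: sub; lra|lra].
  by rewrite -!addrA.
set A := rint _ _ _ _ _; set B := rint _ _ _ _ _.
set D := rint _ _ _ _ _; set E := rint _ _ _ _ _.
rewrite [A + B + _]addrA.
have T : rn (A + B + D + E) <= rn A + rn B + rn D + rn E.
  apply: le_trans (ler_rnD _ _) _; rewrite lerD2r.
  by apply: le_trans (ler_rnD _ _) _; rewrite lerD2r ler_rnD.
have [hA|hA] := lerP (rn (A + B + D + E)) (4 * rn A).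
  by exists x, y; split; [left|left|exact: hA].
have [hB|hB] := lerP (rn (A + B + D + E)) (4 * rn B).
  by exists x, (y + h); split; [left|right|exact: hB].
have [hD|hD] := lerP (rn (A + B + D + E)) (4 * rn D).
  by exists (x + w), y; split; [right|left|exact: hD].
exists (x + w), (y + h); split; [by right|by right|rewrite -/E].
lra.
Qed.

Lemma bisect_limit (x w : nat -> R) :
  (forall n, w n = w n.+1 + w n.+1) -> (forall n, 0 <= w n) ->
  (forall n, x n.+1 = x n \/ x n.+1 = x n + w n.+1) ->
  exists p, forall n, x n <= p <= x n + w n.
Proof.
move=> hw w0 hx.
have up n : x n <= x n.+1 by case: (hx n) => ->; rewrite ?lexx // lerDl.
have dn n : x n.+1 + w n.+1 <= x n + w n.
  by have := w0 n.+1; case: (hx n) => ->; rewrite (hw n); lra.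
have up' m n : (m <= n)%N -> x m <= x n.
  by move=> /subnK <-; elim: (n - m)%N => [//|k]; rewrite addSn => /le_trans; apply.
have dn' m n : (m <= n)%N -> x n + w n <= x m + w m.
  move=> /subnK <-; elim: (n - m)%N => [//|k]; rewrite addSn; exact: le_trans.
have bnd m n : x m <= x n + w n.
  have [mn|/ltnW nm] := leqP m n.
    by apply: le_trans (up' _ _ mn) _; rewrite lerDl.
  by apply: le_trans (dn' _ _ nm); rewrite lerDl.
have hs : has_sup (range x).
  by split; [exists (x 0%N); exists 0%N|exists (x 0%N + w 0%N) => _ [n _ <-]].
exists (sup (range x)) => n; apply/andP; split.
  by apply: sup_upper_bound => //; exists n.
by apply: ge_sup; [case: hs|move=> _ [m _ <-]].
Qed.

Lemma goursat g x1 x2 y1 y2 : x1 <= x2 -> y1 <= y2 -> drect g x1 x2 y1 y2 ->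
  rint g x1 x2 y1 y2 = 0.
Proof.
move=> x12 y12 dg; have cg := drect_crect dg.
apply/eqP; rewrite -rn_eq0; apply/negPn/negP => I0.
have {}I0 : 0 < rn (rint g x1 x2 y1 y2) by rewrite lt_neqAle eq_sym I0 rn_ge0.
set I := rn _ in I0.
pose w n : R := (x2 - x1) / 2 ^+ n; pose h n : R := (y2 - y1) / 2 ^+ n.
have hlf (a : R) n : a / 2 ^+ n = a / 2 ^+ n.+1 + a / 2 ^+ n.+1.
  by rewrite exprSr invfM mulrA -splitr.
have w0 n : 0 <= w n by rewrite divr_ge0 ?exprn_ge0 ?subr_ge0.
have h0 n : 0 <= h n by rewrite divr_ge0 ?exprn_ge0 ?subr_ge0.
(* The lower left corner of the n-th rectangle, of sides w n and h n, is q. *)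
pose P n (q : R * R) := [/\ x1 <= q.1, q.1 + w n <= x2, y1 <= q.2,
  q.2 + h n <= y2 & I <= 4 ^+ n * rn (rint g q.1 (q.1 + w n) q.2 (q.2 + h n))].
pose Q n (q q' : R * R) := (q'.1 = q.1 \/ q'.1 = q.1 + w n.+1) /\
  (q'.2 = q.2 \/ q'.2 = q.2 + h n.+1).
(* The premise sits inside the existential, so that [choice] returns a total step function. *)
have step (a : nat * (R * R)) : exists q', P a.1 a.2 ->
    Q a.1 a.2 q' /\ P a.1.+1 q'.
  case: a => n [x y] /=; have [[/= p1 p2 p3 p4 p5]|nP] := pselect (P n (x, y));
    last by exists (x, y).
  have Ew : w n = w n.+1 + w n.+1 by exact: hlf.
  have Eh : h n = h n.+1 + h n.+1 by exact: hlf.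
  have := w0 n.+1; have := h0 n.+1 => hn0 wn0.
  have cg' : crect g x (x + (w n.+1 + w n.+1)) y (y + (h n.+1 + h n.+1)).
    by rewrite -Ew -Eh; apply: crect_sub cg _ _ _ _.
  have [x' [y' [hx hy hI]]] := goursat_quarter wn0 hn0 cg'.
  exists (x', y') => _; split; first by [].
  rewrite -Ew -Eh in hI; rewrite /P /=.
  split; [by case: hx => ->; lra|by case: hx => ->; lra|by case: hy => ->; lra|
    by case: hy => ->; lra|].
  apply: le_trans p5 _; rewrite exprSr -mulrA ler_wpM2l ?exprn_ge0 //.
have [F hF] := choice step.
pose st := fix st n := if n is n'.+1 then F (n', st n') else (x1, y1).
have Pst n : P n (st n).
  elim: n => [|n IH]; last by have [_] := hF (n, st n) IH.
  rewrite /P /= /w /h expr0 !divr1 mul1r; split; try lra.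
  by rewrite !(addrC _ (_ - _)) !subrK.
have Qst n : Q n (st n) (st n.+1) by have [] := hF (n, st n) (Pst n).
have [p hp] := @bisect_limit (fun n => (st n).1) w (fun n => hlf _ n) w0
  (fun n => (Qst n).1).
have [q hq] := @bisect_limit (fun n => (st n).2) h (fun n => hlf _ n) h0
  (fun n => (Qst n).2).
pose z := p +i* q.
have [P0 P0' Q0 Q0' _] := Pst 0%N.
have dz : differentiable g z.
  apply: dg => /=; first by have := hp 0%N; lra.
  by have := hq 0%N; lra.
pose s := (x2 - x1) + (y2 - y1).
have s0 : 0 <= s by rewrite /s; lra.
(* With s half the perimeter, the estimate below gives I <= 4 e s^2, which contradicts this choice;
   the + 1 covers s = 0. *)
pose e := I / (8 * (s ^+ 2 + 1)).
have s21 : 0 < s ^+ 2 + 1 by rewrite ltr_wpDl ?sqr_ge0.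
have e0 : 0 < e by rewrite divr_gt0 // mulr_gt0.
have [d d0 hd] := diffE_eps dz e0.
have [n hn] : exists n, s / 2 ^+ n < d.
  have : (fun n => s * (2^-1) ^+ n) @ \oo --> (0 : R).
    rewrite -(mulr0 s); apply: cvgM; first exact: cvg_cst.
    by apply: cvg_expr; rewrite ger0_norm; lra.
  move=> /cvgrPdist_lt/(_ d d0)[n _ /(_ n (leqnn n))] /=.
  rewrite sub0r normrN ger0_norm; last by rewrite mulr_ge0 // exprn_ge0.
  by rewrite exprVn => ?; exists n.
have [/= p1 p2 p3 p4 p5] := Pst n.
set x := (st n).1 in p1 p2 p5; set y := (st n).2 in p3 p4 p5.
have hpn := hp n; have hqn := hq n; rewrite -/x in hpn; rewrite -/y in hqn.
have wn := w0 n; have hn0 := h0 n.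
have xw : x <= x + w n by rewrite lerDl.
have yh : y <= y + h n by rewrite lerDl.
have cgn := crect_sub cg p1 p2 p3 p4.
(* The tangent affine function of g at z integrates to 0 and is subtracted, leaving an integrand of
   size e s / 2^n on the n-th rectangle. *)
pose c1 := 'd g z 1; pose c0 := g z - c1 * z.
have caff : crect (fun u => - c0 + - c1 * u) x (x + w n) y (y + h n).
  by move=> u _ _; apply: differentiable_continuous; exact: differentiable_affine.
have E := rintD xw yh (crect_cbd cgn) (crect_cbd caff); rewrite rint_affine addr0 in E.
rewrite -E in p5.
have sn : w n + h n = s / 2 ^+ n by rewrite /w /h -mulrDl.
have hM (u : C) : x <= complex.Re u <= x + w n -> y <= complex.Im u <= y + h n ->
    rn (g u + (- c0 + - c1 * u)) <= e * (s / 2 ^+ n).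
  move=> hu1 hu2.
  have bu : rn (u - z) <= s / 2 ^+ n.
    apply: le_trans (rn_le_ReIm _) _; rewrite cReB cImB /= -sn.
    by rewrite lerD // ler_norml; lra.
  have := hd (u - z) (le_lt_trans bu hn).
  rewrite (linC ('d g z)) -/c1 (addrC z (u - z)) subrK => H.
  rewrite (_ : _ + _ = g u - g z - (u - z) * c1); last by rewrite /c0; ring.
  by apply: le_trans H _; rewrite ler_wpM2l // ltW.
have cD : crect (fun u => g u + (- c0 + - c1 * u)) x (x + w n) y (y + h n).
  by move=> u hu1 hu2; apply: continuousD; [exact: cgn|exact: caff].
have B := rint_bnd xw yh (crect_cbd cD) (fun u hu => let: And3 a b _ := hu in hM u a b).
rewrite (_ : _ + _ - _ + _ = s / 2 ^+ n) in B; last by rewrite -sn; ring.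
have t0 : 0 < 2 ^+ n :> R by rewrite exprn_gt0.
have E4 : 4 ^+ n = 2 ^+ n * 2 ^+ n :> R by rewrite -exprMn; congr (_ ^+ _); ring.
have B2 : I <= 4 * e * s ^+ 2.
  apply: le_trans p5 _; rewrite E4.
  apply: le_trans (ler_wpM2l (mulr_ge0 (ltW t0) (ltW t0)) B) _.
  by rewrite le_eqVlt; apply/orP; left; apply/eqP; field; rewrite gt_eqF.
have : 8 * e * (s ^+ 2 + 1) = I by rewrite /e; field; rewrite gt_eqF.
have := sqr_ge0 s; nra.
Qed.

(** The strips left and right of the square, then the pieces below and above it, avoid z and
    contribute 0 by [goursat]. *)
Lemma goursat_center g x1 x2 y1 y2 (z : C) (r : R) : 0 < r ->
  x1 <= complex.Re z - r -> complex.Re z + r <= x2 ->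
  y1 <= complex.Im z - r -> complex.Im z + r <= y2 ->
  (forall u : C, x1 <= complex.Re u <= x2 -> y1 <= complex.Im u <= y2 -> u <> z ->
     differentiable g u) ->
  rint g x1 x2 y1 y2 = rint g (complex.Re z - r) (complex.Re z + r)
    (complex.Im z - r) (complex.Im z + r).
Proof.
move=> r0 h1 h2 h3 h4 dg.
have D u1 u2 v1 v2 : x1 <= u1 -> u2 <= x2 -> y1 <= v1 -> v2 <= y2 ->
    [\/ u2 < complex.Re z, complex.Re z < u1, v2 < complex.Im z |
    complex.Im z < v1] -> drect g u1 u2 v1 v2.
  move=> a1 a2 a3 a4 hz u /andP[hu1 hu2] /andP[hv1 hv2]; apply: dg.
  - by rewrite (le_trans a1 hu1) (le_trans hu2 a2).
  - by rewrite (le_trans a3 hv1) (le_trans hv2 a4).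
  - by move=> E; move: hu1 hu2 hv1 hv2; rewrite E => *; case: hz; lra.
have B u1 u2 v1 v2 : x1 <= u1 -> u2 <= x2 -> y1 <= v1 -> v2 <= y2 ->
    u1 < complex.Re z < u2 -> v1 < complex.Im z < v2 -> cbd g u1 u2 v1 v2.
  move=> a1 a2 a3 a4 /andP[b1 b2] /andP[b3 b4] u [/andP[c1 c2] /andP[c3 c4] hu].
  apply: differentiable_continuous; apply: dg.
  - by rewrite (le_trans a1 c1) (le_trans c2 a2).
  - by rewrite (le_trans a3 c3) (le_trans c4 a4).
  - by move=> E; move: hu; rewrite E; case; lra.
pose a := complex.Re z - r; pose b := complex.Re z + r.
pose c := complex.Im z - r; pose d := complex.Im z + r.
rewrite -/a -/b -/c -/d.
have ha : a = complex.Re z - r by []. have hb : b = complex.Re z + r by [].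
have hc : c = complex.Im z - r by []. have hd : d = complex.Im z + r by [].
rewrite -(_ : rint g x1 a y1 y2 + rint g a x2 y1 y2 = rint g x1 x2 y1 y2);
  last by apply: rint_splitx; [lra|lra|apply: B; lra|lra].
rewrite (_ : rint g x1 a y1 y2 = 0); last first.
  by apply: goursat; [lra|lra|apply: D; [lra|lra|lra|lra|apply: Or41; lra]].
rewrite add0r -(_ : rint g a b y1 y2 + rint g b x2 y1 y2 = rint g a x2 y1 y2);
  last by apply: rint_splitx; [lra|lra|apply: B; lra|lra].
rewrite (_ : rint g b x2 y1 y2 = 0); last first.
  by apply: goursat; [lra|lra|apply: D; [lra|lra|lra|lra|apply: Or42; lra]].
rewrite addr0 -(_ : rint g a b y1 c + rint g a b c y2 = rint g a b y1 y2);
  last by apply: rint_splity; [lra|lra|apply: B; lra|lra].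
rewrite (_ : rint g a b y1 c = 0); last first.
  by apply: goursat; [lra|lra|apply: D; [lra|lra|lra|lra|apply: Or43; lra]].
rewrite add0r -(_ : rint g a b c d + rint g a b d y2 = rint g a b c y2);
  last by apply: rint_splity; [lra|lra|apply: B; lra|lra].
rewrite (_ : rint g a b d y2 = 0); last first.
  by apply: goursat; [lra|lra|apply: D; [lra|lra|lra|lra|apply: Or44; lra]].
by rewrite addr0.
Qed.

End Goursat.

Section Cauchy.
Context {R : realType}.
Local Notation C := R[i].
Local Notation crect := (@crect R).
Local Notation rint := (@rint R).
Local Notation cbd := (@cbd R).

(* Equal to 2 pi i, but only [kappa != 0] matters. *)
Definition kappa : C := rint (fun u => u^-1) (-1) 1 (-1) 1.

Lemma rbd1_neq0 (u : C) : rbd (-1) 1 (-1) 1 u -> 1 <= rn u.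
Proof.
have hR := ler_Re_rn u; have hI := ler_Im_rn u.
move=> [_ _ [E|E|E|E]]; rewrite E ?normrN normr1 in hR hI; lra.
Qed.

Lemma rn_ge1_neq0 (u : C) : 1 <= rn u -> u != 0.
Proof. by move=> h; rewrite -rn_gt0; lra. Qed.

Lemma cont_inv (u : C) : u != 0 -> {for u, continuous (fun x : C => x^-1)}.
Proof.
move=> u0; apply: differentiable_continuous; by apply: differentiableV.
Qed.

Lemma cbd_inv : cbd (fun u : C => u^-1) (-1) 1 (-1) 1.
Proof. by move=> u /rbd1_neq0/rn_ge1_neq0; exact: cont_inv. Qed.

Lemma Im_div_ge (c u : C) : 0 < complex.Re u ^+ 2 + complex.Im u ^+ 2 <= 2 ->
  2 <= complex.Im c * complex.Re u - complex.Re c * complex.Im u ->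
  1 <= complex.Im (c * u^-1).
Proof.
move=> /andP[h1 h2] h3.
rewrite cImM /= (_ : _ + _ = (complex.Im c * complex.Re u -
  complex.Re c * complex.Im u) / (complex.Re u ^+ 2 + complex.Im u ^+ 2)).
  by rewrite ler_pdivlMr // mul1r; lra.
by case: u h1 h2 h3 => x y /= *; field; rewrite gt_eqF.
Qed.

(** Every edge contributes at least 1 to the imaginary part (in truth pi / 2): there |u|^2 <= 2,
    while the numerator of the imaginary part of du / u is exactly 2. *)
Lemma kappa_neq0 : kappa != 0.
Proof.
have L11 : -1 <= 1 :> R by lra.
have ch (y : R) : y = -1 \/ y = 1 -> cseg (fun u : C => u^-1) ((-1) +i* y) (1 +i* y).
  exact: (cseg_h L11 L11 cbd_inv).
have cv (x : R) : x = -1 \/ x = 1 -> cseg (fun u : C => u^-1) (x +i* (-1)) (x +i* 1).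
  exact: (cseg_v L11 L11 cbd_inv).
have sq (s : R) : 0 <= s <= 1 -> (-1 + s * (1 - -1)) ^+ 2 <= 1.
  by move=> /andP[? ?]; nra.
have h1 : 1 <= complex.Im (1 * hint (fun u : C => u^-1) (-1) (-1) 1).
  apply: Im_lint_ge (ch _ (or_introl erefl)) _ => s /sq h; rewrite segh.
  apply: Im_div_ge => /=; have := sqr_ge0 (-1 + s * (1 - -1)); lra.
have h2 : 1 <= complex.Im (-1 * hint (fun u : C => u^-1) 1 (-1) 1).
  apply: Im_lint_ge (ch _ (or_intror erefl)) _ => s /sq h; rewrite segh.
  apply: Im_div_ge => /=; have := sqr_ge0 (-1 + s * (1 - -1)); lra.
have h3 : 1 <= complex.Im (1 * vint (fun u : C => u^-1) 1 (-1) 1).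
  apply: Im_lint_ge (cv _ (or_intror erefl)) _ => s /sq h; rewrite segv.
  apply: Im_div_ge => /=; have := sqr_ge0 (-1 + s * (1 - -1)); lra.
have h4 : 1 <= complex.Im (-1 * vint (fun u : C => u^-1) (-1) (-1) 1).
  apply: Im_lint_ge (cv _ (or_introl erefl)) _ => s /sq h; rewrite segv.
  apply: Im_div_ge => /=; have := sqr_ge0 (-1 + s * (1 - -1)); lra.
have : 4 <= complex.Im kappa.
  rewrite !mul1r !mulN1r in h1 h2 h3 h4.
  rewrite /kappa rintE cImB cImD cImB.
  move: h1 h2 h3 h4; rewrite !cImN; lra.
by apply: contraTneq => ->; rewrite -ltNge /=; lra.
Qed.

Lemma cauchy f x1 x2 y1 y2 z : drect f x1 x2 y1 y2 ->
  x1 < complex.Re z < x2 -> y1 < complex.Im z < y2 ->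
  rint (fun u => f u * (u - z)^-1) x1 x2 y1 y2 = kappa * f z.
Proof.
move=> df /andP[hx1 hx2] /andP[hy1 hy2].
have L11 : -1 <= 1 :> R by lra.
have dz : differentiable f z by apply: df; rewrite !ltW.
have /ctsP cf := differentiable_continuous dz.
apply/eqP; rewrite -subr_eq0 -rn_eq0 eq_le rn_ge0 andbT.
apply/ler_addgt0Pl => e e0; rewrite addr0.
(* On the square [-1, 1]^2 the constant in [rint_bnd] is 4 (2 + 2) = 16. *)
have e16 : 0 < e / 16 by rewrite divr_gt0.
have /nbhs_rnP[d d0 hd] := cf _ e16.
(* Since |w| <= 2 on the unit square, the points z + r w stay within d / 2 of z; the other bounds
   keep the small square inside the rectangle. *)
pose r := Num.min (d / 4) (Num.min (Num.min (complex.Re z - x1)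
  (x2 - complex.Re z)) (Num.min (complex.Im z - y1) (y2 - complex.Im z))).
have r0 : 0 < r by rewrite !lt_min !subr_gt0 hx1 hx2 hy1 hy2 divr_gt0.
have [rd [[r1 r2] [r3 r4]]] : r <= d / 4 /\ ((r <= complex.Re z - x1 /\
   r <= x2 - complex.Re z) /\ (r <= complex.Im z - y1 /\ r <= y2 - complex.Im z)).
  have : r <= r by []. 
  by rewrite {2}/r !le_min => /and3P[-> /andP[-> ->] /andP[-> ->]].
have dg u : x1 <= complex.Re u <= x2 -> y1 <= complex.Im u <= y2 -> u <> z ->
    differentiable (fun u => f u * (u - z)^-1) u.
  move=> h1 h2 /eqP uz; apply: differentiableM; first exact: df.
  apply: differentiableV; last by rewrite subr_eq0.
  by apply: differentiableB; [exact: differentiable_idfun|exact: differentiable_cst].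
rewrite (goursat_center r0 _ _ _ _ dg); [|lra|lra|lra|lra].
rewrite rint_square.
have dfr (w : C) : rbd (-1) 1 (-1) 1 w ->
    differentiable (fun w => f (z + r%:C * w)) w.
  move=> [/andP[a1 a2] /andP[a3 a4] _].
  apply: (differentiable_comp (g := f)); first exact: differentiable_affine.
  have r0' := ltW r0; apply: df.
    by rewrite cReD cReM /= mul0r subr0; apply/andP; split; nra.
  by rewrite cImD cImM /= mul0r addr0; apply/andP; split; nra.
have c1 : cbd (fun w => f (z + r%:C * w) - f z) (-1) 1 (-1) 1.
  move=> w hw; apply: differentiable_continuous; apply: differentiableB.
    exact: dfr.
  exact: differentiable_cst.
have c2 : cbd (fun w => (f (z + r%:C * w) - f z) * w^-1) (-1) 1 (-1) 1.
  by move=> w hw; apply: continuousM; [exact: c1|exact: cbd_inv].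
have c3 : cbd (fun w => f z * w^-1) (-1) 1 (-1) 1.
  by move=> w hw; apply: continuousM; [exact: cst_continuous|exact: cbd_inv].
have rC0 : r%:C != 0 :> C by rewrite -rn_gt0 rnR gtr0_norm.
(* The scaling factor r cancels. The constant part f z / w integrates to [kappa * f z], and the
   remainder is small by continuity at z. *)
rewrite (@eq_rint _ _ (fun w => r%:C^-1 *
    (f z * w^-1 + (f (z + r%:C * w) - f z) * w^-1))) //; last first.
  move=> w /rbd1_neq0/rn_ge1_neq0 w0.
  by rewrite addrAC subrr add0r; field; rewrite w0 rC0.
have c4 : cbd (fun w => f z * w^-1 + (f (z + r%:C * w) - f z) * w^-1) (-1) 1 (-1) 1.
  by move=> w hw; apply: continuousD; [exact: c3|exact: c2].
have E1 := rintZ r%:C^-1 L11 L11 c4; have E2 := rintD L11 L11 c3 c2.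
have E3 := rintZ (f z) L11 L11 cbd_inv.
rewrite E1 E2 E3 mulrA divff // mul1r.
rewrite -/kappa mulrC addrAC subrr add0r.
have := rint_bnd L11 L11 c2 (M := e / 16).
move=> /(_ _)/le_trans; apply; last by lra.
move=> w hw; have w1 := rbd1_neq0 hw; rewrite rnM rnV.
have b1 : rn (f (z + r%:C * w) - f z) <= e / 16.
  apply/ltW/hd; rewrite addrAC subrr add0r rnM rnR gtr0_norm //.
  have : rn w <= 2.
    apply: le_trans (rn_le_ReIm _) _; case: hw => [/andP[? ?] /andP[? ?] _].
    by rewrite (_ : 2 = 1 + 1) // lerD // ler_norml; apply/andP; split; lra.
  by have := rn_ge0 w; nra.
apply: le_trans b1; rewrite ler_piMr ?rn_ge0 // invf_le1 //; lra.
Qed.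

(** The constant 16 of [rint_bnd] on the unit square, times the bound 2 for the Taylor kernels,
    divided by the modulus of [kappa]. *)
Definition Kc : R := 32 / rn kappa.

Lemma Kc_gt0 : 0 < Kc.
Proof. by rewrite divr_gt0 // rn_gt0 kappa_neq0. Qed.

(** Cauchy's formula for G'(0). It is controlled by the values on the boundary alone, so it behaves
    well for uniform limits not yet known to be holomorphic. *)
Definition deriv1 (G : C -> C) : C :=
  kappa^-1 * rint (fun u => G u * (u^-1 * u^-1)) (-1) 1 (-1) 1.

Lemma rint1_bnd (G : C -> C) (M : R) (k : C -> C) (B : R) :
  cbd G (-1) 1 (-1) 1 ->
  (forall u, rbd (-1) 1 (-1) 1 u -> rn (G u) <= M) ->
  (forall u, rbd (-1) 1 (-1) 1 u -> {for u, continuous k} /\ rn (k u) <= B) ->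
  rn (kappa^-1 * rint (fun u => G u * k u) (-1) 1 (-1) 1) <= Kc * M * (B / 2).
Proof.
move=> cG hM hk; have L11 : -1 <= 1 :> R by lra.
have k0 : 0 < rn kappa by rewrite rn_gt0 kappa_neq0.
have bd1 : rbd (-1) 1 (-1) 1 (1 : C).
  by split => /=; [lra|lra|apply: Or42].
have M0 : 0 <= M by apply: le_trans (rn_ge0 (G 1)) (hM _ bd1).
have B0 : 0 <= B by have [_] := hk 1 bd1; apply: le_trans (rn_ge0 _).
rewrite rnM rnV.
have := @rint_bnd _ (fun u => G u * k u) _ _ _ _ L11 L11 _ (M * B).
move=> /(_ _ _) hb.
rewrite mulrC ler_pdivrMr //; apply: le_trans (hb _ _) _.
- by move=> u hu; apply: continuousM; [exact: cG|case: (hk u hu)].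
- move=> u hu; rewrite rnM; case: (hk u hu) => _ h.
  by rewrite ler_pM ?rn_ge0 // hM.
- rewrite /Kc (_ : _ / _ * _ * _ * _ = 16 * (M * B)); last by field; rewrite gt_eqF.
  lra.
Qed.

Lemma deriv1_bnd (G : C -> C) (M : R) : cbd G (-1) 1 (-1) 1 ->
  (forall u, rbd (-1) 1 (-1) 1 u -> rn (G u) <= M) -> rn (deriv1 G) <= Kc * M.
Proof.
move=> cG hM.
have M0 : 0 <= M.
  apply: le_trans (rn_ge0 (G 1)) (hM _ _).
  by split => /=; [lra|lra|apply: Or42].
apply: le_trans (rint1_bnd (B := 1) cG hM _) _ => [u hu|]; last first.
  by have := mulr_ge0 (ltW Kc_gt0) M0; lra.
split; first by apply: continuousM; exact: cbd_inv.
have h : rn u^-1 <= 1.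
  by have := rbd1_neq0 hu => h; rewrite rnV invf_le1; lra.
by rewrite rnM; have := rn_ge0 u^-1; nra.
Qed.

Lemma deriv1D (G H : C -> C) : cbd G (-1) 1 (-1) 1 -> cbd H (-1) 1 (-1) 1 ->
  deriv1 (fun u => G u + H u) = deriv1 G + deriv1 H.
Proof.
move=> cG cH; have L11 : -1 <= 1 :> R by lra.
have cw F : cbd F (-1) 1 (-1) 1 -> cbd (fun u => F u * (u^-1 * u^-1)) (-1) 1 (-1) 1.
  move=> cF u hu; apply: continuousM; first exact: cF.
  by apply: continuousM; exact: cbd_inv.
have E := rintD L11 L11 (cw _ cG) (cw _ cH).
rewrite /deriv1 -mulrDr -E; congr (_ * _); apply: eq_rint => // u _.
by rewrite mulrDl.
Qed.

(** Insert 1/(u-t) = 1/u + t/(u(u-t)), respectively 1/(u-t) = 1/u + t/u^2 + t^2/(u^2(u-t)), into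
    Cauchy's formula. On the boundary |u| >= 1 and |u - t| >= 1/2, so the last kernels are at most
    2. *)
Lemma taylor1 (G : C -> C) (M : R) : drect G (-1) 1 (-1) 1 ->
  (forall u, rbd (-1) 1 (-1) 1 u -> rn (G u) <= M) ->
  [/\ forall t : C, rn t <= 1 / 2 -> rn (G t - G 0) <= Kc * M * rn t &
    forall t : C, rn t <= 1 / 2 ->
      rn (G t - G 0 - t * deriv1 G) <= Kc * M * rn t ^+ 2].
Proof.
move=> dG hM; have L11 : -1 <= 1 :> R by lra.
have cG : cbd G (-1) 1 (-1) 1 by apply/crect_cbd/drect_crect.
have H k B := @rint1_bnd G M k B cG hM.
have cau (t : C) : rn t <= 1 / 2 ->
    G t = kappa^-1 * rint (fun u => G u * (u - t)^-1) (-1) 1 (-1) 1.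
  move=> ht; rewrite (cauchy (z := t) dG); first by rewrite mulKf // kappa_neq0.
    have := ler_Re_rn t; rewrite ler_norml => /andP[? ?]; apply/andP; split; lra.
  have := ler_Im_rn t; rewrite ler_norml => /andP[? ?]; apply/andP; split; lra.
have far (t u : C) : rn t <= 1 / 2 -> rbd (-1) 1 (-1) 1 u -> 1 / 2 <= rn (u - t).
  move=> ht [_ _ hu].
  have := ler_Re_rn t; rewrite ler_norml => /andP[r1 r2].
  have := ler_Im_rn t; rewrite ler_norml => /andP[i1 i2].
  case: hu => E; [have := ler_Re_rn (u - t)|have := ler_Re_rn (u - t)|
    have := ler_Im_rn (u - t)|have := ler_Im_rn (u - t)];
    rewrite ?cReB ?cImB E ler_norml => /andP[? ?]; lra.
have cfar (t u : C) : rn t <= 1 / 2 -> rbd (-1) 1 (-1) 1 u ->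
    u - t != 0 /\ {for u, continuous (fun u => (u - t)^-1)}.
  move=> ht hu; have := far t u ht hu => h.
  have n0 : u - t != 0 by rewrite -rn_gt0; lra.
  by split => //; apply: differentiable_continuous; apply: differentiableV.
have inv2 (x : C) : 1 / 2 <= rn x -> rn x^-1 <= 2.
  by move=> h; rewrite rnV -[leRHS]invrK lef_pV2 ?posrE; lra.
have inv1 (x : C) : 1 <= rn x -> rn x^-1 <= 1.
  by move=> h; rewrite rnV invf_le1; lra.
have c0 : rn (0 : C) <= 1 / 2 by rewrite rn0; lra.
have cm (f g : C -> C) : cbd f (-1) 1 (-1) 1 -> cbd g (-1) 1 (-1) 1 ->
    cbd (fun u => f u * g u) (-1) 1 (-1) 1.
  by move=> cf cg u hu; exact: (continuousM (cf u hu) (cg u hu)).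
have cT t : rn t <= 1 / 2 -> cbd (fun u => (u - t)^-1) (-1) 1 (-1) 1.
  by move=> ht u hu; have [_] := cfar t u ht hu.
have C0 : cbd (fun u => G u * (u - 0)^-1) (-1) 1 (-1) 1.
  exact: cm cG (cT 0 c0).
have cc (c : C) g : cbd g (-1) 1 (-1) 1 -> cbd (fun u => c * g u) (-1) 1 (-1) 1.
  by move=> cg u hu; apply: continuousM; [exact: cst_continuous|exact: cg].
have ca f g : cbd f (-1) 1 (-1) 1 -> cbd g (-1) 1 (-1) 1 ->
    cbd (fun u => f u + g u) (-1) 1 (-1) 1.
  by move=> cf cg u hu; apply: continuousD; [exact: cf|exact: cg].
split.
- move=> t ht; rewrite (cau t ht) (cau 0 c0) -mulrBr.
  have C1 : cbd (fun u => G u * ((u - t)^-1 * u^-1)) (-1) 1 (-1) 1.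
    exact: cm cG (cm _ _ (cT t ht) cbd_inv).
  have E : rint (fun u => G u * (u - t)^-1) (-1) 1 (-1) 1 =
      rint (fun u => G u * (u - 0)^-1 + t * (G u * ((u - t)^-1 * u^-1))) (-1) 1 (-1) 1.
    apply: eq_rint => // u hu; rewrite subr0.
    have [n0 _] := cfar t u ht hu; have u0 := rn_ge1_neq0 (rbd1_neq0 hu).
    by field; rewrite n0 u0.
  have E1 := rintD L11 L11 C0 (cc t _ C1); have E2 := rintZ t L11 L11 C1.
  rewrite E E1 E2 addrAC subrr add0r mulrCA rnM mulrC ler_wpM2r ?rn_ge0 //.
  apply: le_trans (H _ 2 _) _ => [u hu|]; last by rewrite divff ?mulr1.
  split; first exact: (cm _ _ (cT t ht) cbd_inv).
  have h := inv1 u (rbd1_neq0 hu); have h' := inv2 _ (far t u ht hu).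
  by rewrite rnM -[leRHS]mulr1 ler_pM ?rn_ge0.
- move=> t ht; rewrite (cau t ht) (cau 0 c0) -mulrBr /deriv1 mulrCA -mulrBr.
  have C1 : cbd (fun u => G u * (u^-1 * u^-1)) (-1) 1 (-1) 1.
    exact: cm cG (cm _ _ cbd_inv cbd_inv).
  have C2 : cbd (fun u => G u * ((u - t)^-1 * (u^-1 * u^-1))) (-1) 1 (-1) 1.
    exact: cm cG (cm _ _ (cT t ht) (cm _ _ cbd_inv cbd_inv)).
  have E : rint (fun u => G u * (u - t)^-1) (-1) 1 (-1) 1 =
      rint (fun u => G u * (u - 0)^-1 + (t * (G u * (u^-1 * u^-1)) +
        (t * t) * (G u * ((u - t)^-1 * (u^-1 * u^-1))))) (-1) 1 (-1) 1.
    apply: eq_rint => // u hu; rewrite subr0.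
    have [n0 _] := cfar t u ht hu; have u0 := rn_ge1_neq0 (rbd1_neq0 hu).
    by field; rewrite n0 u0.
  have C3 := ca _ _ (cc t _ C1) (cc (t * t) _ C2).
  have E0 := rintD L11 L11 C0 C3.
  have E1 := rintD L11 L11 (cc t _ C1) (cc (t * t) _ C2).
  have E2 := rintZ t L11 L11 C1; have E3 := rintZ (t * t) L11 L11 C2.
  rewrite E E0 E1 E2 E3.
  rewrite (_ : _ + (_ + _) - _ - _ = (t * t) * rint (fun u => G u *
    ((u - t)^-1 * (u^-1 * u^-1))) (-1) 1 (-1) 1); last by ring.
  rewrite mulrCA rnM mulrC rnM -expr2 ler_wpM2r ?sqr_ge0 //.
  apply: le_trans (H _ 2 _) _ => [u hu|]; last by rewrite divff ?mulr1.
  split; first exact: (cm _ _ (cT t ht) (cm _ _ cbd_inv cbd_inv)).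
  have h := inv1 u (rbd1_neq0 hu); have h' := inv2 _ (far t u ht hu).
  rewrite rnM -[leRHS]mulr1 ler_pM ?rn_ge0 // rnM.
  by have := rn_ge0 u^-1; nra.
Qed.

End Cauchy.

(** * Functions of several variables *)

Section SeveralVariables.
Context {R : realType}.
Local Notation C := R[i].
Local Notation cbd := (@cbd R).
Variable N : nat.
Implicit Types (f g : 'rV[C]_N -> C) (z k y : 'rV[C]_N).

Lemma differentiable_line z k (t : C) : differentiable (fun t : C => z + t *: k) t.
Proof.
apply: differentiableD; first exact: differentiable_cst.
exact: differentiableZl (differentiable_idfun _).
Qed.

Lemma slice_diff f z k t : differentiable f (z + t *: k) ->
  differentiable (fun t : C => f (z + t *: k)) t.
Proof.
by move=> df; apply: (differentiable_comp (g := f)) => //; exact: differentiable_line.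
Qed.

Section slice.
Variables (f : 'rV[C]_N -> C) (z : 'rV[C]_N) (r M : R).
Hypothesis r0 : 0 < r.
Hypothesis df : forall y, rn (y - z) < r -> differentiable f y.
Hypothesis fM : forall y, rn (y - z) < r -> rn (f y) <= M.

Lemma rn2 (t : C) : -1 <= complex.Re t <= 1 -> -1 <= complex.Im t <= 1 -> rn t <= 2.
Proof.
move=> h1 h2; apply: le_trans (rn_le_ReIm _) _.
by rewrite (_ : 2 = 1 + 1) // lerD // ler_norml.
Qed.

(** On the square |t| <= 2, so z + t k stays within r / 2 of z. *)
Lemma slice_drect k : rn k <= r / 4 ->
  drect (fun t : C => f (z + t *: k)) (-1) 1 (-1) 1 /\
  (forall u, rbd (-1) 1 (-1) 1 u -> rn (f (z + u *: k)) <= M).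
Proof.
move=> hk.
have r0' := r0.
have H (t : C) : -1 <= complex.Re t <= 1 -> -1 <= complex.Im t <= 1 ->
    rn (z + t *: k - z) < r.
  move=> h1 h2; rewrite addrAC subrr add0r rnZ.
  by apply: le_lt_trans (ler_pM (rn_ge0 t) (rn_ge0 k) (rn2 h1 h2) hk) _; lra.
split; first by move=> t h1 h2; apply: slice_diff; apply: df; exact: H.
by move=> u [h1 h2 _]; apply: fM; exact: H.
Qed.

(** Both sides are the first-order coefficient of f (z + t k) at t = 0. They are compared at one
    small real t, whose three upper bounds serve [taylor1], the differentiability of f at z and the
    final estimate. *)
Lemma slice_deriv k : rn k <= r / 4 ->
  'd f z k = deriv1 (fun t : C => f (z + t *: k)).
Proof.
move=> hk; have [dG GM] := slice_drect hk.
have [_ T] := taylor1 dG GM.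
have M0 : 0 <= M.
  by apply: le_trans (rn_ge0 (f z)) (fM _); rewrite subrr rn0.
set D := deriv1 _ in T *.
have dz : differentiable f z by apply: df; rewrite subrr rn0.
apply/eqP; rewrite -subr_eq0 -rn_eq0 eq_le rn_ge0 andbT.
apply/ler_addgt0Pl => e e0; rewrite addr0.
have K0 := @Kc_gt0 R.
pose e1 := e / (2 * (rn k + 1)).
have k1 : 0 < rn k + 1 by rewrite ltr_wpDl ?rn_ge0.
have e10 : 0 < e1 by rewrite divr_gt0 // mulr_gt0.
have [d d0 hd] := diffE_eps dz e10.
pose t : R := Num.min (1 / 2) (Num.min (d / (2 * (rn k + 1))) (e / (2 * (Kc * M + 1)))).
have A0 : 0 < Kc * M + 1 :> R by rewrite ltr_wpDl // mulr_ge0 // ltW.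
have t0 : 0 < t.
  by rewrite !lt_min !divr_gt0 ?mulr_gt0.
have [t1 t2 t3] : [/\ t <= 1 / 2, t <= d / (2 * (rn k + 1)) &
    t <= e / (2 * (Kc * M + 1))].
  have : t <= t by []. by rewrite {2}/t !le_min => /and3P[].
have rt : rn (t%:C : C) = t by rewrite rnR gtr0_norm.
have h1 : rn (t%:C *: k) < d.
  rewrite rnZ rt; rewrite ler_pdivlMr ?mulr_gt0 // in t2.
  by have := rn_ge0 k; nra.
have B1 := hd _ h1.
have B2 : rn (t%:C : C) <= 1 / 2 by rewrite rt.
have {}B2 := T _ B2; rewrite scale0r addr0 rt in B2.
rewrite linearZ /= rnZ rt in B1.
rewrite -(ler_pM2l t0).
have -> : t * rn ('d f z k - D) = rn (t%:C * ('d f z k - D)) by rewrite rnM rt.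
have -> : t%:C * ('d f z k - D) = (f (z + t%:C *: k) - f z - t%:C * D) -
    (f (z + t%:C *: k) - f z - t%:C * 'd f z k) by ring.
apply: le_trans (ler_rnB _ _) _; apply: le_trans (lerD B2 B1) _.
rewrite ler_pdivlMr ?mulr_gt0 // in t3.
have E1 : 2 * (e1 * (t * rn k)) <= t * e.
  have Ee : e = e1 * (2 * (rn k + 1)) by rewrite /e1 divfK // gt_eqF ?mulr_gt0.
  rewrite [in leRHS]Ee -subr_ge0 (_ : _ - _ = 2 * (t * e1)); last by ring.
  by rewrite mulr_ge0 // mulr_ge0 ?ltW.
have E2 : 2 * (Kc * M * t ^+ 2) <= t * e.
  have := ler_wpM2l (ltW t0) t3; have := sqr_ge0 t; rewrite expr2; lra.
lra.
Qed.

(** Rescale k to norm r / 4 and use [taylor1] on that complex line at the parameter 4 |k| / r. The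
    constants depend on r and M only. *)
Lemma taylorN k : rn k <= r / 8 ->
  rn (f (z + k) - f z) <= Kc * M * (4 / r * rn k) /\
  rn (f (z + k) - f z - 'd f z k) <= Kc * M * (4 / r * rn k) ^+ 2.
Proof.
have [->|k0] := eqVneq k 0.
  by rewrite addr0 subrr sub0r rnN linear0 !rn0 !mulr0 expr0n mulr0 lexx.
move=> hk8; have hk : 0 < rn k by rewrite rn_gt0.
pose c : R := 4 / r * rn k; have c0 : 0 < c by rewrite mulr_gt0 // divr_gt0.
pose k' := c^-1%:C *: k.
have rk' : rn k' = r / 4.
  by rewrite rnZ rnR gtr0_norm ?invr_gt0 // /c; field; rewrite !gt_eqF.
have Ek : k = c%:C *: k'.
  by rewrite scalerA -rmorphM /= divff ?gt_eqF // scale1r.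
have rc : rn (c%:C : C) = c by rewrite rnR gtr0_norm.
have c12 : rn (c%:C : C) <= 1 / 2.
  rewrite rc /c mulrAC ler_pdivrMr //; lra.
have rk4 : rn k' <= r / 4 by rewrite rk'.
have [dG GM] := slice_drect rk4.
have [T1 T2] := taylor1 dG GM.
have := T1 _ c12; have := T2 _ c12; rewrite -slice_deriv // scale0r addr0 rc -Ek.
have -> : 'd f z k = c%:C * 'd f z k' by rewrite {1}Ek linearZ.
by [].
Qed.
End slice.

Definition dirv (j : 'I_N) : 'rV[C]_N := delta_mx 0 j.

Lemma row_sum_dirv k : k = \sum_j k 0 j *: dirv j.
Proof. exact: row_sum_delta. Qed.

Lemma rn_dirv j : rn (dirv j) <= 1.
Proof.
apply: rn_le_coord => // i; rewrite mxE eqxx /=.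
by case: (i == j); rewrite ?rn1 ?rn0.
Qed.

Lemma diff_sum f z k : 'd f z k = \sum_j k 0 j * 'd f z (dirv j).
Proof.
rewrite {1}(row_sum_dirv k) linear_sum; apply: eq_bigr => j _.
by rewrite linearZ.
Qed.

Lemma diff_quad f z (a : 'I_N -> C) (r A : R) : 0 < r -> 0 <= A ->
  (forall k, rn k <= r -> rn (f (z + k) - f z - \sum_j k 0 j * a j) <= A * rn k ^+ 2) ->
  differentiable f z.
Proof.
move=> r0 A0 h; apply: (proj1 (@diff_intro_eps _ _ C f z a _)) => e e0.
have A1 : 0 < A + 1 by rewrite ltr_wpDl.
exists (Num.min r (e / (A + 1))); first by rewrite lt_min r0 divr_gt0.
move=> k; rewrite lt_min ltr_pdivlMr // => /andP[/ltW kr ke].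
apply: le_trans (h _ kr) _; rewrite expr2 mulrA ler_wpM2r ?rn_ge0 //.
by have := rn_ge0 k; lra.
Qed.

(** This is Weierstrass' theorem. The candidate derivative of f is given by Cauchy integrals of f
    itself; [taylorN] holds for every approximant g with the same constant, so the quadratic
    estimate survives in the limit. *)
Lemma hol_closure f z (r M : R) : 0 < r ->
  (forall e : R, 0 < e -> exists g, forall y, rn (y - z) < r ->
     [/\ differentiable g y, rn (g y) <= M & rn (f y - g y) <= e]) ->
  differentiable f z.
Proof.
move=> r0 h.
have rz y : y = z -> rn (y - z) < r by move=> ->; rewrite subrr rn0.
have M0 : 0 <= M.
  have [g hg] := h 1 ltr01; have [_ + _] := hg z (rz z erefl).
  exact: le_trans (rn_ge0 _).
have K0 := @Kc_gt0 R; have r4 : 0 < r / 4 by lra.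
have cf y : rn (y - z) < r -> {for y, continuous f}.
  move=> yr; apply/ctsP => e e0; have e3 : 0 < e / 3 by lra.
  have [g hg] := h _ e3; have [dg _ h1] := hg y yr.
  have /ctsP/(_ _ e3) := differentiable_continuous dg => /nbhs_rnP[d d0 hd].
  apply/nbhs_rnP; exists (Num.min d (r - rn (y - z))).
    by rewrite lt_min d0 subr_gt0.
  move=> x; rewrite lt_min => /andP[xd xr].
  have xz : rn (x - z) < r.
    by rewrite -(subrK y x) -addrA; apply: le_lt_trans (ler_rnD _ _) _; lra.
  have [_ _ h2] := hg x xz; have h3 := hd x xd.
  rewrite (_ : f x - f y = (f x - g x) + (g x - g y) - (f y - g y)); last by ring.
  apply: le_lt_trans (ler_rnB _ _) _.
  by apply: le_lt_trans (lerD (ler_rnD _ _) (lexx _)) _; lra.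
pose v j := (r / 4)%:C *: dirv j.
have rv j : rn (v j) <= r / 4.
  by rewrite rnZ rnR gtr0_norm // ler_piMr ?rn_dirv // ltW.
(* The j-th partial derivative, computed along the rescaled direction [v j] for which [slice_deriv]
   is available. *)
pose a j : C := (r / 4)^-1%:C * deriv1 (fun u : C => f (z + u *: v j)).
pose A : R := Kc * M * (4 / r) ^+ 2.
have A0 : 0 <= A by rewrite /A mulr_ge0 ?sqr_ge0 // mulr_ge0 // ltW.
apply: (@diff_quad f z a (r / 8) A) => //; first by lra.
move=> k hk; apply/ler_addgt0Pl => e e0.
(* An approximation of f within e / B makes the total error exactly e: 2 for the values at z and z +
   k, the sum for the partial derivatives. *)
pose B : R := 2 + (\sum_(j < N) rn (k 0 j)) * ((r / 4)^-1 * Kc).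
have S0 : 0 <= \sum_(j < N) rn (k 0 j) by apply: sumr_ge0 => j _; exact: rn_ge0.
have B0 : 0 < B.
  by rewrite ltr_pwDl // mulr_ge0 // mulr_ge0 ?ltW // invr_gt0.
have eB : 0 < e / B by rewrite divr_gt0.
have [g hg] := h _ eB.
have dg y : rn (y - z) < r -> differentiable g y by move=> /hg[].
have gM y : rn (y - z) < r -> rn (g y) <= M by move=> /hg[].
have gf y : rn (y - z) < r -> rn (f y - g y) <= e / B by move=> /hg[].
have [_ T] := taylorN r0 dg gM hk.
have E j : a j - 'd g z (dirv j) =
    (r / 4)^-1%:C * deriv1 (fun u : C => f (z + u *: v j) - g (z + u *: v j)).
  have -> : 'd g z (dirv j) = (r / 4)^-1%:C * 'd g z (v j).
    by rewrite /v linearZ /= mulrA -rmorphM /= mulVf ?gt_eqF // mul1r.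
  rewrite (slice_deriv r0 dg gM (rv j)) /a -mulrBr; congr (_ * _).
  have inb (u : C) : rbd (-1) 1 (-1) 1 u -> rn (z + u *: v j - z) < r.
    move=> [h1 h2 _]; rewrite addrAC subrr add0r rnZ.
    by apply: le_lt_trans (ler_pM (rn_ge0 u) (rn_ge0 (v j)) (rn2 h1 h2) (rv j)) _; lra.
  have c1 : cbd (fun u : C => f (z + u *: v j) - g (z + u *: v j)) (-1) 1 (-1) 1.
    move=> u hu; apply: continuousB.
      apply: (continuous_comp (g := f)); last exact/cf/inb.
      exact/differentiable_continuous/differentiable_line.
    by apply/differentiable_continuous/slice_diff/dg/inb.
  have c2 : cbd (fun u : C => g (z + u *: v j)) (-1) 1 (-1) 1.
    by move=> u hu; apply/differentiable_continuous/slice_diff/dg/inb.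
  have D := deriv1D c1 c2.
  apply/eqP; rewrite subr_eq -D; apply/eqP; congr deriv1.
  by apply/funext => u; rewrite subrK.
have b j : rn (a j - 'd g z (dirv j)) <= (r / 4)^-1 * (Kc * (e / B)).
  rewrite E rnM rnR gtr0_norm ?invr_gt0 //.
  apply: ler_wpM2l; first by rewrite invr_ge0 ltW.
  have inb (u : C) : rbd (-1) 1 (-1) 1 u -> rn (z + u *: v j - z) < r.
    move=> [h1 h2 _]; rewrite addrAC subrr add0r rnZ.
    by apply: le_lt_trans (ler_pM (rn_ge0 u) (rn_ge0 (v j)) (rn2 h1 h2) (rv j)) _; lra.
  apply: (@deriv1_bnd R _ (e / B)) => [u hu|u hu]; last exact/gf/inb.
  apply: continuousB.
    apply: (continuous_comp (g := f)); last exact/cf/inb.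
    exact/differentiable_continuous/differentiable_line.
  by apply/differentiable_continuous/slice_diff/dg/inb.
have zk : rn (z + k - z) < r by rewrite addrAC subrr add0r; lra.
rewrite (_ : f (z + k) - _ - _ = (g (z + k) - g z - 'd g z k) +
  ((f (z + k) - g (z + k)) - (f z - g z)) -
  \sum_j k 0 j * (a j - 'd g z (dirv j))); last first.
  under [X in _ = _ - X]eq_bigr do rewrite mulrBr.
  by rewrite sumrB (diff_sum g z k); ring.
apply: le_trans (ler_rnB _ _) _; rewrite addrC.
have F1 : rn ((f (z + k) - g (z + k)) - (f z - g z)) <= 2 * (e / B).
  apply: le_trans (ler_rnB _ _) _; rewrite mulrDl mul1r.
  by rewrite lerD ?gf // rz.
have F2 : rn (\sum_j k 0 j * (a j - 'd g z (dirv j))) <=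
    (\sum_(j < N) rn (k 0 j)) * ((r / 4)^-1 * (Kc * (e / B))).
  apply: le_trans (ler_rn_sum _ _ _) _; rewrite mulr_suml; apply: ler_sum => j _.
  by rewrite rnM ler_wpM2l ?rn_ge0.
have F3 := ler_rnD (g (z + k) - g z - 'd g z k) ((f (z + k) - g (z + k)) - (f z - g z)).
have F4 : 2 * (e / B) + (\sum_(j < N) rn (k 0 j)) * ((r / 4)^-1 * (Kc * (e / B))) = e.
  rewrite -[RHS](divfK (lt0r_neq0 B0)) [in RHS]/B [in RHS]mulrDr; ring.
have -> : A * rn k ^+ 2 = Kc * M * (4 / r * rn k) ^+ 2 by rewrite /A; ring.
lra.
Qed.

(** Differentiation under the integral: [taylorN] bounds the quadratic remainder uniformly in s. The
    partial derivatives [D j] are continuous in s because a difference quotient with a fixed small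
    step t approximates them uniformly in s. *)
Lemma diff_cint (psi : 'rV[C]_N -> R -> C) z (r M : R) : 0 < r ->
  (forall (s : R) y, 0 <= s <= 1 -> rn (y - z) < r ->
     differentiable (psi ^~ s) y /\ rn (psi y s) <= M) ->
  (forall y, rn (y - z) < r -> cont01 (psi y)) ->
  differentiable (fun y => cint (psi y)) z.
Proof.
move=> r0 h cpsi.
have K0 := @Kc_gt0 R.
have zr : rn (z - z) < r by rewrite subrr rn0.
have M0 : 0 <= M.
  by have [|_] := h 0 z _ zr; [rewrite lexx ler01|apply: le_trans (rn_ge0 _)].
have T (s : R) k : 0 <= s <= 1 -> rn k <= r / 8 ->
  rn (psi (z + k) s - psi z s - 'd (psi ^~ s) z k) <= Kc * M * (4 / r * rn k) ^+ 2.
  move=> s01 hk.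
  have [] := @taylorN (psi ^~ s) z r M r0 _ _ k hk => // y yr;
    by have [] := h s y s01 yr.
pose D j s := 'd (psi ^~ s) z (dirv j).
have cD j : cont01 (D j).
  move=> s s01 e e0.
  pose B : R := Kc * M * (4 / r) ^+ 2.
  have B0 : 0 <= B by rewrite /B mulr_ge0 ?sqr_ge0 // mulr_ge0 // ltW.
  have B1 : 0 < B + 1 by rewrite ltr_wpDl.
  pose t : R := Num.min (r / 8) (e / (4 * (B + 1))).
  have t0 : 0 < t by rewrite lt_min !divr_gt0 // mulr_gt0.
  have [t1 t2] : t <= r / 8 /\ t <= e / (4 * (B + 1)).
    by apply/andP; rewrite -le_min.
  have rt : rn (t%:C *: dirv j) <= t.
    by rewrite rnZ rnR gtr0_norm // ler_piMr ?rn_dirv // ltW.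
  have zt : rn (z + t%:C *: dirv j - z) < r by rewrite addrAC subrr add0r; lra.
  have te : 0 < t * (e / 4) by rewrite mulr_gt0 // divr_gt0.
  have [d1 d10 h1] := cpsi _ zt s s01 _ te; have [d2 d20 h2] := cpsi _ zr s s01 _ te.
  exists (Num.min d1 d2); first by rewrite lt_min d10.
  move=> u u01; rewrite lt_min => /andP[/(h1 u u01) {}h1 /(h2 u u01) {}h2].
  have Q s' : 0 <= s' <= 1 -> rn (psi (z + t%:C *: dirv j) s' - psi z s' - t%:C * D j s')
      <= t * (e / 4).
    move=> s01'; have := T s' _ s01' (le_trans rt t1).
    rewrite linearZ /= => /le_trans; apply.
    apply: (@le_trans _ _ (B * t ^+ 2)).
      rewrite exprMn mulrA -/B ler_wpM2l // ler_pXn2r ?nnegrE ?rn_ge0 // ltW //.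
    rewrite expr2 mulrCA ler_wpM2l ?(ltW t0) //.
    rewrite ler_pdivlMr ?mulr_gt0 // in t2.
    by have := ltW t0; lra.
  have Q1 := Q s s01; have Q2 := Q u u01.
  rewrite -(ltr_pM2l t0).
  have -> : t * rn (D j u - D j s) = rn (t%:C * (D j u - D j s)).
    by rewrite rnM rnR gtr0_norm.
  set p1 := psi (z + _) u in h1 Q2; set p2 := psi z u in h2 Q2.
  set p3 := psi (z + _) s in h1 Q1; set p4 := psi z s in h2 Q1.
  have R4 (q1 q2 q3 q4 a b c : C) : c * (a - b) = ((q1 - q3) - (q2 - q4)) +
      ((q3 - q4 - c * b) - (q1 - q2 - c * a)) by ring.
  rewrite (R4 p1 p2 p3 p4).
  have F1 := ler_rnD ((p1 - p3) - (p2 - p4)) ((p3 - p4 - t%:C * D j s) -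
    (p1 - p2 - t%:C * D j u)).
  have F2 := ler_rnB (p1 - p3) (p2 - p4).
  have F3 := ler_rnB (p3 - p4 - t%:C * D j s) (p1 - p2 - t%:C * D j u).
  apply: le_lt_trans F1 _; apply: le_lt_trans (lerD F2 F3) _.
  apply: lt_le_trans (ltr_leD (ltrD h1 h2) (lerD Q1 Q2)) _.
  by rewrite le_eqVlt; apply/orP; left; apply/eqP; field.
pose A : R := 2 * (Kc * M * (4 / r) ^+ 2).
have A0 : 0 <= A by rewrite /A mulr_ge0 // mulr_ge0 ?sqr_ge0 // mulr_ge0 // ltW.
apply: (@diff_quad _ z (fun j => cint (D j)) (r / 8) A) => //; first by lra.
move=> k hk.
have zk : rn (z + k - z) < r by rewrite addrAC subrr add0r; lra.
have c1 := cont01D (cpsi _ zk) (cont01Z (-1) (cpsi _ zr)).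
have c2 : cont01 (fun s => \sum_j k 0 j * D j s).
  by apply: cont01_sum => j; apply: cont01Z.
have -> : \sum_j k 0 j * cint (D j) = cint (fun s => \sum_j k 0 j * D j s).
  rewrite cint_sum; last by move=> j; apply: cont01Z.
  by apply: eq_bigr => j _; rewrite cintZ.
have Z1 := cintZ (-1) (cpsi _ zr); have Z2 := cintZ (-1) c2.
have A1 := cintD (cpsi _ zk) (cont01Z (-1) (cpsi _ zr)).
have A2 := cintD c1 (cont01Z (-1) c2).
have -> : cint (psi (z + k)) - cint (psi z) -
    cint (fun s : R => \sum_j k 0 j * D j s) =
    cint (fun s => psi (z + k) s + -1 * psi z s + -1 * \sum_j k 0 j * D j s).
  by rewrite A2 A1 Z1 Z2 !mulN1r.
have -> : A * rn k ^+ 2 = 2 * (Kc * M * (4 / r * rn k) ^+ 2).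
  by rewrite /A [in RHS]exprMn !mulrA.
apply: cint_bnd.
  by apply: cont01D => //; exact: cont01Z.
move=> s s01; rewrite !mulN1r.
by rewrite -(diff_sum (psi ^~ s) z k); exact: T.
Qed.

End SeveralVariables.

(** * Holomorphic germs and uniformity over compact sets *)

Section HolAt.
Context {R : realType}.
Local Notation C := R[i].

Definition hol_at {V : normedModType C} (z : V) (h : V -> C) :=
  \forall y \near z, differentiable h y.

Lemma ctsRP {X : topologicalType} (f : X -> R) x :
  {for x, continuous f} <->
  (forall e : R, 0 < e -> \forall y \near x, `|f y - f x| < e).
Proof.
split=> [/cvgrPdist_lt h e /h|h].
  by apply: filterS => y; rewrite distrC.
by apply/cvgrPdist_lt => e /h; apply: filterS => y; rewrite distrC.
Qed.

Section general.
Context {V : normedModType C}.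
Implicit Types (f g h : V -> C) (z : V).

Lemma hol_atP z h : hol_at z h <->
  exists2 e : R, 0 < e & forall y, rn (y - z) < e -> differentiable h y.
Proof. exact: nbhs_rnP. Qed.

Lemma hol_at_diff z h : hol_at z h -> differentiable h z.
Proof. exact: nbhs_singleton. Qed.

Lemma hol_at_cts z h : hol_at z h -> {for z, continuous h}.
Proof. by move=> /hol_at_diff/differentiable_continuous. Qed.

Lemma near_near z (P : V -> Prop) : (\forall y \near z, P y) ->
  \forall y \near z, \forall x \near y, P x.
Proof. by move=> h; near=> y; near: y; exact: (near_join h). Unshelve. all: end_near. Qed.

Lemma hol_at_near z h : hol_at z h -> \forall y \near z, hol_at y h.
Proof. exact: near_near. Qed.

Lemma hol_at_eq z f g : (\forall y \near z, f y = g y) -> hol_at z f -> hol_at z g.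
Proof.
move=> /near_near fg; apply: filterS2 fg => y; exact: near_eq_differentiable.
Qed.

Lemma hol_at_ext z f g : (forall y, f y = g y) -> hol_at z f -> hol_at z g.
Proof. by move=> fg; apply: hol_at_eq; exact: nearW. Qed.

Lemma hol_atW z h : (forall y, differentiable h y) -> hol_at z h.
Proof. by move=> dh; exact: nearW. Qed.

Lemma hol_at_cst z c : hol_at z (fun=> c).
Proof. by apply: nearW => y; exact: differentiable_cst. Qed.

Lemma hol_atD z f g : hol_at z f -> hol_at z g -> hol_at z (fun x => f x + g x).
Proof. by apply: filterS2 => y; exact: differentiableD. Qed.

Lemma hol_atB z f g : hol_at z f -> hol_at z g -> hol_at z (fun x => f x - g x).
Proof. by apply: filterS2 => y; exact: differentiableB. Qed.

Lemma hol_atN z f : hol_at z f -> hol_at z (fun x => - f x).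
Proof. by apply: filterS => y; exact: differentiableN. Qed.

Lemma hol_atM z f g : hol_at z f -> hol_at z g -> hol_at z (fun x => f x * g x).
Proof. by apply: filterS2 => y; exact: differentiableM. Qed.

Lemma hol_atX z f n : hol_at z f -> hol_at z (fun x => f x ^+ n).
Proof.
move=> hf; elim: n => [|n IH].
  rewrite (_ : (fun _ => _) = fun=> 1); first exact: hol_at_cst.
  by apply/funext => x; rewrite expr0.
rewrite (_ : (fun _ => _) = fun x => f x * f x ^+ n); first exact: hol_atM.
by apply/funext => x; rewrite exprS.
Qed.

Lemma hol_at_sum z I (r : seq I) (F : I -> V -> C) :
  (forall i, hol_at z (F i)) -> hol_at z (fun x => \sum_(i <- r) F i x).
Proof.
move=> hF; elim: r => [|i r IH].
  rewrite (_ : (fun _ => _) = fun=> 0); first exact: hol_at_cst.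
  by apply/funext => x; rewrite big_nil.
rewrite (_ : (fun _ => _) = fun x => F i x + \sum_(j <- r) F j x).
  exact: hol_atD.
by apply/funext => x; rewrite big_cons.
Qed.

Lemma near_neq0 z f : {for z, continuous f} -> f z != 0 ->
  \forall y \near z, f y != 0.
Proof.
move=> cf fz; have e0 : 0 < rn (f z) by rewrite rn_gt0.
move/ctsP: cf => /(_ _ e0); apply: filterS => y; apply: contraTneq => ->.
by rewrite sub0r rnN ltxx.
Qed.

Lemma hol_atV z f : hol_at z f -> f z != 0 -> hol_at z (fun x => (f x)^-1).
Proof.
move=> hf fz; have := near_neq0 (hol_at_cts hf) fz.
by apply: filterS2 hf => y dy fy; exact: differentiableV.
Qed.

End general.

Lemma hol_at_comp {V W : normedModType C} (F : V -> W) (h : W -> C) z :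
  (\forall y \near z, differentiable F y) -> hol_at (F z) h ->
  hol_at z (fun x => h (F x)).
Proof.
move=> dF hh.
have cF : {for z, continuous F}.
  exact/differentiable_continuous/(nbhs_singleton dF).
have hh' : \forall x \near z, differentiable h (F x) by exact: (cF _ hh).
by apply: filterS2 dF hh' => y d1 d2; exact: (differentiable_comp (g := h)).
Qed.

Lemma hol_at_compW {V W : normedModType C} (F : V -> W) (h : W -> C) z :
  (forall y, differentiable F y) -> hol_at (F z) h -> hol_at z (fun x => h (F x)).
Proof. by move=> dF; apply: hol_at_comp; exact: nearW. Qed.

(** The form in which compactness yields a uniform radius; uniform bounds come from it as well, with
    d^-1 as the bound. *)
Lemma compact_unif {T : topologicalType} (K : set T) (P : T -> R -> Prop) :
  compact K -> (forall x (d d' : R), P x d -> 0 < d' <= d -> P x d') ->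
  (forall x, K x -> exists2 d : R, 0 < d & \forall x' \near x, K x' -> P x' d) ->
  exists2 d : R, 0 < d & forall x, K x -> P x d.
Proof.
move=> cK mono loc.
have /near_covering_withinP nc := (compact_near_coveringP K).1 cK.
have [|d /= d0 hd] := nc R (0 : R)^'+ (fun d x => P x d) _.
  move=> x /loc[d d0 hd].
  exists ([set x' | K x' -> P x' d], [set d' | 0 < d' <= d]) => /=.
    split => //; near=> d'; apply/andP; split; first by near: d'; exact: nbhs_right_gt.
    by near: d'; exact: nbhs_right_le.
  by move=> [x' d'] /= [h1 h2] Kx'; apply: mono (h1 Kx') h2.
exists (d / 2); first by rewrite divr_gt0.
move=> x Kx; apply: (hd (d / 2)) => //=; last by rewrite divr_gt0.
rewrite /ball_ /= sub0r normrN gtr0_norm ?divr_gt0 //.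
by rewrite ltr_pdivrMr // ltr_pMr // ltr1n.
Unshelve. all: end_near. Qed.

Lemma segment01_compact : compact [set s : R | 0 <= s <= 1].
Proof.
rewrite (_ : [set _ | _] = `[0, 1]%classic); first exact: segment_compact.
by apply/seteqP; split => s; rewrite /= in_itv.
Qed.

End HolAt.

(** * Cauchy integrals over one edge, as functions of several variables *)

Section Edge.
Context {R : realType}.
Local Notation C := R[i].
Variable N : nat.
Implicit Types (z y : 'rV[C]_N).

Definition upd z (i : 'I_N) (u : C) : 'rV[C]_N := z + (u - z 0 i) *: dirv i.

Lemma coordB y z j : (y - z) 0 j = y 0 j - z 0 j.
Proof. by rewrite 2!mxE. Qed.

Lemma updE z i u : upd z i u 0 i = u.
Proof. by rewrite !mxE !eqxx mulr1 addrC subrK. Qed.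

Lemma updE_neq z i u j : j != i -> upd z i u 0 j = z 0 j.
Proof. by move=> ji; rewrite !mxE (negbTE ji) andbF mulr0 addr0. Qed.

Lemma upd_id z i : upd z i (z 0 i) = z.
Proof. by rewrite /upd subrr scale0r addr0. Qed.

Lemma rn_updB z y i u w : rn (upd z i u - upd y i w) <= rn (z - y) + rn (u - w).
Proof.
apply: rn_le_coord => [|j]; first by rewrite addr_ge0 ?rn_ge0.
have [->|ji] := eqVneq j i.
  by rewrite coordB !updE lerDr rn_ge0.
rewrite coordB !updE_neq // ler_wpDr ?rn_ge0 //.
by have := rn_coord (z - y) j; rewrite coordB.
Qed.

Lemma differentiable_coordE i z : differentiable (fun y => y 0 i) z.
Proof. exact: differentiable_coord. Qed.

Lemma differentiable_upd i u z : differentiable (fun y => upd y i u) z.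
Proof.
apply: differentiableD; first exact: differentiable_idfun.
apply: differentiableZl; apply: differentiableB; first exact: differentiable_cst.
exact: differentiable_coordE.
Qed.

Lemma diff_invsub_coord (c : C) i y : c != y 0 i ->
  differentiable (fun y : 'rV[C]_N => (c - y 0 i)^-1) y.
Proof.
move=> h; apply: differentiableV; last by rewrite subr_eq0.
apply: differentiableB; first exact: differentiable_cst.
exact: differentiable_coordE.
Qed.

Lemma diff_invsub (c u : C) : u != c -> differentiable (fun u : C => (u - c)^-1) u.
Proof.
move=> h; apply: differentiableV; last by rewrite subr_eq0.
apply: differentiableB; first exact: differentiable_idfun.
exact: differentiable_cst.
Qed.

Lemma differentiable_upd2 y i u : differentiable (fun u => upd y i u) u.
Proof.
apply: differentiableD; first exact: differentiable_cst.
apply: differentiableZl; apply: differentiableB; first exact: differentiable_idfun.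
exact: differentiable_cst.
Qed.

(** The part of Cauchy's integral in the i-th variable that comes from the edge [a, b]. *)
Definition eint (v : 'rV[C]_N -> C) i a b z :=
  lint (fun u => v (upd z i u) * (u - z 0 i)^-1) a b.

(** By compactness of the edge, a single d serves as radius and d^-1 as bound for the integrands at
    all parameters s, so [diff_cint] applies. The only singularities lie over the edge itself. *)
Lemma eint_hol v i (a b : C) z :
  (forall s : R, 0 <= s <= 1 -> hol_at (upd z i (seg a b s)) v) ->
  (forall s : R, 0 <= s <= 1 -> seg a b s != z 0 i) ->
  hol_at z (eint v i a b).
Proof.
move=> hv hz.
pose psi (y : 'rV[C]_N) (s : R) := v (upd y i (seg a b s)) * (seg a b s - y 0 i)^-1.
pose P (s d : R) := forall y, rn (y - z) < d ->
  [/\ differentiable (psi ^~ s) y, rn (psi y s) <= d^-1,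
      hol_at (upd y i (seg a b s)) v & seg a b s != y 0 i].
have segB (s s' : R) : rn (seg a b s' - seg a b s) = `|s' - s| * rn (b - a).
  by rewrite /seg opprD addrACA subrr add0r -mulrBl -rmorphB rnM rnR.
have [d d0 hd] : exists2 d : R, 0 < d & forall s, 0 <= s <= 1 -> P s d.
  apply: compact_unif segment01_compact _ _.
    move=> s e e' h /andP[e'0 ee'] y ye'.
    have [h1 h2 h3 h4] := h y (lt_le_trans ye' ee'); split => //.
    apply: le_trans h2 _; rewrite lef_pV2 // posrE //.
    exact: lt_le_trans ee'.
  move=> s s01; have := hv s s01 => hvs.
  have c0 : 0 < rn (seg a b s - z 0 i) by rewrite rn_gt0 subr_eq0; exact: hz.
  set c := rn _ in c0.
  have /hol_atP[e1 e10 h1] := hvs.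
  have /ctsP/(_ _ ltr01)/nbhs_rnP[e2 e20 h2] := hol_at_cts hvs.
  set w := upd z i (seg a b s) in h1 h2.
  pose M : R := (rn (v w) + 1) * (4 / c).
  have M0 : 0 < M by rewrite mulr_gt0 ?divr_gt0 // ltr_wpDl ?rn_ge0.
  pose e := Num.min (Num.min e1 e2) c / 4.
  have e0 : 0 < e by rewrite divr_gt0 // !lt_min e10 e20 c0.
  have [f1 f2 f3] : [/\ e * 4 <= e1, e * 4 <= e2 & e * 4 <= c].
    have : e * 4 <= e * 4 by []. by rewrite {2}/e divfK // !le_min -andbA => /and3P[].
  exists (Num.min e M^-1); first by rewrite lt_min e0 invr_gt0.
  pose B := rn (b - a) + 1.
  have B0 : 0 < B by rewrite ltr_wpDl ?rn_ge0.
  apply/nbhs_ballP; exists (e / B); first by rewrite /= divr_gt0.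
  move=> s' ss' s'01 y; rewrite lt_min => /andP[ye yM].
  have {}ss' : `|s - s'| < e / B by exact: ss'.
  have g1 : rn (seg a b s' - seg a b s) < e.
    rewrite segB distrC; rewrite ltr_pdivlMr // in ss'.
    by apply: le_lt_trans ss'; rewrite ler_wpM2l // lerDl.
  have g2 : rn (upd y i (seg a b s') - w) < e * 2.
    apply: le_lt_trans (rn_updB _ _ _ _ _) _; rewrite mulr_natr mulr2n.
    by rewrite ltrD.
  have g3 : c / 2 <= rn (seg a b s' - y 0 i).
    have := ler_rn_sub (seg a b s - z 0 i) ((seg a b s - seg a b s') + (y 0 i - z 0 i)).
    rewrite (_ : _ - _ - (_ + _) = seg a b s' - y 0 i); last by ring.
    apply: le_trans; rewrite -/c.
    have := ler_rnD (seg a b s - seg a b s') (y 0 i - z 0 i).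
    rewrite (rnB (seg a b s)).
    have := rn_coord (y - z) i; rewrite coordB => q1 q2.
    have q3 := le_lt_trans q2 (ltr_leD g1 q1).
    have q4 : rn (seg a b s - seg a b s' + (y 0 i - z 0 i)) <= c / 2.
      apply: le_trans (ltW q3) _; apply: le_trans (lerD (lexx _) (ltW ye)) _.
      by clear -f3; lra.
    by clear -q4; lra.
  have sy : seg a b s' - y 0 i != 0.
    by rewrite -rn_gt0; apply: lt_le_trans g3; rewrite divr_gt0.
  have hol' : hol_at (upd y i (seg a b s')) v.
    apply/hol_atP; exists (e * 2); first by rewrite mulr_gt0.
    move=> x hx; apply: h1; rewrite -(subrK (upd y i (seg a b s')) x) -addrA.
    apply: le_lt_trans (ler_rnD _ _) _.
    by apply: lt_le_trans (ltrD hx g2) _; clear -f1; lra.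
  have sy' : seg a b s' != y 0 i by rewrite -subr_eq0.
  have dpsi : differentiable (psi ^~ s') y.
    apply: differentiableM; last exact: diff_invsub_coord.
    apply: (differentiable_comp (g := v)); first exact: differentiable_upd.
    exact: hol_at_diff.
  suff hM : rn (psi y s') <= (Num.min e M^-1)^-1 by [].
  apply: (@le_trans _ _ M); last first.
    by rewrite -[leLHS]invrK lef_pV2 ?posrE ?lt_min ?e0 ?invr_gt0 // ge_min lexx orbT.
  rewrite /psi rnM rnV ler_pM ?rn_ge0 ?invr_ge0 ?rn_ge0 //.
    have /h2/ltW q : rn (upd y i (seg a b s') - w) < e2.
      by apply: lt_le_trans g2 _; clear -e0 f2; lra.
    have q' := ler_rn_sub (v (upd y i (seg a b s'))) (v w).
    by have := le_trans q' q; clear; lra.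
  rewrite -[leRHS]invrK lef_pV2 ?posrE ?invr_gt0 ?divr_gt0 // ?invf_div.
    by apply: le_trans g3; clear -c0; lra.
  by rewrite rn_gt0.
have cp y : rn (y - z) < d -> cont01 (psi y).
  move=> yd; apply: (@cseg_cont01 _ (fun u => v (upd y i u) * (u - y 0 i)^-1)).
  move=> s s01; have [_ _ h3 h4] := hd s s01 y yd.
  apply: continuousM; last exact/differentiable_continuous/diff_invsub.
  apply: (continuous_comp (g := v)); last exact: hol_at_cts.
  exact/differentiable_continuous/differentiable_upd2.
apply/hol_atP; exists (d / 2); first by rewrite divr_gt0.
move=> y yd; rewrite /eint /lint.
apply: differentiableM; first exact: differentiable_cst.
apply: (@diff_cint _ _ psi y (d / 2) d^-1).
- by rewrite divr_gt0.
- move=> s x s01 xd.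
  have hxz : rn (x - z) < d.
    rewrite -(subrK y x) -addrA (splitr d); apply: le_lt_trans (ler_rnD _ _) _.
    by rewrite ltrD.
  by have [h1 h2 _ _] := hd s s01 x hxz.
- move=> x xd; apply: cp.
  rewrite -(subrK y x) -addrA (splitr d); apply: le_lt_trans (ler_rnD _ _) _.
  by rewrite ltrD.
Qed.

End Edge.

(** * Boxes and the splitting of holomorphic functions *)

Section Boxes.
Context {R : realType}.
Local Notation C := R[i].

Lemma mkC_cts : continuous (fun p : R * R => p.1 +i* p.2 : C).
Proof.
move=> [x y]; apply/ctsP => e e0.
have e2 : 0 < e / 2 by rewrite divr_gt0.
exists (ball x (e / 2), ball y (e / 2)); first by split; exact: nbhsx_ballx.
move=> [x' y'] /= [hx hy].
have {}hx : `|x - x'| < e / 2 by exact: hx.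
have {}hy : `|y - y'| < e / 2 by exact: hy.
apply: le_lt_trans (rn_le_ReIm _) _; rewrite cReB cImB /= (splitr e).
by rewrite distrC (distrC y') ltrD.
Qed.

Lemma rect_compact (a b c d : R) :
  compact [set u : C | a <= complex.Re u <= b /\ c <= complex.Im u <= d].
Proof.
rewrite (_ : [set _ | _] = (fun p : R * R => p.1 +i* p.2 : C) @`
    (`[a, b]%classic `*` `[c, d]%classic)).
  apply: continuous_compact; last by apply: compact_setX; exact: segment_compact.
  exact/continuous_subspaceT/mkC_cts.
apply/seteqP; split.
  by move=> [x y] /= [h1 h2]; exists (x, y) => //=; rewrite !in_itv.
by move=> _ [[x y] /= + <-]; rewrite !in_itv /= => -[].
Qed.

Section fixN.
Variable N : nat.
Implicit Types (z y : 'rV[C]_N).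
(** The real directions of C^N; [true] stands for the imaginary part. *)
Definition dir := ('I_N * bool)%type.

Definition co z (d : dir) : R :=
  if d.2 then complex.Im (z 0 d.1) else complex.Re (z 0 d.1).

Definition box (a b : dir -> R) : set 'rV[C]_N :=
  [set z | forall d, a d <= co z d <= b d].

Lemma co_lip y z d : `|co y d - co z d| <= rn (y - z).
Proof.
have h := rn_coord (y - z) d.1; rewrite coordB in h.
rewrite /co; case: d.2; apply: le_trans h; rewrite -?cReB -?cImB.
  exact: ler_Im_rn.
exact: ler_Re_rn.
Qed.

Lemma co_cts d : continuous (co ^~ d).
Proof.
move=> z; apply/ctsRP => e e0; apply/nbhs_rnP; exists e => // y.
by apply: le_lt_trans; exact: co_lip.
Qed.

Lemma rn_le_co y z (e : R) : 0 <= e -> (forall d, `|co y d - co z d| <= e) ->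
  rn (y - z) <= 2 * e.
Proof.
move=> e0 h; apply: rn_le_coord => [|j]; first by rewrite mulr_ge0.
rewrite coordB; apply: le_trans (rn_le_ReIm _) _.
have := h (j, false); have := h (j, true); rewrite /co /= -cReB -cImB.
rewrite mulrDl mul1r; move=> ? ?; exact: lerD.
Qed.

Lemma box_rn (M : R) z : rn z <= M -> box (fun=> - M) (fun=> M) z.
Proof.
move=> zM d; rewrite -ler_norml; apply: le_trans zM; have := co_lip z 0 d.
by rewrite subr0 (_ : co 0 d = 0) ?subr0 // /co; case: d.2; rewrite mxE.
Qed.

Lemma box_compact a b : compact (box a b).
Proof.
pose A (i : 'I_N) := [set u : C |
   a (i, false) <= complex.Re u <= b (i, false) /\
   a (i, true) <= complex.Im u <= b (i, true)].
have cA i : compact (A i) by exact: rect_compact.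
have H := @rV_compact C N A cA.
have E : box a b = [set v | forall i, A i (v ord0 i)].
  apply/seteqP; split => z h /=.
    by move=> i; split; [exact: (h (i, false))|exact: (h (i, true))].
  by move=> [i []]; rewrite /co /=; have [] := h i.
by rewrite E; exact: H.
Qed.

Definition mkrow (f : dir -> R) : 'rV[C]_N :=
  \row_i (f (i, false) +i* f (i, true)).

Lemma co_mkrow f d : co (mkrow f) d = f d.
Proof. by case: d => i []; rewrite /co /= mxE. Qed.

Lemma box_near a b (e : R) y : (forall d, a d <= b d) -> 0 <= e ->
  (forall d, a d - e <= co y d <= b d + e) ->
  exists2 k, box a b k & rn (y - k) <= 2 * e.
Proof.
move=> ab e0 h.
exists (mkrow (fun d => Num.max (a d) (Num.min (co y d) (b d)))).
  by move=> d; rewrite co_mkrow le_max lexx /= ge_max ab ge_min lexx orbT.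
apply: rn_le_co => // d; rewrite co_mkrow.
have := h d; have := ab d; rewrite /Num.max /Num.min.
case: (ltP (co y d) (b d)) => h1; case: ltP => h2 h3 /andP[h4 h5];
  rewrite ler_norml; apply/andP; split; lra.
Qed.

Lemma compact_hol (K : set 'rV[C]_N) (v : 'rV[C]_N -> C) : compact K ->
  (forall z, K z -> hol_at z v) ->
  exists2 r : R, 0 < r & forall z y, K z -> rn (y - z) < r -> differentiable v y.
Proof.
move=> cK hv.
have [||r r0 hr] := @compact_unif R _ K
  (fun z d => forall y, rn (y - z) < d -> differentiable v y) cK.
- by move=> x d d' h /andP[_ dd] y yd; apply: h; exact: lt_le_trans dd.
- move=> z Kz; have /hol_atP[e e0 he] := hv z Kz.
  exists (e / 2); first by rewrite divr_gt0.
  apply/nbhs_rnP; exists (e / 2); first by rewrite divr_gt0.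
  move=> x xz _ y yx; apply: he; rewrite -(subrK x y) -addrA (splitr e).
  by apply: le_lt_trans (ler_rnD _ _) _; rewrite ltrD.
by exists r => // z y Kz; exact: hr.
Qed.

Definition setd (a : dir -> R) (d : dir) (c : R) := fun d' => if d' == d then c else a d'.

(** Write v by Cauchy's formula over a thin rectangle around the slab, in the plane of the
    coordinate [d.1]. The edge at c - e gives h'' and the other three give h'; an edge integral is
    holomorphic at all points of the box off the line carrying its edge, and these lines lie on the
    harmless side or outside the box. *)
Lemma split_box (v : 'rV[C]_N -> C) a b d c :
  (forall z, box a b z -> co z d = c -> hol_at z v) ->
  exists h' h'' : 'rV[C]_N -> C, [/\
    forall z, box a b z -> co z d <= c -> hol_at z h',
    forall z, box a b z -> c <= co z d -> hol_at z h'' &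
    forall z, box a b z -> co z d = c -> \forall y \near z, v y = h' y - h'' y].
Proof.
move=> hv.
(* If the slab is empty, the box lies on one side or is empty, and zero functions do. *)
have [[z0 [bz0 cz0]]|K0] := pselect (exists z, box a b z /\ co z d = c); last first.
  exists (fun=> 0), (fun=> 0); split; do ?by move=> *; exact: hol_at_cst.
  by move=> z bz cz; exfalso; apply: K0; exists z.
pose a' := setd a d c; pose b' := setd b d c.
have ab' d' : a' d' <= b' d'.
  rewrite /a' /b' /setd; case: eqP => // _.
  by have /andP[] := bz0 d'; exact: le_trans.
have K z : box a' b' z -> box a b z /\ co z d = c.
  move=> bz; have cz : co z d = c.
    by have := bz d; rewrite /a' /b' /setd eqxx => ?; apply/eqP; rewrite eq_le andbC.
  split => // d'; have [->|dd] := eqVneq d' d.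
    by rewrite cz -cz0; exact: bz0.
  by have := bz d'; rewrite /a' /b' /setd (negbTE dd).
have K' z : box a b z -> co z d = c -> box a' b' z.
  move=> bz cz d'; rewrite /a' /b' /setd; case: eqP => [->|_]; last exact: bz.
  by rewrite cz lexx.
have [r r0 hr] : exists2 r : R, 0 < r &
    forall z y, box a' b' z -> rn (y - z) < r -> differentiable v y.
  apply: compact_hol; first exact: box_compact.
  by move=> z /K[]; exact: hv.
(* A point of the box enlarged by e is within 2 e of the slab, so a ball of radius e around it stays
   where v is differentiable. *)
pose e := r / 8; have e0 : 0 < e by rewrite divr_gt0.
have e8 : 8 * e = r by rewrite /e mulrC divfK.
pose i := d.1.
pose X1 := a' (i, false) - e; pose X2 := b' (i, false) + e.
pose Y1 := a' (i, true) - e; pose Y2 := b' (i, true) + e.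
have X12 : X1 <= X2 by have := ab' (i, false); rewrite /X1 /X2; clear -e0; lra.
have Y12 : Y1 <= Y2 by have := ab' (i, true); rewrite /Y1 /Y2; clear -e0; lra.
have FA y u : (forall d', d'.1 != i -> a d' - e <= co y d' <= b d' + e) ->
    X1 <= complex.Re u <= X2 -> Y1 <= complex.Im u <= Y2 -> hol_at (upd y i u) v.
  move=> hy h1 h2.
  have [|k bk kd] := @box_near a' b' e (upd y i u) ab' (ltW e0).
    move=> d'; have [di|di] := eqVneq d'.1 i.
      case: d' di => j t /= ->; rewrite /co /= updE.
      by case: t.
    have dd : d' != d by apply: contraNneq di => ->.
    have := hy d' di; rewrite /a' /b' /setd (negbTE dd) /co updE_neq //.
  apply/hol_atP; exists e => // x xu; apply: (hr k) => //.
  rewrite -(subrK (upd y i u) x) -addrA; apply: le_lt_trans (ler_rnD _ _) _.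
  by apply: lt_le_trans (ltr_leD xu kd) _; rewrite -e8; clear -e0; lra.
pose Eh Y := eint v i (X1 +i* Y) (X2 +i* Y).
pose Ev X := eint v i (X +i* Y1) (X +i* Y2).
have inbox z : box a b z -> forall d', d'.1 != i -> a d' - e <= co z d' <= b d' + e.
  move=> bz d' _; have /andP[h1 h2] := bz d'.
  by apply/andP; split; clear -h1 h2 e0; lra.
have FEh z Y : box a b z -> Y = Y1 \/ Y = Y2 -> complex.Im (z 0 i) != Y ->
    hol_at z (Eh Y).
  move=> bz hY nY; apply: eint_hol => s s01; rewrite segh; last first.
    by apply: contraNneq nY => <-.
  apply: FA; [exact: inbox|exact: conv_bnd|].
  by case: hY => -> /=; rewrite lexx Y12.
have FEv z X : box a b z -> X = X1 \/ X = X2 -> complex.Re (z 0 i) != X ->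
    hol_at z (Ev X).
  move=> bz hX nX; apply: eint_hol => s s01; rewrite segv; last first.
    by apply: contraNneq nX => <-.
  apply: FA; [exact: inbox| |exact: conv_bnd].
  by case: hX => -> /=; rewrite lexx X12.
have FC z : box a b z -> co z d = c -> \forall y \near z,
    v y = kappa^-1 * (Eh Y1 y - Eh Y2 y + Ev X2 y - Ev X1 y).
  move=> bz cz; have Kz := K' z bz cz.
  apply/nbhs_rnP; exists e => // y yz.
  have cy d' : a' d' - e < co y d' < b' d' + e.
    have /andP[h1 h2] := Kz d'.
    have := le_lt_trans (co_lip y z d') yz.
    by rewrite ltr_norml => /andP[h3 h4]; apply/andP; split; clear -h1 h2 h3 h4; lra.
  have hc := @cauchy R (fun u => v (upd y i u)) X1 X2 Y1 Y2 (y 0 i) _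
    (cy (i, false)) (cy (i, true)).
  rewrite /Eh /Ev /eint.
  rewrite -[RHS]/(kappa^-1 * rint (fun u => v (upd y i u) * (u - y 0 i)^-1) X1 X2 Y1 Y2).
  rewrite hc; first by rewrite upd_id mulKf // kappa_neq0.
  move=> u h1 h2; apply: (differentiable_comp (g := v)).
    exact: differentiable_upd2.
  apply: hol_at_diff; apply: FA => // d' di.
  have dd : d' != d by apply: contraNneq di => ->.
  by have := cy d'; rewrite /a' /b' /setd (negbTE dd) => /andP[/ltW-> /ltW->].
have inb z d' : d' != d -> box a b z -> a' d' - e < co z d' < b' d' + e.
  move=> dd bz; rewrite /a' /b' /setd (negbTE dd); have /andP[h1 h2] := bz d'.
  by apply/andP; split; clear -h1 h2 e0; lra.
have [d2|d2] := boolP d.2.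
- have Ed : d = (i, true) by rewrite /i; case: (d) d2 => ? [].
  have EY1 : Y1 = c - e by rewrite /Y1 /a' /setd -Ed eqxx.
  have EY2 : Y2 = c + e by rewrite /Y2 /b' /setd -Ed eqxx.
  have nd : (i, false) != d by apply/eqP => E; rewrite -E in d2.
  exists (fun y => kappa^-1 * (- Eh Y2 y + Ev X2 y - Ev X1 y)),
    (fun y => - (kappa^-1 * Eh Y1 y)); split.
  + move=> z bz zc; apply: hol_atM; first exact: hol_at_cst.
    have /andP[h1 h2] := inb z _ nd bz.
    apply: hol_atB; first apply: hol_atD; first apply: hol_atN.
    * apply: FEh => //; first by right.
      rewrite EY2 lt_eqF //; move: zc; rewrite {1}Ed /co /= => zc.
      by clear -zc e0; lra.
    * by apply: FEv => //; [right|rewrite lt_eqF].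
    * by apply: FEv => //; [left|rewrite gt_eqF].
  + move=> z bz zc; apply: hol_atN; apply: hol_atM; first exact: hol_at_cst.
    apply: FEh => //; first by left.
    rewrite EY1 gt_eqF //; move: zc; rewrite {1}Ed /co /= => zc.
    by clear -zc e0; lra.
  + move=> z bz zc; apply: filterS (FC z bz zc) => y ->; ring.
- have Ed : d = (i, false) by rewrite /i; case: (d) d2 => ? [].
  have EX1 : X1 = c - e by rewrite /X1 /a' /setd -Ed eqxx.
  have EX2 : X2 = c + e by rewrite /X2 /b' /setd -Ed eqxx.
  have nd : (i, true) != d by apply/eqP => E; rewrite -E in d2.
  exists (fun y => kappa^-1 * (Eh Y1 y - Eh Y2 y + Ev X2 y)),
    (fun y => kappa^-1 * Ev X1 y); split.
  + move=> z bz zc; apply: hol_atM; first exact: hol_at_cst.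
    have /andP[h1 h2] := inb z _ nd bz.
    apply: hol_atD; first apply: hol_atB.
    * by apply: FEh => //; [left|rewrite gt_eqF].
    * by apply: FEh => //; [right|rewrite lt_eqF].
    * apply: FEv => //; first by right.
      rewrite EX2 lt_eqF //; move: zc; rewrite {1}Ed /co /= => zc.
      by clear -zc e0; lra.
  + move=> z bz zc; apply: hol_atM; first exact: hol_at_cst.
    apply: FEv => //; first by left.
    rewrite EX1 gt_eqF //; move: zc; rewrite {1}Ed /co /= => zc.
    by clear -zc e0; lra.
  + move=> z bz zc; apply: filterS (FC z bz zc) => y ->; ring.
Qed.

End fixN.
End Boxes.

(** * Polyhedra: Cousin's additive problem and Oka's extension *)

Section Interval.
Context {R : realType}.

(** Continuous induction: the supremum of the points reachable from A can be passed unless it is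
    B. *)
Lemma interval_glue (T : R -> R -> Prop) (A B : R) : A <= B ->
  (forall c, A <= c <= B -> exists2 e : R, 0 < e & T (c - e) (c + e)) ->
  (forall x x' y y', T x y -> x <= x' -> y' <= y -> T x' y') ->
  (forall x c y, x <= c <= y -> T x c -> T c y -> T x y) -> T A B.
Proof.
move=> AB loc mono glue.
pose S := [set x | A <= x <= B /\ T A x].
have SA : S A.
  split; first by rewrite lexx.
  have [|e e0 h] := loc A; first by rewrite lexx.
  by apply: mono h _ _; [rewrite gerBl ltW|rewrite lerDl ltW].
have hS : has_sup S.
  by split; [exists A|exists B => x [/andP[]]].
pose m := sup S.
have mA : A <= m by apply: sup_upper_bound.
have mB : m <= B by apply: ge_sup; [exists A|move=> x [/andP[]]].
have [|e e0 h] := loc m; first by rewrite mA.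
have [x [/andP[Ax xB] Tx] xm] := sup_adherent e0 hS.
have xm' : x <= m by apply: sup_upper_bound => //; split => //; rewrite Ax.
pose y := Num.min (m + e) B.
have xy : x <= y by rewrite le_min xB andbT; apply: le_trans xm' _; rewrite lerDl ltW.
have Ty : T A y.
  apply: (glue A x y) => //; first by rewrite Ax.
  by apply: mono h _ _; [exact: ltW|rewrite ge_min lexx].
have [Bm|mB'] := leP B (m + e); first by move: Ty; rewrite /y min_r.
have Sy : S y by split => //; rewrite (le_trans Ax xy) ge_min lexx orbT.
have := sup_upper_bound hS Sy; rewrite /y min_l; last exact: ltW.
by rewrite -/m gerDl leNgt e0.
Qed.
End Interval.

Section Poly.
Context {R : realType}.
Local Notation C := R[i].

(* Squares replace discs, so that polyhedra lift to boxes with one more variable.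
   The side 4 leaves room to approximate on the unit disc by Taylor sums. *)
Definition sqv (u : C) := -2 <= complex.Re u <= 2 /\ -2 <= complex.Im u <= 2.

Lemma sqvN_near (u : C) : ~ sqv u -> exists2 e : R, 0 < e &
  forall w, rn (w - u) < e -> ~ sqv w.
Proof.
have H (x : R) : ~ (-2 <= x <= 2) -> exists2 e : R, 0 < e & forall y, `|y - x| < e ->
    ~ (-2 <= y <= 2).
  move=> /negP; rewrite negb_and -!ltNge => /orP[h|h].
    exists (-2 - x); first by rewrite subr_gt0.
    by move=> y; rewrite ltr_norml => /andP[? ?] /andP[? ?]; lra.
  exists (x - 2); first by rewrite subr_gt0.
  by move=> y; rewrite ltr_norml => /andP[? ?] /andP[? ?]; lra.
move=> /not_andP[/H|/H] [e e0 he]; exists e => // w wu [h1 h2].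
  by apply: he h1; apply: le_lt_trans wu; rewrite -cReB ler_Re_rn.
by apply: he h2; apply: le_lt_trans wu; rewrite -cImB ler_Im_rn.
Qed.

(** Continuity of p is known at the points of K only, so the covering form of compactness is used
    instead of closedness of a preimage. *)
Lemma compact_sqv {T : topologicalType} (K : set T) (p : T -> C) : compact K ->
  (forall x, K x -> {for x, continuous p}) ->
  compact (K `&` [set x | sqv (p x)]).
Proof.
move=> cK cp; apply/compact_near_coveringP => I F P FF hP.
have /near_covering_withinP nc := (compact_near_coveringP K).1 cK.
suff : \forall i \near F, K `<=` (fun x => sqv (p x) -> P i x).
  by apply: filterS => i h x [/h].
apply: nc => x Kx; have [sx|nsx] := pselect (sqv (p x)).
  have [[A B] [/= hA hB] AB] := hP x (conj Kx sx).
  by exists (A, B) => // -[x' i'] /= h _ _; exact: (AB (x', i')).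
have [e e0 he] := sqvN_near nsx.
have /ctsP/(_ e e0) hx := cp x Kx.
exists ([set x' | rn (p x' - p x) < e], setT); first by split => //; exact: filterT.
by move=> [x' i'] /= [h _] _ s; have := he _ h.
Qed.

Section fixN.
Variable N : nat.
Implicit Types (z y : 'rV[C]_N) (p : 'rV[C]_N -> C) (ps : seq ('rV[C]_N -> C)).

Fixpoint sqs ps z : Prop := if ps is p :: ps' then sqv (p z) /\ sqs ps' z else True.

Fixpoint hps (B : set 'rV[C]_N) ps : Prop :=
  if ps is p :: ps' then (forall z, B z -> hol_at z p) /\ hps B ps' else True.

Definition poly a b ps : set 'rV[C]_N := [set z | box a b z /\ sqs ps z].

Lemma hps_sub (A B : set 'rV[C]_N) ps : A `<=` B -> hps B ps -> hps A ps.
Proof. by move=> AB; elim: ps => //= p ps IH [h /IH]; split => // z /AB; exact: h. Qed.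

Lemma poly_compact a b ps : hps (box a b) ps -> compact (poly a b ps).
Proof.
elim: ps => [_|p ps IH /= [hp /IH {}IH]].
  rewrite (_ : poly a b [::] = box a b); first exact: box_compact.
  by apply/seteqP; split => [z []|z bz].
rewrite (_ : poly a b (p :: ps) = poly a b ps `&` [set z | sqv (p z)]).
  apply: compact_sqv => // z [bz _]; exact/hol_at_cts/hp.
by apply/seteqP; split => z /=; [move=> [? []]|move=> [[]]].
Qed.

(* A distribution of Cousin type: [s z] prescribes a solution near [z] up to
   functions holomorphic near [z]. *)
Definition cousin (Q : set 'rV[C]_N) := forall s : 'rV[C]_N -> 'rV[C]_N -> C,
  (forall z, Q z -> \forall y \near z, Q y -> hol_at y (fun x => s z x - s y x)) ->
  exists u, forall z, Q z -> hol_at z (fun x => u x - s z x).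

(** The additive Cousin problem for the two halves into which a real hyperplane cuts Q. *)
Definition splits (Q : set 'rV[C]_N) := forall (v : 'rV[C]_N -> C) d c,
  (forall z, Q z -> co z d = c -> hol_at z v) ->
  exists h' h'' : 'rV[C]_N -> C, [/\
    forall z, Q z -> co z d <= c -> hol_at z h',
    forall z, Q z -> c <= co z d -> hol_at z h'' &
    forall z, Q z -> co z d = c -> \forall y \near z, v y = h' y - h'' y].

Lemma co_near z d (e : R) : 0 < e -> \forall y \near z, `|co y d - co z d| < e.
Proof. by move=> e0; have /ctsRP := @co_cts R N d z; exact. Qed.

(** Induction on the directions [ds] in which the box may have positive width. With none left, the
    polyhedron has at most one point. Otherwise [interval_glue] is applied in a direction d: the
    induction hypothesis solves the problem on a slice, hence near it, and [splits] glues two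
    neighbouring solutions. *)
Lemma cousin_of_splits a b ps : hps (box a b) ps ->
  (forall a' b', hps (box a' b') ps -> splits (poly a' b' ps)) ->
  cousin (poly a b ps).
Proof.
move=> hp hs s hds.
pose Sol (A : set 'rV[C]_N) := exists u, forall z, A z -> hol_at z (fun x => u x - s z x).
suff H (ds : seq (dir N)) a' b' : (forall d, a d <= a' d) -> (forall d, b' d <= b d) ->
    (forall d, d \notin ds -> b' d <= a' d) -> Sol (poly a' b' ps).
  by apply: (H (enum {: dir N})) => // d; rewrite mem_enum.
elim: ds a' b' => [|d ds' IH] a' b' aa bb dd.
  have [[z0 Qz0]|nz] := pselect (exists z, poly a' b' ps z); last first.
    by exists (fun=> 0) => z Qz; exfalso; apply: nz; exists z.
  exists (s z0) => z Qz.
  suff -> : z = z0.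
    rewrite (_ : (fun _ => _) = fun=> 0); first exact: hol_at_cst.
    by apply/funext => x; rewrite subrr.
  have E d : co z d = co z0 d.
    have := dd d isT; have /andP[h1 h2] := Qz.1 d; have /andP[h3 h4] := Qz0.1 d.
    by move=> ?; apply/eqP; rewrite eq_le; apply/andP; split; lra.
  apply/rowP => i; apply: eq_ReIm; first exact: (E (i, false)).
  exact: (E (i, true)).
have [ba|ab] := leP (b' d) (a' d).
  apply: IH => // d' nd; have [->//|ne] := eqVneq d' d.
  by apply: dd; rewrite inE negb_or ne.
pose Q := poly a' b' ps.
have Qsub : Q `<=` poly a b ps.
  move=> z [bz sz]; split => // d'; have /andP[h1 h2] := bz d'.
  by rewrite (le_trans (aa d') h1) (le_trans h2 (bb d')).
have hp' : hps (box a' b') ps.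
  apply: hps_sub hp => z bz d'; have /andP[h1 h2] := bz d'.
  by rewrite (le_trans (aa d') h1) (le_trans h2 (bb d')).
pose T (x y : R) := Sol [set z : 'rV[C]_N | Q z /\ x <= co z d <= y].
have [c cab|x x' y y' [u hu] xx yy|x c y /andP[xc cy] [u hu] [w hw]|u hu] :=
    @interval_glue R T (a' d) (b' d) (ltW ab).
- have [|||u hu] := IH (setd a' d c) (setd b' d c).
  + by move=> d'; rewrite /setd; case: eqP => [->|//]; have /andP[] := cab;
      move=> h _; exact: le_trans (aa d) h.
  + by move=> d'; rewrite /setd; case: eqP => [->|//]; have /andP[_ h] := cab;
      exact: le_trans h (bb d).
  + move=> d' nd; rewrite /setd; case: eqP => [//|/eqP ne].
    by apply: dd; rewrite inE negb_or ne.
  (* The solution u on the slice remains one at nearby points, as the data may be changed there from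
     [s z] to [s y]. Points off the slice satisfy the condition vacuously for small e, so
     compactness of Q yields a full slab. *)
  have [|||e e0 he] := @compact_unif R _ Q (fun z e => `|co z d - c| <= e ->
    hol_at z (fun x => u x - s z x)).
  + exact: poly_compact.
  + by move=> z e e' h /andP[_ ee] h'; apply: h; exact: le_trans h' ee.
  + move=> z Qz; have [zc|zc] := eqVneq (co z d) c.
      exists 1 => //.
      have hz : hol_at z (fun x => u x - s z x).
        apply: hu; split; last by case: Qz.
        move=> d'; rewrite /setd; case: eqP => [->|_]; first by rewrite zc lexx.
        by case: Qz => bz _; exact: bz.
      apply: filterS2 (hol_at_near hz) (hds z (Qsub z Qz)) => y h1 h2 Qy _.
      have := hol_atD h1 (h2 (Qsub y Qy)).
      by apply: hol_at_ext => x; rewrite addrA subrK.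
    have e0 : 0 < `|co z d - c| / 2 by rewrite divr_gt0 // normr_gt0 subr_eq0.
    exists (`|co z d - c| / 2) => //.
    apply: filterS (co_near z d e0) => y hy _ hy'; exfalso.
    have := ler_normD (co y d - c) (co z d - co y d).
    have E : co y d - c + (co z d - co y d) = co z d - c by ring.
    rewrite E (distrC (co z d) (co y d)) => h.
    by have := le_lt_trans h (ler_ltD hy' hy); rewrite -splitr ltxx.
  exists e => //; exists u => z [Qz /andP[h1 h2]]; apply: he => //.
  by rewrite ler_norml; apply/andP; split; lra.
- exists u => z [Qz /andP[h1 h2]]; apply: hu; split => //.
  by rewrite (le_trans xx h1) (le_trans h2 yy).
(* Two solutions differ on the common slice by a holomorphic function, which is written there as h'
   - h''. *)
- have [|h' [h'' [hh' hh'' hv]]] := hs _ _ hp' (fun z => u z - w z) d c.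
    move=> z Qz zc.
    have h1 : hol_at z (fun x => u x - s z x) by apply: hu; rewrite /= zc xc lexx.
    have h2 : hol_at z (fun x => w x - s z x) by apply: hw; rewrite /= zc cy lexx.
    by apply: hol_at_ext (hol_atB h1 h2) => t; ring.
  (* Near the slice u - h' = w - h'', so the case distinction creates no jump. *)
  exists (fun z => if co z d <= c then u z - h' z else w z - h'' z).
  move=> z [Qz /andP[h1 h2]].
  have [zc|zc|zc] := ltgtP (co z d) c.
  + have hz : hol_at z (fun x => u x - s z x) by apply: hu; rewrite /= h1 ltW.
    apply: hol_at_eq (hol_atB hz (hh' z Qz (ltW zc))).
    have e0 : 0 < c - co z d by rewrite subr_gt0.
    apply: filterS (co_near z d e0) => q; rewrite ltr_norml => /andP[_ hy].
    have -> : co q d <= c by clear -hy; lra.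
    ring.
  + have hz : hol_at z (fun x => w x - s z x) by apply: hw; rewrite /= h2 ltW.
    apply: hol_at_eq (hol_atB hz (hh'' z Qz (ltW zc))).
    have e0 : 0 < co z d - c by rewrite subr_gt0.
    apply: filterS (co_near z d e0) => q; rewrite ltr_norml => /andP[hy _].
    have /negbTE-> : ~~ (co q d <= c) by rewrite -ltNge; clear -hy; lra.
    ring.
  + have hz : hol_at z (fun x => u x - s z x) by apply: hu; rewrite /= h1 zc lexx.
    have zc' : co z d <= c by rewrite zc.
    apply: hol_at_eq (hol_atB hz (hh' z Qz zc')).
    apply: filterS (hv z Qz zc) => q E; case: ifP => _; first by ring.
    by rewrite -[w q](subKr (u q)) E; ring.
- by exists u => z Qz; apply: hu; split => //; case: Qz => bz _; exact: bz.
Qed.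

End fixN.
End Poly.

Section Oka.
Context {R : realType}.
Local Notation C := R[i].

Section emb.
Variable N : nat.
Implicit Types (z y : 'rV[C]_N) (Z Y : 'rV[C]_(N + 1)).

Definition lastI : 'I_(N + 1) := rshift N ord0.
Definition prj Z : 'rV[C]_N := lsubmx Z.
Definition lst Z : C := Z 0 lastI.
(** The pair (z, w), written in the standard basis so that differentiability reduces to that of
    coordinates. *)
Definition emb z (w : C) : 'rV[C]_(N + 1) :=
  \sum_i z 0 i *: dirv (lshift 1 i) + w *: dirv lastI.

Lemma emb_l z w i : emb z w 0 (lshift 1 i) = z 0 i.
Proof.
rewrite mxE summxE (bigD1 i) //= big1 => [|j ji]; rewrite !mxE /=.
  by rewrite eqxx eq_shift mulr1 mulr0 !addr0.
by rewrite eq_lshift eq_sym (negbTE ji) mulr0.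
Qed.

Lemma lst_emb z w : lst (emb z w) = w.
Proof.
rewrite /lst mxE summxE big1 => [|j _]; rewrite !mxE /=; last by rewrite eq_shift mulr0.
by rewrite eqxx mulr1 add0r.
Qed.

Lemma prj_emb z w : prj (emb z w) = z.
Proof. by apply/rowP => i; rewrite mxE emb_l. Qed.

Lemma emb_prj Z : emb (prj Z) (lst Z) = Z.
Proof.
apply/rowP => j; case: (split_ordP j) => k ->; first by rewrite emb_l mxE.
by rewrite ord1 -[LHS]/(lst _) lst_emb.
Qed.

Lemma differentiable_prj Z : differentiable prj Z.
Proof. exact: differentiable_lsubmx. Qed.

Lemma differentiable_lst Z : differentiable lst Z.
Proof. exact: differentiable_coord. Qed.

Lemma differentiable_emb z (p : 'rV[C]_N -> C) : differentiable p z ->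
  differentiable (fun y => emb y (p y)) z.
Proof.
move=> dp; apply: differentiableD; last exact: differentiableZl.
have := @differentiable_sum _ _ _ N
  (fun i y => y 0 i *: (dirv (lshift 1 i) : 'rV[C]_(N + 1))) z.
rewrite (_ : \sum_i _ = fun y => \sum_i y 0 i *: dirv (lshift 1 i)).
  by apply => i; apply: differentiableZl; exact: differentiable_coord.
by apply/funext => y; rewrite fct_sumE.
Qed.

Definition lift2 (a : dir N -> R) (c : R) : dir (N + 1) -> R :=
  fun d => match fintype.split d.1 with inl i => a (i, d.2) | inr _ => c end.

Lemma box_lift a b Z :
  box (lift2 a (-2)) (lift2 b 2) Z <-> box a b (prj Z) /\ sqv (lst Z).
Proof.
split=> [h|[h1 [h2 h3]] [j t]].
  split=> [[i t]|].
    have := h (lshift 1 i, t); rewrite /lift2 /=.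
    rewrite (_ : fintype.split (lshift 1 i) = inl i); last by rewrite (unsplitK (inl _ i)).
    by rewrite /co /= mxE.
  have := h (lastI, false); have := h (lastI, true); rewrite /lift2 /=.
  rewrite (_ : fintype.split lastI = inr ord0); last by rewrite (unsplitK (inr _ ord0)).
  by rewrite /co /=.
rewrite /lift2 /=; case: (split_ordP j) => k E.
  by have := h1 (k, t); rewrite /co /= E mxE.
have {}E : j = lastI by rewrite E ord1.
by rewrite /co /= E; case: t.
Qed.

Lemma co_emb z w i t : co (emb z w) (lshift 1 i, t) = co z (i, t).
Proof. by rewrite /co /= emb_l. Qed.

Definition mapps (ps : seq ('rV[C]_N -> C)) : seq ('rV[C]_(N + 1) -> C) :=
  [seq p \o prj | p <- ps].

Lemma sqs_map ps Z : sqs (mapps ps) Z <-> sqs ps (prj Z).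
Proof. by elim: ps => //= p ps IH; rewrite IH. Qed.

Lemma poly_lift a b ps Z :
  poly (lift2 a (-2)) (lift2 b 2) (mapps ps) Z <-> poly a b ps (prj Z) /\ sqv (lst Z).
Proof.
split=> [[/box_lift[h1 h2] /sqs_map h3]|[[h1 h3] h2]] //.
by split; [exact/box_lift|exact/sqs_map].
Qed.

Lemma hol_at_prj (h : 'rV[C]_N -> C) Z : hol_at (prj Z) h ->
  hol_at Z (fun Y => h (prj Y)).
Proof. by apply: hol_at_compW => Y; exact: differentiable_prj. Qed.

Lemma hol_at_lst Z : hol_at Z lst.
Proof. by apply: hol_atW => Y; exact: differentiable_lst. Qed.

Lemma hps_lift a b ps : hps (box a b) ps ->
  hps (box (lift2 a (-2)) (lift2 b 2)) (mapps ps).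
Proof.
elim: ps => //= p ps IH [h1 /IH h2]; split => // Z /box_lift[bz _].
by apply: hol_at_prj; exact: h1.
Qed.

(* Oka's trick: solving the Cousin problem for [h(z) / (w - p(z))] extends [h]
   from the graph of [p]. *)
Lemma oka_extension a b (p h : 'rV[C]_N -> C) ps :
  (forall z, box a b z -> hol_at z p) ->
  cousin (poly (lift2 a (-2)) (lift2 b 2) (mapps ps)) ->
  (forall z, poly a b (p :: ps) z -> hol_at z h) ->
  exists2 H : 'rV[C]_(N + 1) -> C,
    forall Z, poly (lift2 a (-2)) (lift2 b 2) (mapps ps) Z -> hol_at Z H &
    forall z, H (emb z (p z)) = h z.
Proof.
move=> hp cou hh.
pose g Y := lst Y - p (prj Y).
pose s Z Y := if g Z == 0 then h (prj Y) * (g Y)^-1 else 0.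
set Q := poly (lift2 a (-2)) _ _ in cou *.
have hg Z : Q Z -> hol_at Z g.
  move=> /poly_lift[[bz _] _]; apply: hol_atB; first exact: hol_at_lst.
  by apply: hol_at_prj; exact: hp.
have on Z : Q Z -> g Z = 0 -> hol_at Z (fun Y => h (prj Y)).
  move=> /poly_lift[[bz sz] sl] /eqP; rewrite subr_eq0 => /eqP E.
  by apply: hol_at_prj; apply: hh; split => //=; rewrite -E.
have off Z : Q Z -> g Z != 0 -> \forall Y \near Z, g Y != 0.
  by move=> QZ; apply: near_neq0; apply: hol_at_cts; exact: hg.
have [|u hu] := cou s.
  move=> Z QZ; have [gZ|gZ] := eqVneq (g Z) 0.
    apply: filterS (hol_at_near (on Z QZ gZ)) => Y hY QY.
    rewrite /s gZ eqxx; case: eqP => gY.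
      by apply: hol_at_ext (hol_at_cst Y 0) => t; rewrite subrr.
    apply: hol_atB; last exact: hol_at_cst.
    by apply: hol_atM => //; apply: hol_atV; [exact: hg|exact/eqP].
  apply: filterS (off Z QZ gZ) => Y gY QY; rewrite /s (negbTE gZ) (negbTE gY).
  by apply: hol_at_ext (hol_at_cst Y 0) => t; rewrite subrr.
(* This is h + g (u - h / g): as inverses of 0 are 0, the second term restores the value h on the
   graph, where g vanishes. *)
exists (fun Y => g Y * u Y + (if g Y == 0 then h (prj Y) else 0)); last first.
  by move=> z; rewrite /g lst_emb prj_emb subrr eqxx mul0r add0r.
move=> Z QZ; have := hu Z QZ; rewrite /s; have [gZ|gZ] := eqVneq (g Z) 0 => hZ.
  apply: hol_at_ext (hol_atD (on Z QZ gZ) (hol_atM (hg Z QZ) hZ)) => Y.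
  rewrite mulrBr; case: eqP => [->|/eqP gY].
    by rewrite !mul0r subr0 addr0 add0r.
  by rewrite mulrCA divff // mulr1 addr0 addrC subrK.
apply: hol_at_eq (hol_atM (hg Z QZ) hZ).
by apply: filterS (off Z QZ gZ) => Y /negbTE->; rewrite subr0 addr0.
Qed.

End emb.

Lemma poly_setd N a b ps (z : 'rV[C]_N) d c : poly a b ps z -> co z d = c ->
  poly (setd a d c) (setd b d c) ps z.
Proof.
move=> [bz sz] zc; split => // d'; rewrite /setd.
by case: eqP => [->|_]; [rewrite zc lexx|exact: bz].
Qed.

(** Induction on the number of functions, for all dimensions at once: v is extended from the graph
    of p to one more variable, split there with one function fewer, and pulled back along the graph.
    The Cousin problem needed for the extension is solved by the same induction hypothesis. *)
Lemma splits_poly m : forall N a b (ps : seq ('rV[C]_N -> C)), size ps = m ->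
  hps (box a b) ps -> splits (poly a b ps).
Proof.
elim: m => [|m IH] N a b [|p ps] //= => [_ _|[sz] [hp hps]] v d c hv.
  have [|h' [h'' [h1 h2 h3]]] := @split_box R N v a b d c.
    by move=> z bz; apply: hv.
  exists h', h''; split=> z [bz _]; [exact: h1|exact: h2|exact: h3].
have lsz : size (mapps ps) = m by rewrite size_map.
(* When no point of the box has [co z d = c], the slab below leaves the box. *)
have [[z0 [bz0 cz0]]|nz] := pselect (exists z, box a b z /\ co z d = c); last first.
  exists (fun=> 0), (fun=> 0); split; do ?by move=> *; exact: hol_at_cst.
  by move=> z [bz _] cz; exfalso; apply: nz; exists z.
have sub : box (setd a d c) (setd b d c) `<=` box a b.
  move=> z bz d'; have := bz d'; rewrite /setd; case: eqP => [->|//].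
  by move=> /andP[? ?]; have := bz0 d; rewrite cz0 => /andP[? ?]; apply/andP; split; lra.
have onc z : box (setd a d c) (setd b d c) z -> co z d = c.
  by move=> /(_ d); rewrite /setd eqxx => ?; apply/eqP; rewrite eq_le andbC.
(* The box is flattened to co z d = c, since v is holomorphic only there. *)
have [|||H hH HE] := @oka_extension N (setd a d c) (setd b d c) p v ps.
- by move=> z /sub; exact: hp.
- apply: cousin_of_splits; first by apply: hps_lift; exact: hps_sub hps.
  by move=> a' b' h; exact: IH.
- move=> z [bz sz']; apply: hv; last exact: onc.
  by split => //; exact: sub.
have [|H' [H'' [h1 h2 h3]]] := IH _ _ _ _ lsz (hps_lift hps) H (lshift 1 d.1, d.2) c.
  move=> Z QZ Zc; apply: hH.
  have /poly_lift[q1 q2] := QZ; apply/poly_lift; split => //.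
  apply: poly_setd => //; rewrite -Zc -{2}(emb_prj Z) co_emb.
  by case: (d).
have Qe z : poly a b (p :: ps) z ->
    poly (lift2 a (-2)) (lift2 b 2) (mapps ps) (emb z (p z)).
  move=> [bz [s1 s2]]; apply/poly_lift; rewrite prj_emb lst_emb; split => //.
have ce z : co (emb z (p z)) (lshift 1 d.1, d.2) = co z d.
  by rewrite co_emb; case: (d).
have de z : poly a b (p :: ps) z -> \forall y \near z,
    differentiable (fun y => emb y (p y)) y.
  by move=> [bz _]; apply: filterS (hp z bz) => y; exact: differentiable_emb.
exists (fun z => H' (emb z (p z))), (fun z => H'' (emb z (p z))); split.
- move=> z Qz zc; apply: (hol_at_comp (F := fun y => emb y (p y)) (de z Qz)).
  by apply: h1; [exact: Qe|rewrite ce].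
- move=> z Qz zc; apply: (hol_at_comp (F := fun y => emb y (p y)) (de z Qz)).
  by apply: h2; [exact: Qe|rewrite ce].
- move=> z Qz zc.
  have cF : {for z, continuous (fun y => emb y (p y))}.
    exact/differentiable_continuous/(nbhs_singleton (de z Qz)).
  have := h3 (emb z (p z)) (Qe z Qz); rewrite ce => /(_ zc) hn.
  have hn' : \forall y \near z, H (emb y (p y)) = H' (emb y (p y)) - H'' (emb y (p y)).
    exact: (cF _ hn).
  by apply: filterS hn' => y <-; rewrite HE.
Qed.

Lemma cousin_poly N a b (ps : seq ('rV[C]_N -> C)) : hps (box a b) ps ->
  cousin (poly a b ps).
Proof.
move=> h; apply: cousin_of_splits => // a' b' h'.
exact: splits_poly (erefl _) h'.
Qed.

End Oka.

(** * Approximation on polyhedra *)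

Section Approx.
Context {R : realType}.
Local Notation C := R[i].

Lemma compact_bnd {T : topologicalType} {W : normedModType C} (K : set T)
    (f : T -> W) : compact K ->
  (forall z, K z -> {for z, continuous f}) ->
  exists2 M : R, 0 < M & forall z, K z -> rn (f z) <= M.
Proof.
move=> cK cf.
have [||d d0 hd] := @compact_unif R _ K (fun z d => rn (f z) <= d^-1) cK.
- move=> x d d' h /andP[d'0 dd]; apply: le_trans h _.
  by rewrite lef_pV2 ?posrE // (lt_le_trans d'0).
- move=> z Kz; have /ctsP/(_ _ ltr01) h := cf z Kz.
  have p1 : 0 < rn (f z) + 1 by rewrite ltr_wpDl ?rn_ge0.
  exists (rn (f z) + 1)^-1; first by rewrite invr_gt0.
  apply: filterS h => y hy _; rewrite invrK.
  by have := ler_rn_sub (f y) (f z); move: hy; clear; lra.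
by exists d^-1; [rewrite invr_gt0|].
Qed.

Lemma pow_half_small (B e : R) : 0 < e -> exists n, B * 2^-1 ^+ n <= e.
Proof.
move=> e0; have [B0|B0] := leP B 0.
  by exists 0%N; rewrite expr0 mulr1 (le_trans B0) // ltW.
exists (Num.bound (B / e)); set n := Num.bound _.
have h : B / e < n%:R by apply: archi_boundP; rewrite divr_ge0 ?ltW.
rewrite exprVn ler_pdivrMr ?exprn_gt0 // mulrC.
have h2 : n%:R <= 2 ^+ n :> R by rewrite -natrX ler_nat ltnW // ltn_expl.
by rewrite -ler_pdivrMr //; apply: le_trans (ltW h) h2.
Qed.

Lemma rbd2_ge (u : C) : rbd (-2) 2 (-2) 2 u -> 2 <= rn u.
Proof.
move=> [_ _ h]; have h1 := ler_Re_rn u; have h2 := ler_Im_rn u.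
have n2 : `|2 : R| = 2 by rewrite ger0_norm.
by case: h => E; [apply: le_trans h1|apply: le_trans h1|apply: le_trans h2|
  apply: le_trans h2]; rewrite E ?normrN n2.
Qed.

Section OneVar.
Variables (g : C -> C) (w : C).
Hypotheses (dg : drect g (-2) 2 (-2) 2) (w1 : rn w <= 1).
Let rI (f : C -> C) := rint f (-2) 2 (-2) 2.
Let J n := rI (fun u => g u * u^-1 ^+ n * (u - w)^-1).
(** The n-th Taylor coefficient of g at 0, times [kappa]. The idle [u - 0] gives it the shape of the
    kernel of J with w = 0, and of [eint]. *)
Definition tcoef n := rI (fun u => g u * u^-1 ^+ n * (u - 0)^-1).

Lemma rbd_g (u : C) : rbd (-2) 2 (-2) 2 u -> {for u, continuous g}.
Proof. by move=> [h1 h2 _]; apply: differentiable_continuous; exact: dg. Qed.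

Lemma rbd_ne (u : C) : rbd (-2) 2 (-2) 2 u -> u != 0.
Proof. by move=> /rbd2_ge h; apply: rn_ge1_neq0; apply: le_trans h; lra. Qed.

Lemma rbd_sub (u : C) : rbd (-2) 2 (-2) 2 u -> 1 <= rn (u - w).
Proof.
move=> /rbd2_ge h; have h1 := ler_rn_sub u w; apply: le_trans h1.
have w1' := w1; have : 2 - 1 <= rn u - rn w by apply: lerB.
by apply: le_trans; lra.
Qed.

Lemma cts_pow n (u : C) : u != 0 -> {for u, continuous (fun x : C => x^-1 ^+ n)}.
Proof.
move=> u0; apply: hol_at_cts; apply: hol_atX; apply: hol_atV => //.
by apply: hol_atW => y; exact: differentiable_idfun.
Qed.

Lemma cts_sub (c u : C) : u - c != 0 -> {for u, continuous (fun x : C => (x - c)^-1)}.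
Proof.
by rewrite subr_eq0 => h; apply: differentiable_continuous; exact: diff_invsub.
Qed.

Lemma cbd_J n (c : C) : (forall u : C, rbd (-2) 2 (-2) 2 u -> u - c != 0) ->
  cbd (fun u => g u * u^-1 ^+ n * (u - c)^-1) (-2) 2 (-2) 2.
Proof.
move=> hc u hu; apply: continuousM; last exact/cts_sub/hc.
by apply: continuousM; [exact: rbd_g|exact/cts_pow/rbd_ne].
Qed.

Lemma nw (u : C) : rbd (-2) 2 (-2) 2 u -> u - w != 0.
Proof. by move=> hu; apply: rn_ge1_neq0; exact: rbd_sub. Qed.

Lemma n0 (u : C) : rbd (-2) 2 (-2) 2 u -> u - 0 != 0.
Proof. by move=> hu; rewrite subr0; exact: rbd_ne. Qed.

(** One step of the geometric expansion 1/(u-w) = 1/u + w/(u(u-w)). *)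
Lemma J_step n : J n = tcoef n + w * J n.+1.
Proof.
have L : -2 <= 2 :> R by lra.
have E1 := rintZ w L L (cbd_J (n := n.+1) nw).
have c1 : cbd (fun u => w * (g u * u^-1 ^+ n.+1 * (u - w)^-1)) (-2) 2 (-2) 2.
  move=> u hu; apply: continuousM; first exact: (hol_at_cts (hol_at_cst u w)).
  exact: (cbd_J (n := n.+1) nw).
have E2 := rintD L L (cbd_J (n := n) n0) c1.
rewrite -[w * J _]E1 -[RHS]E2; apply: eq_rint => // u hu.
rewrite exprS subr0; have := nw hu; have := rbd_ne hu; set t := u^-1 ^+ n.
by move=> h1 h2; field; do ?[apply/andP; split].
Qed.

Lemma J_sum n : J 0 = \sum_(k < n) tcoef k * w ^+ k + w ^+ n * J n.
Proof.
elim: n => [|n IH]; first by rewrite big_ord0 add0r expr0 mul1r.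
by rewrite IH big_ord_recr /= {1}J_step exprSr; ring.
Qed.

(** The remainder is w^n J n. On the boundary of the square of side 4 one has |u| >= 2 and |u - w|
    >= 1, whence 2^-n; the factor 32 is 4 (4 + 4) from [rint_bnd]. *)
Lemma taylor_bound M n : (forall u : C, rbd (-2) 2 (-2) 2 u -> rn (g u) <= M) ->
  rn (g w - \sum_(k < n) (kappa^-1 * tcoef k) * w ^+ k) <=
    rn (kappa : C)^-1 * 32 * M * 2^-1 ^+ n.
Proof.
move=> hM; have L : -2 <= 2 :> R by lra.
have hw := w1; have r1 := ler_Re_rn w; have r2 := ler_Im_rn w.
have /andP[wr1 wr2] : -2 < complex.Re w < 2.
  by move: r1; rewrite ler_norml => /andP[? ?]; apply/andP; split; lra.
have /andP[wi1 wi2] : -2 < complex.Im w < 2.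
  by move: r2; rewrite ler_norml => /andP[? ?]; apply/andP; split; lra.
have E : kappa * g w = J 0.
  rewrite -(cauchy dg (z := w)) ?wr1 ?wi1 //.
  by apply: eq_rint => // u _; rewrite expr0 mulr1.
have -> : g w - \sum_(k < n) kappa^-1 * tcoef k * w ^+ k = kappa^-1 * (w ^+ n * J n).
  rewrite -[X in X - _](mulKf kappa_neq0) E (J_sum n) mulrDr addrC mulr_sumr.
  by rewrite (eq_bigr (fun k : 'I_n => kappa^-1 * (tcoef k * w ^+ k)));
    [rewrite addKr|move=> k _; rewrite mulrA].
rewrite rnM -!mulrA; apply: ler_wpM2l; first exact: rn_ge0.
rewrite rnM rnX -[leRHS]mul1r; apply: ler_pM; rewrite ?exprn_ge0 ?rn_ge0 //.
  by rewrite exprn_ile1 ?rn_ge0.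
have hb := rint_bnd L L (cbd_J (n := n) nw) (M := M * 2^-1 ^+ n).
apply: le_trans (hb _) _; last first.
  by set t := M * _; lra.
move=> u hu; rewrite !rnM -[leRHS]mulr1; apply: ler_pM; rewrite ?mulr_ge0 ?rn_ge0 //.
  apply: ler_pM; rewrite ?rn_ge0 ?hM // rnX.
  rewrite rnV; apply: lerXn2r; rewrite ?nnegrE ?invr_ge0 ?rn_ge0 //.
  rewrite lef_pV2 ?posrE //; first exact: rbd2_ge.
  by apply: lt_le_trans (rbd2_ge hu).
by rewrite rnV invf_le1 ?rbd_sub // (lt_le_trans _ (rbd_sub hu)).
Qed.

End OneVar.

(** Taylor expansion in the last variable. The bound of G on the compact box makes one n serve all
    z. *)
Lemma taylor_last N a b (G : 'rV[C]_(N + 1) -> C) e :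
  (forall Z, box (lift2 a (-2)) (lift2 b 2) Z -> hol_at Z G) -> 0 < e ->
  exists n, exists2 c : nat -> 'rV[C]_N -> C,
    forall k z, box a b z -> hol_at z (c k) &
    forall z w, box a b z -> rn w <= 1 ->
      rn (G (emb z w) - \sum_(k < n) c k z * w ^+ k) <= e.
Proof.
move=> hG e0.
have [M M0 hM] : exists2 M : R, 0 < M & forall Z, box (lift2 a (-2)) (lift2 b 2) Z ->
    rn (G Z) <= M.
  by apply: compact_bnd; [exact: box_compact|move=> Z /hG/hol_at_cts].
have [n hn] := pow_half_small (rn (kappa : C)^-1 * 32 * M) e0.
exists n, (fun k z => kappa^-1 * tcoef (fun u => G (emb z u)) k); last first.
  move=> z w bz w1; apply: le_trans hn; apply: taylor_bound => //.
    move=> u h1 h2; apply: (differentiable_comp (g := G)).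
      rewrite (_ : emb z = fun u => emb z 0 + u *: dirv (lastI N)).
        apply: differentiableD; first exact: differentiable_cst.
        by apply: differentiableZl; exact: differentiable_idfun.
      by apply/funext => t; rewrite /emb scale0r addr0.
    by apply: hol_at_diff; apply: hG; apply/box_lift; rewrite prj_emb lst_emb.
  by move=> u [h1 h2 _]; apply: hM; apply/box_lift; rewrite prj_emb lst_emb.
move=> k z bz; apply: hol_atM; first exact: hol_at_cst.
(* With v, each edge of the coefficient integral is an [eint] in the last variable, evaluated at (y,
   0); so [eint_hol] gives holomorphy in y. *)
pose v Y := G Y * (lst Y)^-1 ^+ k.
have updE u y : upd (emb y 0) (lastI N) u = emb y u :> 'rV[C]_(N + 1).
  have -> : emb y u = emb y 0 + u *: dirv (lastI N) by rewrite /emb scale0r addr0.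
  by rewrite /upd -/(lst _) lst_emb subr0.
have lE y : emb y 0 0 (lastI N) = 0 := lst_emb y 0.
have E p q : hol_at z (fun y : 'rV[C]_N => eint v (lastI N) p q (emb y 0)) ->
    hol_at z (fun y => lint (fun u => G (emb y u) * u^-1 ^+ k * (u - 0)^-1) p q).
  apply: hol_at_ext => y; rewrite /eint; apply: eq_lint => s _.
  by rewrite updE lE /v lst_emb.
have H p q : (forall s : R, 0 <= s <= 1 -> rbd (-2) 2 (-2) 2 (seg p q s)) ->
    hol_at z (fun y => lint (fun u => G (emb y u) * u^-1 ^+ k * (u - 0)^-1) p q).
  move=> hs; apply: E; apply: (hol_at_compW (F := fun y : 'rV[C]_N => emb y 0)).
    by move=> y; apply: differentiable_emb; exact: differentiable_cst.
  have ns s : 0 <= s <= 1 -> seg p q s != 0.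
    by move=> /hs/rbd2_ge h; apply: rn_ge1_neq0; apply: le_trans h; lra.
  apply: eint_hol => s s01; last by rewrite lE; exact: ns.
  rewrite updE; apply: hol_atM.
    by apply: hG; apply/box_lift; rewrite prj_emb lst_emb; have [] := hs s s01.
  apply: hol_atX; apply: hol_atV; first exact: hol_at_lst.
  by rewrite lst_emb; exact: ns.
have L : -2 <= 2 :> R by lra.
rewrite /tcoef /rint /hint /vint.
apply: hol_atB; first apply: hol_atD; first apply: hol_atB; apply: H => s s01.
- by apply: rbd_h => //; left.
- by apply: rbd_h => //; right.
- by apply: rbd_v => //; right.
- by apply: rbd_v => //; left.
Qed.

Fixpoint le1 N (ps : seq ('rV[C]_N -> C)) z : Prop :=
  if ps is p :: ps' then rn (p z) <= 1 /\ le1 ps' z else True.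

Lemma le1_map N (ps : seq ('rV[C]_N -> C)) Z : le1 (mapps ps) Z <-> le1 ps (prj Z).
Proof. by elim: ps => //= p ps IH; rewrite IH. Qed.

Lemma rn1_sqv (u : C) : rn u <= 1 -> sqv u.
Proof.
have := ler_Re_rn u; have := ler_Im_rn u; rewrite !ler_norml => /andP[? ?] /andP[? ?] ?.
by split; apply/andP; split; lra.
Qed.

(** Induction on the number of functions: h is extended off the graph of p, the extension is
    approximated by G on the larger box, and the Taylor sums of G in the last variable are evaluated
    at p z. Each of the two errors is at most e / 2. *)
Lemma oka_approx m : forall N a b (ps : seq ('rV[C]_N -> C)) h e, size ps = m ->
  hps (box a b) ps -> (forall z, poly a b ps z -> hol_at z h) -> 0 < e ->
  exists2 A, forall z, box a b z -> hol_at z A &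
    forall z, box a b z -> le1 ps z -> rn (h z - A z) <= e.
Proof.
elim: m => [|m IH] N a b [|p ps] //= h e.
  move=> _ _ hh e0; exists h; first by move=> z bz; exact: hh.
  by move=> z _ _; rewrite subrr rn0 ltW.
move=> [sz] [hp hps] hh e0.
have [||H hH HE] := @oka_extension R N a b p h ps hp => //.
  by apply: cousin_poly; exact: hps_lift.
have e2 : 0 < e / 2 by rewrite divr_gt0.
have [|G hG GE] := IH _ _ _ (mapps ps) H (e / 2) _ (hps_lift hps) hH e2.
  by rewrite size_map.
have [n [c hc cE]] := taylor_last hG e2.
exists (fun z => \sum_(k < n) c k z * p z ^+ k).
  move=> z bz; apply: hol_at_sum => k; apply: hol_atM; first exact: hc.
  by apply: hol_atX; exact: hp.
move=> z bz [p1 l1]; rewrite -HE.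
have := ler_rnD (H (emb z (p z)) - G (emb z (p z)))
  (G (emb z (p z)) - \sum_(k < n) c k z * p z ^+ k).
rewrite addrA subrK => h1; apply: le_trans h1 _; rewrite (splitr e).
apply: lerD; last exact: cE.
apply: GE; last by apply/le1_map; rewrite prj_emb.
by apply/box_lift; rewrite prj_emb lst_emb; split => //; exact: rn1_sqv.
Qed.

End Approx.

(** * Holomorphic hulls and Rossi's local maximum principle *)

Lemma cRe_inv {R : realType} (w : R[i]) :
  complex.Re w^-1 = complex.Re w / rn w ^+ 2.
Proof. by rewrite rn_sqr; case: w. Qed.

Lemma thirds {R : realType} (x : R) : x / 3 + x / 3 + x / 3 = x.
Proof. by field. Qed.

Section CompactInd.
Context {R : realType} {T : topologicalType}.
Implicit Types (K A B : set T).

(** The sets A such that K minus A satisfies P form a filter. If P K failed it would be proper, and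
    local validity excludes every cluster point. *)
Lemma compact_ind K (P : set T -> Prop) : compact K -> P set0 ->
  (forall A B, A `<=` B -> P B -> P A) -> (forall A B, P A -> P B -> P (A `|` B)) ->
  (forall x, K x -> exists2 U, nbhs x U & P U) -> P K.
Proof.
move=> cK P0 Psub PU loc; apply: contrapT => nP.
pose F A := P (K `\` A).
have FF : Filter F.
  split; rewrite /F.
  - by rewrite setDT.
  - by move=> A B hA hB; rewrite setDIr; exact: PU.
  - by move=> A B AB; apply: Psub => x [Kx nB]; split => // /AB.
have PF : ProperFilter F.
  by split => // h; apply: nP; move: h; rewrite /F setD0.
have [|x [Kx cx]] := cK F PF; first by rewrite /F setDv.
have [U xU PUU] := loc x Kx.
have FU : F (~` U) by apply: Psub PUU => y [_ /contrapT].
by have [y []] := cx _ _ FU xU.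
Qed.

Lemma compact_has_max K (f : T -> R) : compact K -> K !=set0 ->
  (forall x, K x -> {for x, continuous f}) ->
  exists2 x, K x & forall y, K y -> f y <= f x.
Proof.
move=> cK [x0 Kx0] cf; have [||x Kx h] := compact_EVT_max (f := f) _ cK.
- by exists x0.
- by apply: continuous_in_subspaceT => x; rewrite inE; exact: cf.
- by exists x => [|y Ky]; [rewrite inE in Kx|apply: h; rewrite inE].
Qed.

End CompactInd.

Section Hull.
Context {R : realType}.
Local Notation C := R[i].
Variable N : nat.
Implicit Types (z y : 'rV[C]_N) (A Y K U : set 'rV[C]_N).

Lemma rV_haus : hausdorff_space 'rV[C]_N.
Proof. exact: norm_hausdorff. Qed.

Lemma closed_of_near A : (forall z, ~ A z -> \forall y \near z, ~ A y) -> closed A.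
Proof.
move=> h; rewrite -[A]setCK; apply: open_closedC; rewrite openE => z; exact: h.
Qed.

Lemma near_setC A z : closed A -> ~ A z -> \forall y \near z, ~ A y.
Proof. by move=> cA nA; apply: open_nbhs_nbhs; split => //; exact: closed_openC. Qed.

Variables (a b : dir N -> R) (Y : set 'rV[C]_N).
Hypothesis Yb : Y `<=` box a b.
(** The hull of Y for functions holomorphic near the box. Bounds M stand in for the supremum over Y,
    so that no compactness of Y is needed here. *)
Definition hull : set 'rV[C]_N := [set z | box a b z /\ forall g M, 0 <= M ->
  (forall y, box a b y -> hol_at y g) -> (forall y, Y y -> rn (g y) <= M) ->
  rn (g z) <= M].

Lemma sub_hull : Y `<=` hull.
Proof. by move=> y Yy; split=> [|g M M0 _ h]; [exact: Yb|exact: h]. Qed.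

(** Divide g by a number strictly between its bound on Y and |g z|, then take a high power
    (Bernoulli's inequality). The 3 exceeds 2 sqrt 2, hence puts the value outside the square of
    [sqv]. *)
Lemma hull_sep z : box a b z -> ~ hull z -> exists g, [/\
  forall y, box a b y -> hol_at y g, forall y, hull y -> rn (g y) <= 1 & 3 < rn (g z)].
Proof.
move=> bz nh; have : ~ forall g M, 0 <= M ->
  (forall y, box a b y -> hol_at y g) -> (forall y, Y y -> rn (g y) <= M) ->
  rn (g z) <= M by move=> h; apply: nh.
move=> /existsNP[g /existsNP[M /not_implyP[M0 /not_implyP[hg /not_implyP[hM]]]]].
move=> /negP; rewrite -ltNge => Mz.
pose M' := (M + rn (g z)) / 2.
have [M'0 MM' M'z] : [/\ 0 < M', M <= M' & M' < rn (g z)].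
  by rewrite /M'; split; lra.
pose q := rn (g z) / M'.
have q1 : 1 < q by rewrite ltr_pdivlMr // mul1r.
have [k hk] : exists k : nat, 3 < q ^+ k.
  have [k hk] : exists k : nat, 3 < 1 + (q - 1) *+ k.
    have h := archi_boundP (x := 2 / (q - 1)) _.
    exists (Num.bound (2 / (q - 1))); rewrite -(mulr_natl (q - 1)).
    have : 2 < (Num.bound (2 / (q - 1)))%:R * (q - 1).
      rewrite -ltr_pdivrMr ?subr_gt0 //; apply: h.
      by rewrite divr_ge0 // subr_ge0 ltW.
    by set t := _ * _; lra.
  exists k; apply: lt_le_trans hk _.
  elim: k => [|k IH]; first by rewrite mulr0n addr0 expr0.
  rewrite mulrSr exprSr addrA.
  have : (1 + (q - 1) *+ k) * q <= q ^+ k * q by rewrite ler_pM2r //; lra.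
  apply: le_trans; have : 0 <= (q - 1) *+ k by rewrite mulrn_wge0 // subr_ge0 ltW.
  set t := _ *+ k => t0; clearbody t; clear -q1 t0; nra.
exists (fun y => (g y * (M'^-1)%:C) ^+ k); split.
- move=> y b_y; apply: hol_atX; apply: hol_atM; first exact: hg.
  exact: hol_at_cst.
- move=> y [_ hy]; have := hy g M M0 hg hM => gM.
  rewrite rnX rnM rnR ger0_norm; last by rewrite invr_ge0 ltW.
  apply: exprn_ile1; first by rewrite divr_ge0 ?rn_ge0 // ltW.
  by rewrite ler_pdivrMr // mul1r (le_trans gM).
- by rewrite rnX rnM rnR ger0_norm ?invr_ge0 ?ltW.
Qed.

Lemma gt3_nsqv (u : C) : 3 < rn u -> ~ sqv u.
Proof.
move=> h [/andP[h1 h2] /andP[h3 h4]].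
by have := rn_sqr u; move: h h1 h2 h3 h4; set t := rn u; clearbody t; nra.
Qed.

Lemma hull_closed : closed hull.
Proof.
apply: closed_of_near => z nz; have [bz|bz] := pselect (box a b z).
  have [g [hg1 hg2 hg3]] := hull_sep bz nz.
  have e0 : 0 < rn (g z) - 3 by rewrite subr_gt0.
  have /ctsP/(_ _ e0) := hol_at_cts (hg1 z bz).
  apply: filterS => y hy /hg2 gy.
  have := ler_rn_sub (g z) (g y); rewrite rnB => h; clear -h hy gy hg3; lra.
have cb : closed (box a b) by apply: compact_closed; [exact: rV_haus|exact: box_compact].
by apply: filterS (near_setC cb bz) => y nb [].
Qed.

Lemma hull_box : hull `<=` box a b. Proof. by move=> z []. Qed.

Lemma hull_compact : compact hull.
Proof. by apply: subclosed_compact hull_box; [exact: hull_closed|exact: box_compact]. Qed.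

Lemma sqs_cat (ps qs : seq ('rV[C]_N -> C)) z : sqs (ps ++ qs) z <-> sqs ps z /\ sqs qs z.
Proof. by elim: ps => [|p ps IH] /=; [split=> [|[]]|rewrite IH; tauto]. Qed.
Lemma le1_cat (ps qs : seq ('rV[C]_N -> C)) z : le1 (ps ++ qs) z <-> le1 ps z /\ le1 qs z.
Proof. by elim: ps => [|p ps IH] /=; [split=> [|[]]|rewrite IH; tauto]. Qed.
Lemma hps_cat B (ps qs : seq ('rV[C]_N -> C)) : hps B (ps ++ qs) <-> hps B ps /\ hps B qs.
Proof. by elim: ps => [|p ps IH] /=; [split=> [|[]]|rewrite IH; tauto]. Qed.

(** Each point of the box outside the interior of U is expelled, with a neighbourhood, by one
    function from [hull_sep]; compactness leaves finitely many. *)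
Lemma hull_nbhd U : (forall z, hull z -> nbhs z U) -> exists ps,
  [/\ hps (box a b) ps, forall z, hull z -> le1 ps z & poly a b ps `<=` U].
Proof.
move=> hU; pose K := box a b `\` interior U.
have cK : compact K.
  apply: (@subclosed_compact _ _ (box a b)); last by move=> z [].
    apply: closedI; last exact/open_closedC/open_interior.
    by apply: compact_closed; [exact: rV_haus|exact: box_compact].
  exact: box_compact.
pose P (A : set 'rV[C]_N) := exists ps,
  [/\ hps (box a b) ps, forall z, hull z -> le1 ps z & forall z, A z -> ~ sqs ps z].
suff [ps [h1 h2 h3]] : P K.
  exists ps; split => // z [bz sz]; apply: contrapT => nU.
  by apply: (h3 z) => //; split => // /interior_subset.
apply: compact_ind cK _ _ _ _.
- by exists [::]; split => // z [].
- by move=> A B AB [ps [h1 h2 h3]]; exists ps; split => // z /AB; exact: h3.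
- move=> A B [ps [h1 h2 h3]] [qs [k1 k2 k3]]; exists (ps ++ qs); split.
  + exact/hps_cat.
  + by move=> z hz; apply/le1_cat; split; [exact: h2|exact: k2].
  + by move=> z AB /sqs_cat[s1 s2]; case: AB => [/h3|/k3]; exact.
- move=> z [bz nU]; have nh : ~ hull z by move=> /hU.
  have [g [hg1 hg2 hg3]] := hull_sep bz nh.
  have e0 : 0 < rn (g z) - 3 by rewrite subr_gt0.
  exists [set y | 3 < rn (g y)].
    have /ctsP/(_ _ e0) := hol_at_cts (hg1 z bz); apply: filterS => y hy.
    have := ler_rn_sub (g z) (g y); rewrite rnB /= => h; clear -h hy; lra.
  exists [:: g]; split => //=; first by move=> y hy; split => //; exact: hg2.
  by move=> y /gt3_nsqv h [/h].
Qed.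

Lemma hull_cousin U (s : 'rV[C]_N -> 'rV[C]_N -> C) :
  (forall z, hull z -> nbhs z U) ->
  (forall z, U z -> \forall y \near z, U y -> hol_at y (fun x => s z x - s y x)) ->
  exists u, forall z, hull z -> hol_at z (fun x => u x - s z x).
Proof.
move=> hU hs; have [ps [h1 h2 h3]] := hull_nbhd hU.
have [|u hu] := @cousin_poly R N a b ps h1 s.
  by move=> z Qz; apply: filterS (hs z (h3 z Qz)) => y h Qy; apply: h; exact: h3.
exists u => z hz; apply: hu; split; first by case: hz.
move: (h2 z hz); elim: (ps) => //= q qs IH [q1 /IH]; split => //.
exact: rn1_sqv.
Qed.

Lemma hull_approx h e : (forall z, hull z -> hol_at z h) -> 0 < e ->
  exists2 A, forall z, box a b z -> hol_at z A &
    forall z, hull z -> rn (h z - A z) <= e.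
Proof.
move=> hh e0.
have [|ps [h1 h2 h3]] := @hull_nbhd [set z | hol_at z h].
  by move=> z /hh/hol_at_near.
have [A hA hE] := oka_approx (erefl (size ps)) h1 h3 e0.
by exists A => // z hz; apply: hE; [case: hz|exact: h2].
Qed.

(** The hull is defined by functions on the whole box; approximation carries its inequality over to
    functions holomorphic near the hull only. *)
Lemma hull_max h M : 0 <= M -> (forall z, hull z -> hol_at z h) ->
  (forall z, Y z -> rn (h z) <= M) -> forall z, hull z -> rn (h z) <= M.
Proof.
move=> M0 hh hM z hz; apply/ler_addgt0Pr => e e0.
have e2 : 0 < e / 2 by rewrite divr_gt0.
have [A hA hE] := hull_approx hh e2.
have hAM : rn (A z) <= M + e / 2.
  case: hz => bz; apply; [by rewrite addr_ge0 // ltW| by [] |] => y Yy.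
  have := ler_rn_sub (A y) (h y); rewrite rnB.
  have h1 := hE y (sub_hull Yy); have h2 := hM y Yy => h3; clear -h1 h2 h3; lra.
have h1 := ler_rn_sub (h z) (A z); have h2 := hE z hz; clear -h1 h2 hAM; lra.
Qed.


(* Rossi's local maximum principle. If |G| exceeded its bound on [Bd], normalise
   its maximum over [A] to G(p) = 1 and solve the Cousin problem with data
   1 / (G - 1) near {G = 1}. After subtracting a constant the solution m has
   Re m <= -1 on the hull, so m / (1 - eps m) is holomorphic there and bounded on
   [Y] uniformly in eps, whereas its value at p is - 1 / eps. *)
Lemma hull_lmp (A Bd : set 'rV[C]_N) G M : compact Y -> compact A -> A `<=` hull ->
  (forall z, A z -> ~ Bd z -> \forall y \near z, hull y -> A y) ->
  (forall z, A z -> Y z -> Bd z) -> (forall z, A z -> hol_at z G) ->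
  0 <= M -> (forall z, Bd z -> rn (G z) <= M) -> forall z, A z -> rn (G z) <= M.
Proof.
move=> cY cA AS Aopen AY hG M0 hM z1 Az1; rewrite leNgt; apply/negP => Mz1.
have [p Ap pmax] : exists2 p, A p & forall y, A y -> rn (G y) <= rn (G p).
  apply: compact_has_max cA _ _; first by exists z1.
  move=> x /hG/hol_at_cts/ctsP h; apply/ctsRP => e e0; apply: filterS (h e e0) => y.
  by apply: le_lt_trans; rewrite ler_norml; have := ler_rn_sub (G y) (G x);
    have := ler_rn_sub (G x) (G y); rewrite rnB => ? ?; apply/andP; split; lra.
have Gp0 : G p != 0.
  by rewrite -rn_gt0; apply: le_lt_trans M0 (lt_le_trans Mz1 (pmax _ Az1)).
have Gp1 : 0 < rn (G p) by rewrite rn_gt0.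
pose g z := G z / G p.
have hg z : A z -> hol_at z g.
  by move=> Az; apply: hol_atM; [exact: hG|exact: hol_at_cst].
have gp : g p = 1 by rewrite /g divff.
have g1 z : A z -> rn (g z) <= 1.
  by move=> Az; rewrite /g rnM rnV ler_pdivrMr // mul1r pmax.
have gB z : Bd z -> g z != 1.
  move=> Bz; apply/eqP => /(congr1 (fun x : C => rn x)); rewrite /g rnM rnV rn1 => E.
  have : rn (G z) < rn (G p).
    by apply: le_lt_trans (hM z Bz) (lt_le_trans Mz1 (pmax _ Az1)).
  by rewrite -[X in X < _](divfK (lt0r_neq0 Gp1)) E mul1r ltxx.
pose Z := A `&` [set z | g z = 1].
have clA : closed A by apply: compact_closed => //; exact: rV_haus.
have cZ : compact Z.
  apply: (@subclosed_compact _ Z A) => // [|z []//].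
  apply: closed_of_near => z nZ; have [Az|Az] := pselect (A z); last first.
    by apply: filterS (near_setC clA Az) => y nA [].
  have gz : g z - 1 != 0 by rewrite subr_eq0; apply/eqP => E; apply: nZ.
  have := near_neq0 (hol_at_cts (hol_atB (hg z Az) (hol_at_cst z 1))) gz.
  by apply: filterS => y + [_ /= E]; rewrite E subrr eqxx.
have ZnB z : Z z -> ~ Bd z by move=> [_ /= E] /gB; rewrite E eqxx.
(* The radius is doubled because points within d of [near_Z] will be considered too. *)
have [d d0 hd] : exists2 d : R, 0 < d & forall k, Z k -> forall x, rn (x - k) < d + d ->
    differentiable g x /\ (hull x -> A x).
  apply: compact_unif cZ _ _.
    move=> k e e' h /andP[_ ee] x xk; apply: h; apply: lt_le_trans xk _.
    exact: lerD.
  move=> k Zk; have Ak : A k by case: Zk.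
  have /nbhs_rnP[r r0 hr] : \forall y \near k, differentiable g y /\ (hull y -> A y).
    by apply: filterS2 (hg k Ak) (Aopen k Ak (ZnB k Zk)).
  exists (r / 3); first by rewrite divr_gt0.
  apply/nbhs_rnP; exists (r / 3); first by rewrite divr_gt0.
  move=> k' kk _ x xk; apply: hr; rewrite -(subrK k' x) -addrA.
  apply: le_lt_trans (ler_rnD _ _) _; apply: lt_le_trans (ltrD xk kk) _.
  by rewrite thirds.
pose near_Z x := exists2 k, Z k & rn (x - k) < d.
pose s x y := if asbool (near_Z x) then (g y - 1)^-1 else 0.
have nZo x : near_Z x -> \forall y \near x, near_Z y.
  move=> [k Zk xk]; apply/nbhs_rnP; exists (d - rn (x - k)); first by rewrite subr_gt0.
  move=> y yx; exists k => //; rewrite -(subrK x y) -addrA.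
  apply: le_lt_trans (ler_rnD _ _) _; rewrite -(subrK (rn (x - k)) d).
  by rewrite ltr_leD.
(* The data jump at the rim of [near_Z], but there g - 1 has no zero on the hull and both choices
   are holomorphic. *)
pose U := [set x | near_Z x \/ (\forall y \near x, ~ near_Z y) \/
   (hol_at x g /\ g x != 1)].
have near1 x : hol_at x g -> g x != 1 -> \forall y \near x, g y != 1.
  move=> hx gx; have gx0 : g x - 1 != 0 by rewrite subr_eq0.
  have := near_neq0 (hol_at_cts (hol_atB hx (hol_at_cst x 1))) gx0.
  by apply: filterS => y; rewrite subr_eq0.
have SU3 z : hull z -> near_Z z \/ (\forall y \near z, ~ near_Z y) \/
    [/\ hol_at z g, g z != 1 & A z].
  move=> hz; have [|nz] := pselect (near_Z z); first by left.
  right; have [|fz] := pselect (\forall y \near z, ~ near_Z y); [by left|right].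
  have [y yz [k Zk yk]] : exists2 y, rn (y - z) < d & near_Z y.
    apply: contrapT => h; apply: fz; apply/nbhs_rnP; exists d => // y yz ny.
    by apply: h; exists y.
  have zk : rn (z - k) < d + d.
    rewrite -(subrK y z) -addrA; apply: le_lt_trans (ler_rnD _ _) _.
    by rewrite rnB ltrD.
  have Az : A z by have [_] := hd k Zk z zk; exact.
  split => //; first exact: hg.
  by apply/eqP => gz; apply: nz; exists z; rewrite ?subrr ?rn0.
have near_out z : hull z -> near_Z z -> ~ Z z -> [/\ hol_at z g, g z != 1 & A z].
  move=> hz [k Zk zk] nZ; have [|_ h] := hd k Zk z.
    by apply: lt_le_trans zk _; rewrite lerDl ltW.
  have Az := h hz; split => //; first exact: hg.
  by apply/eqP => gz; apply: nZ.
have [||u hu] := @hull_cousin U s.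
- move=> z hz; have [h|[h|[h1 h2 _]]] := SU3 z hz.
  + by apply: filterS (nZo z h) => y; left.
  + by apply: filterS (near_near h) => y; right; left.
  + by apply: filterS2 (hol_at_near h1) (near1 z h1 h2) => y ? ?; right; right.
- move=> x Ux; have inv y : hol_at y g -> g y != 1 -> hol_at y (fun t => (g t - 1)^-1).
    move=> hy gy; apply: hol_atV; last by rewrite subr_eq0.
    by apply: hol_atB => //; exact: hol_at_cst.
  have sE y t : near_Z y -> s y t = (g t - 1)^-1 by rewrite /s => /asboolT->.
  have sE0 y t : ~ near_Z y -> s y t = 0 by rewrite /s => /asboolF->.
  have same y t : near_Z x -> near_Z y -> s x t - s y t = 0.
    by move=> ? ?; rewrite !sE ?subrr.
  have same0 y t : ~ near_Z x -> ~ near_Z y -> s x t - s y t = 0.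
    by move=> ? ?; rewrite !sE0 ?subrr.
  case: Ux => [h|[h|[h1 h2]]].
  + apply: filterS (nZo x h) => y ny _.
    by apply: hol_at_ext (hol_at_cst y 0) => t; rewrite same.
  + have nx : ~ near_Z x by exact: (nbhs_singleton h).
    apply: filterS h => y ny _.
    by apply: hol_at_ext (hol_at_cst y 0) => t; rewrite same0.
  + apply: filterS2 (hol_at_near h1) (near1 x h1 h2) => y k1 k2 _.
    have hs q : hol_at y (s q).
      have [nq|nq] := pselect (near_Z q).
        by apply: hol_at_ext (inv y k1 k2) => t; rewrite sE.
      by apply: hol_at_ext (hol_at_cst y 0) => t; rewrite sE0.
    exact: hol_atB.
have uZ z : Z z -> hol_at z (fun x => u x - (g x - 1)^-1).
  move=> Zz; have := hu z (AS z (proj1 Zz)); apply: hol_at_ext => x.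
  rewrite /s asboolT //; exists z => //; by rewrite subrr rn0.
have uN z : hull z -> ~ Z z -> hol_at z u.
  move=> hz nZ; have h := hu z hz; have [nz|nz] := pselect (near_Z z).
    have [h1 h2 _] := near_out z hz nz nZ.
    have h3 : hol_at z (fun t => (g t - 1)^-1).
      apply: hol_atV; last by rewrite subr_eq0.
      by apply: hol_atB => //; exact: hol_at_cst.
    by apply: hol_at_ext (hol_atD h h3) => x; rewrite /s asboolT // subrK.
  by apply: hol_at_ext h => x; rewrite /s asboolF // subr0.
(* Near Z, |g| <= 1 gives Re (1 / (g - 1)) <= 0, so Re u is at most the real part of the holomorphic
   u - 1 / (g - 1). Hence Re u is bounded above in spite of the poles. *)
have [e e0 he] : exists2 e : R, 0 < e & forall z, hull z -> complex.Re (u z) <= e^-1.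
  apply: compact_unif hull_compact _ _.
    move=> z e e' h /andP[e'0 ee]; apply: le_trans h _.
    by rewrite lef_pV2 ?posrE // (lt_le_trans e'0).
  move=> z hz.
  have H (v : 'rV[C]_N -> C) : hol_at z v ->
      (\forall y \near z, hull y -> complex.Re (u y) <= complex.Re (v y)) ->
      exists2 e : R, 0 < e & \forall y \near z, hull y -> complex.Re (u y) <= e^-1.
    move=> hv uv; exists (rn (v z) + 1)^-1.
      by rewrite invr_gt0 ltr_wpDl ?rn_ge0.
    have /ctsP/(_ _ ltr01) := hol_at_cts hv; apply: filterS2 uv => y h1 h2 /h1 h3.
    rewrite invrK; apply: le_trans h3 _.
    have q1 := ler_Re_rn (v y); have q2 := ler_rn_sub (v y) (v z).
    have q3 := ler_norm (complex.Re (v y)); clear -q1 q2 q3 h2; lra.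
  have [Zz|nZ] := pselect (Z z); last first.
    by apply: (H u); [exact: uN|apply: filterS (uN z hz nZ)].
  apply: H (uZ z Zz) _.
  have [Az _] := Zz; apply: filterS (Aopen z Az (ZnB z Zz)) => y hA hy.
  have := g1 y (hA hy); rewrite cReB; set w := g y => w1.
  suff : complex.Re ((w - 1)^-1) <= 0 by lra.
  have [->|wn] := eqVneq w 1; first by rewrite subrr invr0.
  rewrite cRe_inv mulr_le0_ge0 ?invr_ge0 ?sqr_ge0 // cReB /=.
  by have := ler_Re_rn w; have := ler_norm (complex.Re w); lra.
pose c : C := (e^-1 + 1)%:C; pose m x := u x - c.
have mRe z (eps : R) : 0 < eps -> hull z -> 1 <= rn (1 - eps%:C * m z).
  move=> eps0 /he hz; apply: le_trans (ler_Re_rn _); apply: le_trans (ler_norm _).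
  rewrite cReB cReM cReB /= mul0r subr0.
  have : eps * (complex.Re (u z) - (e^-1 + 1)) <= 0 by rewrite pmulr_rle0 //; lra.
  by lra.
have mN z : hull z -> ~ Z z -> hol_at z m.
  by move=> hz nZ; apply: hol_atB; [exact: uN|exact: hol_at_cst].
have YnZ y : Y y -> ~ Z y by move=> Yy Zy; apply: (ZnB y Zy); apply: AY Yy; case: Zy.
have [B B0 hB] : exists2 B : R, 0 < B & forall y, Y y -> rn (m y) <= B.
  apply: compact_bnd cY _ => y Yy; apply: hol_at_cts; apply: mN; first exact: sub_hull.
  exact: YnZ.
(* Then the modulus of psi at p is 1 / eps = B + 1, too large for a function bounded by B on Y. *)
pose eps := (B + 1)^-1; have B1 : 0 < B + 1 by rewrite addr_gt0.
have eps0 : 0 < eps by rewrite invr_gt0.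
pose pole x := near_Z x /\ g x = 1.
pose psi x := if asbool (pole x) then - (eps%:C)^-1 else m x / (1 - eps%:C * m x).
have Zp : Z p by split.
have poleZ z : Z z -> pole z.
  by move=> Zz; split; [exists z; rewrite ?subrr ?rn0|case: Zz].
have epsC : (eps%:C : C) != 0 by rewrite -rn_gt0 rnR gtr0_norm.
suff : rn (psi p) <= B.
  rewrite /psi asboolT; last exact: poleZ.
  by rewrite rnN rnV rnR gtr0_norm // /eps invrK gerDl ler10.
suff [k1 k2] : (forall z, hull z -> hol_at z psi) /\ (forall y, Y y -> rn (psi y) <= B).
  exact: (@hull_max psi B (ltW B0) k1 k2 p (AS p Ap)).
split.
- move=> z hz; have [Zz|nZ] := pselect (Z z).
    have [Az /= gz] := Zz.
    pose q x := g x - 1; pose h x := u x - (g x - 1)^-1 - c.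
    have hq : hol_at z q by apply: hol_atB; [exact: hg|exact: hol_at_cst].
    have hh : hol_at z h by apply: hol_atB; [exact: uZ|exact: hol_at_cst].
    have qz : q z = 0 by rewrite /q gz subrr.
    have hqh : hol_at z (fun x => 1 + q x * h x).
      by apply: hol_atD; [exact: hol_at_cst|exact: hol_atM].
    (* At a pole, numerator and denominator of psi are multiplied by q = g - 1, where q m = 1 + q h
       with h holomorphic. *)
    have : hol_at z (fun x => (1 + q x * h x) / (q x - eps%:C * (1 + q x * h x))).
      apply: hol_atM => //; apply: hol_atV.
        by apply: hol_atB => //; apply: hol_atM => //; exact: hol_at_cst.
      by rewrite qz mul0r addr0 mulr1 sub0r oppr_eq0.
    apply: hol_at_eq; have nz : near_Z z by case: (poleZ z Zz).
    apply: filterS (nZo z nz) => y ny; rewrite /psi; case: asboolP => [[_ gy]|np].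
      by rewrite /q gy subrr mul0r addr0 mulr1 sub0r mul1r invrN.
    have q0 : q y != 0 by rewrite subr_eq0; apply/eqP => gy; apply: np.
    have E1 : 1 + q y * h y = q y * m y.
      by rewrite /h /m -/(q y) !mulrBr divff //; ring.
    have E2 : q y - eps%:C * (q y * m y) = q y * (1 - eps%:C * m y) by ring.
    by rewrite E1 E2 invfM mulrACA divff // mul1r.
  have np : \forall y \near z, ~ pole y.
    have H : hol_at z g -> g z != 1 -> \forall y \near z, ~ pole y.
      by move=> h1 h2; apply: filterS (near1 z h1 h2) => y + [_ E]; rewrite E eqxx.
    have [nz|[nz|[h1 h2 _]]] := SU3 z hz; last exact: H.
      by have [h1 h2 _] := near_out z hz nz nZ; exact: H.
    by apply: filterS nz => y ny [].
  have : hol_at z (fun x => m x / (1 - eps%:C * m x)).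
    have hm := mN z hz nZ; apply: hol_atM => //; apply: hol_atV.
      apply: hol_atB; first exact: hol_at_cst.
      by apply: hol_atM => //; exact: hol_at_cst.
    by apply: rn_ge1_neq0; exact: mRe.
  by apply: hol_at_eq; apply: filterS np => y ny; rewrite /psi asboolF.
- move=> y Yy; have hy := sub_hull Yy.
  rewrite /psi asboolF => [|[ny gy]]; last first.
    have nZ := YnZ y Yy; have [_ + _] := near_out y hy ny nZ.
    by rewrite gy eqxx.
  rewrite rnM rnV; have h1 := mRe y eps eps0 hy.
  rewrite ler_pdivrMr; last exact: lt_le_trans h1.
  apply: le_trans (hB y Yy) _; rewrite -[X in X <= _]mulr1.
  by apply: ler_wpM2l => //; rewrite ltW.
Qed.

End Hull.

Section HullEq.
Context {R : realType}.
Local Notation C := R[i].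
Variable N : nat.
Implicit Types (z y p : 'rV[C]_N) (Y : set 'rV[C]_N).

(** The squared Euclidean norm, which comes from an inner product, unlike the maximum norm [rn] of
    rows. *)
Definition e2 z : R := \sum_j rn (z 0 j) ^+ 2.
(** The Hermitian product with p, holomorphic in z; [Re_lin] is polarization. *)
Definition lin p z : C := \sum_j z 0 j * conjc (p 0 j).

Lemma Re_lin p z : complex.Re (lin p z) = (e2 z + e2 p - e2 (z - p)) / 2.
Proof.
have H (r : seq 'I_N) : complex.Re (\sum_(j <- r) z 0 j * conjc (p 0 j)) =
   (\sum_(j <- r) rn (z 0 j) ^+ 2 + \sum_(j <- r) rn (p 0 j) ^+ 2 -
    \sum_(j <- r) rn ((z - p) 0 j) ^+ 2) / 2.
  elim: r => [|j r IH]; first by rewrite !big_nil /=; ring.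
  rewrite !big_cons cReD IH cReM coordB !rn_sqr cReB cImB.
  by case: (z 0 j) => ? ?; case: (p 0 j) => ? ? /=; field.
exact: H.
Qed.

Lemma lin_self p : lin p p = (e2 p)%:C.
Proof.
rewrite /lin /e2 rmorph_sum; apply: eq_bigr => j _; rewrite rn_sqr.
by case: (p 0 j) => x y; apply: eq_ReIm; rewrite ?cReM ?cImM /=; ring.
Qed.

Lemma rn_le_e2 z : rn z ^+ 2 <= e2 z.
Proof.
have e0 : 0 <= e2 z by apply: sumr_ge0 => j _; exact: sqr_ge0.
rewrite -[leRHS]sqr_sqrtr //; apply: lerXn2r; rewrite ?nnegrE ?rn_ge0 ?sqrtr_ge0 //.
apply: rn_le_coord => [|j]; first exact: sqrtr_ge0.
rewrite -[leLHS]ger0_norm ?rn_ge0 // -sqrtr_sqr; apply: ler_wsqrtr.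
rewrite /e2 (bigD1 j) //= lerDl; apply: sumr_ge0 => i _; exact: sqr_ge0.
Qed.

Lemma ctsR_rn {V : normedModType C} {X : topologicalType} (f : X -> V) x :
  {for x, continuous f} -> {for x, continuous (fun y : X => rn (f y))}.
Proof.
move=> /ctsP h; apply/ctsRP => e e0; apply: filterS (h e e0) => y.
apply: le_lt_trans; rewrite ler_norml.
have := ler_rn_sub (f y) (f x); have := ler_rn_sub (f x) (f y); rewrite rnB.
by move=> ? ?; apply/andP; split; lra.
Qed.

Lemma e2_cts z : {for z, continuous e2}.
Proof.
have H (r : seq 'I_N) : {for z, continuous (fun y => \sum_(j <- r) rn (y 0 j) ^+ 2)}.
  elim: r => [|j r IH].
    rewrite (_ : (fun _ => _) = fun=> 0); first by apply/ctsRP => e e0;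
      apply/nbhs_rnP; exists 1 => // y _; rewrite subrr normr0.
    by apply/funext => y; rewrite big_nil.
  rewrite (_ : (fun _ => _) = fun y => rn (y 0 j) * rn (y 0 j) +
     \sum_(i <- r) rn (y 0 i) ^+ 2); last by apply/funext => y; rewrite big_cons expr2.
  apply: continuousD => //.
  have cj : {for z, continuous (fun y => rn (y 0 j))}.
    apply: (@ctsR_rn C^o); exact/differentiable_continuous/differentiable_coordE.
  exact: continuousM.
exact: H.
Qed.

Lemma hol_at_lin p z : hol_at z (lin p).
Proof.
apply: hol_at_sum => j; apply: hol_atM; last exact: hol_at_cst.
by apply: hol_atW => y; exact: differentiable_coordE.
Qed.

Lemma ball_closed p (r : R) : closed [set z | rn (z - p) <= r].
Proof.
apply: closed_of_near => z /= /negP; rewrite -ltNge => h.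
apply/nbhs_rnP; exists (rn (z - p) - r); first by rewrite subr_gt0.
move=> y yz /= yp; have := ler_rn_sub (z - p) (z - y).
have -> : z - p - (z - y) = y - p by rewrite opprB addrC addrA subrK.
by rewrite (rnB z y) => k; have := lt_le_trans yz (lerB (lexx _) yp); lra.
Qed.

(* Let p be a point of largest Euclidean norm in the closure of hull \ Y. The
   powers of c / (e2 p + c / 4 - lin p z) peak at p, and multiplying them by some
   [u j], which vanishes on [Y] but not at a point of hull \ Y close to p,
   contradicts the local maximum principle. *)
Lemma hull_eq (a b : dir N -> R) Y : compact Y -> Y `<=` box a b ->
  (forall y, Y y -> exists (J : Type) (u : J -> 'rV[C]_N -> C) (r : R),
    [/\ 0 < r, forall j x, rn (x - y) < r -> differentiable (u j) x,
      forall j x, Y x -> rn (x - y) < r -> u j x = 0 &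
      forall x, hull a b Y x -> rn (x - y) < r -> (forall j, u j x = 0) -> Y x]) ->
  hull a b Y `<=` Y.
Proof.
move=> cY Yb loc z0 hz0; apply: contrapT => nY0.
have clY : closed Y by apply: compact_closed => //; exact: rV_haus.
have clH := @hull_closed R N a b Y.
pose E := hull a b Y `\` Y; pose K := closure E.
have EH : K `<=` hull a b Y.
  by rewrite ((closure_id _).1 clH); apply: closureS => x [].
have cK : compact K.
  by apply: subclosed_compact EH; [exact: closed_closure|exact: hull_compact].
have EK : E `<=` K by exact: subset_closure.
have [p Kp pmax] : exists2 p, K p & forall y, K y -> e2 y <= e2 p.
  apply: compact_has_max cK _ _; first by exists z0; apply: EK; split.
  by move=> x _; exact: e2_cts.
have [J [u [r [r0 du uY uE]]]] : exists (J : Type) (u : J -> 'rV[C]_N -> C) (r : R),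
    [/\ 0 < r, forall j x, rn (x - p) < r -> differentiable (u j) x,
      forall j x, Y x -> rn (x - p) < r -> u j x = 0 &
      forall x, hull a b Y x -> rn (x - p) < r -> (forall j, u j x = 0) -> Y x].
  have [Yp|nYp] := pselect (Y p); first exact: loc.
  have /nbhs_rnP[r r0 hr] := near_setC clY nYp.
  (* Around a point outside Y the constant 1 serves: the ball misses Y, so both conditions hold
     vacuously. *)
  exists unit, (fun _ _ => 1), r; split => //.
  - by move=> j x Yx /hr.
  - by move=> x _ _ /(_ tt)/eqP; rewrite oner_eq0.
(* On K, Re D is at least c at distance r / 2 or more from p, while D p = c / 4. So c / D has
   modulus at most 1 far from p and at least 2 at a point e of hull minus Y close to p. *)
pose c := r ^+ 2 / 8; have c0 : 0 < c by rewrite divr_gt0 // exprn_gt0.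
pose D x := (e2 p + c / 4)%:C - lin p x.
have ReD1 x : complex.Re (D x) = e2 p + c / 4 - (e2 x + e2 p - e2 (x - p)) / 2.
  by rewrite cReB Re_lin.
have e2ge x : 0 <= e2 x by apply: sumr_ge0 => j _; exact: sqr_ge0.
have ReD2 x : K x -> c / 4 <= complex.Re (D x).
  by move=> /pmax; rewrite ReD1; have := e2ge (x - p); lra.
have ReD3 x : K x -> r / 2 <= rn (x - p) -> c <= complex.Re (D x).
  move=> /pmax; rewrite ReD1 => h1 h2; have h3 := rn_le_e2 (x - p).
  have h4 : (r / 2) ^+ 2 <= rn (x - p) ^+ 2.
    by apply: lerXn2r; rewrite // nnegrE ?rn_ge0 // divr_ge0 // ltW.
  have h5 : (r / 2) ^+ 2 = 2 * c by rewrite /c; field.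
  by rewrite h5 in h4; clear -h1 h3 h4 c0; lra.
have hD x : hol_at x D by apply: hol_atB; [exact: hol_at_cst|exact: hol_at_lin].
have Re_rn x (t : R) : t <= complex.Re (D x) -> t <= rn (D x).
  by move=> h; apply: le_trans h _; apply: le_trans (ler_norm _) (ler_Re_rn _).
have D0 x : K x -> D x != 0.
  move=> /ReD2/Re_rn h; rewrite -rn_gt0; apply: lt_le_trans h.
  by rewrite divr_gt0.
have Dp : D p = (c / 4)%:C by rewrite /D lin_self -rmorphB addrC addKr.
have [e [[he nYe] [ep De]]] : exists e, E e /\ (rn (e - p) < r / 2 /\ rn (D e) <= c / 2).
  have c4 : 0 < c / 4 by rewrite divr_gt0.
  have n1 : \forall x \near p, rn (x - p) < r / 2.
    by apply/nbhs_rnP; exists (r / 2); rewrite ?divr_gt0.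
  have /ctsP/(_ _ c4) n2 := hol_at_cts (hD p).
  have [e [Ee [h1 h2]]] := Kp _ (filterI n1 n2).
  exists e; split => //; split => //; have := ler_rn_sub (D e) (D p).
  rewrite {1}Dp rnR gtr0_norm // => h3.
  by have := le_lt_trans h3 h2; lra.
have [j uj] : exists j, u j e != 0.
  apply: contrapT => h; apply: nYe; apply: uE => //; first by lra.
  by move=> j; apply/eqP; apply: contrapT => /negP hj; apply: h; exists j.
pose A := K `&` [set x | rn (x - p) <= r / 2].
pose Bd := A `&` (Y `|` [set x | r / 2 <= rn (x - p)]).
have cA : compact A by apply: compact_closedI => //; exact: ball_closed.
have Ar x : A x -> rn (x - p) < r by move=> [_ /= h]; lra.
have hu x : A x -> hol_at x (u j).
  move=> /Ar xr; apply/hol_atP; exists (r - rn (x - p)); first by rewrite subr_gt0.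
  move=> y yx; apply: du; have := ler_rnD (y - x) (x - p).
  by rewrite addrA subrK => h; apply: le_lt_trans h _; clear -yx; lra.
have [Bu Bu0 hBu] := compact_bnd cA (fun x Ax => hol_at_cts (hu x Ax)).
have Ke : K e by exact: (EK e (conj he nYe)).
have Ae : A e by split => //; rewrite /= ltW.
pose f x : C := c%:C / D x.
have hf x : K x -> hol_at x f.
  move=> Kx; apply: hol_atM; first exact: hol_at_cst.
  by apply: hol_atV => //; exact: D0.
have fe : 2 <= rn (f e).
  have De0 : 0 < rn (D e) by rewrite rn_gt0; exact: D0 Ke.
  have -> : rn (f e) = c / rn (D e) by rewrite /f rnM rnV rnR gtr0_norm.
  by rewrite ler_pdivlMr // mulrC -ler_pdivlMr.
(* On [Bd] the product vanishes (on Y) or is at most Bu (at distance r / 2), whatever k is; large k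
   then forces u j e = 0. *)
have key k : rn (u j e) * 2 ^+ k <= Bu.
  apply: (@le_trans _ _ (rn (u j e * f e ^+ k))).
    rewrite rnM rnX; apply: ler_wpM2l; first exact: rn_ge0.
    by apply: lerXn2r; rewrite ?nnegrE ?rn_ge0.
  apply: (@hull_lmp R N a b Y Yb A Bd (fun x => u j x * f x ^+ k) Bu
    cY cA _ _ _ _ (ltW Bu0) _ e Ae).
  - by move=> x [Kx _]; exact: EH.
  - move=> x [Kx xr] nB.
    have nY : ~ Y x by move=> Yx; apply: nB; split => //; left.
    have nr : rn (x - p) < r / 2.
      by rewrite ltNge; apply/negP => h; apply: nB; split => //; right.
    have n1 : \forall y \near x, rn (y - p) < r / 2.
      apply/nbhs_rnP; exists (r / 2 - rn (x - p)); first by rewrite subr_gt0.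
      move=> y yx; have := ler_rnD (y - x) (x - p).
      by rewrite addrA subrK => h; apply: le_lt_trans h _; clear -yx; lra.
    apply: filterS2 n1 (near_setC clY nY) => y h1 h2 hy.
    by split; [apply: EK|exact: ltW].
  - by move=> x Ax Yx; split => //; left.
  - by move=> x Ax; apply: hol_atM; [exact: hu|apply: hol_atX; apply: hf; case: Ax].
  - move=> x [Ax [Yx|/= xr]].
      by rewrite uY ?mul0r ?rn0 ?ltW //; exact: Ar.
    rewrite rnM rnX -[leRHS]mulr1; apply: ler_pM; rewrite ?exprn_ge0 ?rn_ge0 //.
      exact: hBu.
    apply: exprn_ile1; first exact: rn_ge0.
    have [Kx _] := Ax; have h := Re_rn x c (ReD3 x Kx xr).
    rewrite /f rnM rnV rnR gtr0_norm // ler_pdivrMr ?mul1r //.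
    exact: lt_le_trans h.
have ue0 : 0 < rn (u j e) by rewrite rn_gt0.
have [k hk] := @pow_half_small R Bu (rn (u j e) / 2) ltac:(by rewrite divr_gt0).
have := key k; rewrite -ler_pdivlMr ?exprn_gt0 // -exprVn => h.
have h2 := le_trans h hk; clear -h2 ue0; lra.
Qed.

End HullEq.

(** * Complex exponential and logarithm *)

Section CExp.
Context {R : realType}.
Local Notation C := R[i].

Definition cexp (z : C) : C :=
  (expR (complex.Re z) * cos (complex.Im z)) +i* (expR (complex.Re z) * sin (complex.Im z)).

Lemma cexpD (z w : C) : cexp (z + w) = cexp z * cexp w.
Proof.
apply: eq_ReIm; rewrite ?cReM ?cImM /cexp /= cReD cImD expRD ?cosD ?sinD; ring.
Qed.

Lemma cexp0 : cexp 0 = 1.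
Proof. by apply: eq_ReIm; rewrite /= expR0 ?cos0 ?sin0 ?mulr1 ?mulr0. Qed.

Lemma cexp_neq0 (z : C) : cexp z != 0.
Proof.
apply: contra_eq_neq (cexpD z (- z)) => ->.
by rewrite subrr mul0r cexp0 oner_eq0.
Qed.

Lemma cexpN (z : C) : cexp (- z) = (cexp z)^-1.
Proof.
apply: (mulfI (cexp_neq0 z)); rewrite -cexpD subrr cexp0 divff //.
exact: cexp_neq0.
Qed.

Lemma cexp_eps (e : R) : 0 < e -> exists2 d : R, 0 < d & forall k : C, rn k < d ->
  rn (cexp k - 1 - k) <= e * rn k.
Proof.
move=> e0; pose e' := Num.min 1 (e / 8).
have e'0 : 0 < e' by rewrite lt_min ltr01 divr_gt0.
have [e'1 e'e] : e' <= 1 /\ e' <= e / 8.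
  by split; rewrite ge_min lexx ?orbT.
have [d1 d10 h1] := (is_derive_epsP _ _ _).1 (is_derive_expR (0 : R)) e' e'0.
have [d2 d20 h2] := (is_derive_epsP _ _ _).1 (is_derive_cos (0 : R)) e' e'0.
have [d3 d30 h3] := (is_derive_epsP _ _ _).1 (is_derive_sin (0 : R)) e' e'0.
exists (Num.min (Num.min d1 d2) (Num.min d3 (e' / 2))).
  by rewrite !lt_min d10 d20 d30 divr_gt0.
move=> k; rewrite !lt_min => /andP[/andP[k1 k2] /andP[k3 k4]].
have := ler_Re_rn k; have := ler_Im_rn k.
case: k k1 k2 k3 k4 => x y /=; set t := rn _ => k1 k2 k3 k4 yt xt.
have := h1 x (le_lt_trans xt k1); have := h2 y (le_lt_trans yt k2).
have := h3 y (le_lt_trans yt k3).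
rewrite !add0r expR0 cos0 sin0 oppr0 mulr0 !mulr1 !(subr0, addr0) => s1 c1 x1.
apply: le_trans (rn_le_ReIm _) _; rewrite !(cReB, cImB) /= subr0.
have t0 : 0 <= t by exact: rn_ge0.
have a0 := normr_ge0 x; have b0 := normr_ge0 y.
have E1 : expR x <= 2.
  have := ler_norm (expR x - 1 - x); have := ler_norm x.
  have : e' * `|x| <= `|x| by rewrite -[leRHS]mul1r ler_wpM2r.
  by clear -x1 xt k4 e'1; lra.
have E0 : 0 <= expR x := expR_ge0 x.
have R1 : `|expR x * cos y - 1 - x| <= 3 * e' * t.
  have -> : expR x * cos y - 1 - x = (expR x - 1 - x) + expR x * (cos y - 1) by ring.
  apply: le_trans (ler_normD _ _) _; rewrite normrM (ger0_norm E0).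
  have q1 : e' * `|x| <= e' * t by apply: ler_wpM2l => //; rewrite ltW.
  have q2 : e' * `|y| <= e' * t by apply: ler_wpM2l => //; rewrite ltW.
  have q3 : expR x * `|cos y - 1| <= 2 * (e' * t).
    by apply: ler_pM => //; exact: le_trans c1 q2.
  by clear -x1 q1 q3; lra.
have R2 : `|expR x * sin y - y| <= 4 * e' * t.
  have -> : expR x * sin y - y = (expR x - 1) * y + expR x * (sin y - y) by ring.
  apply: le_trans (ler_normD _ _) _; rewrite !normrM (ger0_norm E0).
  have q2 : e' * `|y| <= e' * t by apply: ler_wpM2l => //; rewrite ltW.
  have q3 : expR x * `|sin y - y| <= 2 * (e' * t).
    by apply: ler_pM => //; exact: le_trans s1 q2.
  have q4 : `|expR x - 1| <= e'.
    have -> : expR x - 1 = (expR x - 1 - x) + x by ring.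
    apply: le_trans (ler_normD _ _) _.
    have : e' * `|x| <= `|x| by rewrite -[leRHS]mul1r ler_wpM2r.
    by clear -x1 xt k4; lra.
  have q5 : `|expR x - 1| * `|y| <= e' * t by exact: ler_pM.
  have q6 : 0 <= e' * t by rewrite mulr_ge0 // ltW.
  by clear -q3 q5 q6; lra.
have q7 : 8 * (e' * t) <= e * t by rewrite mulrA ler_wpM2r //; clear -e'e; lra.
have q6 : 0 <= e' * t by rewrite mulr_ge0 // ltW.
by clear -R1 R2 q6 q7; lra.
Qed.

Lemma cexp_cts z : {for z, continuous cexp}.
Proof.
have c0 : forall e : R, 0 < e -> exists2 d : R, 0 < d & forall k, rn k < d ->
    rn (cexp k - 1) < e.
  move=> e e0; have [d d0 hd] := cexp_eps ltr01.
  exists (Num.min d (e / 2)); first by rewrite lt_min d0 divr_gt0.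
  move=> k; rewrite lt_min => /andP[/hd h1 h2].
  have := ler_rnD (cexp k - 1 - k) k; rewrite subrK mul1r in h1 *.
  by clear -h1 h2; lra.
apply/ctsP => e e0; have p0 : 0 < rn (cexp z) by rewrite rn_gt0 cexp_neq0.
have [|d d0 hd] := c0 (e / rn (cexp z)); first by rewrite divr_gt0.
apply/nbhs_rnP; exists d => // y /hd; rewrite ltr_pdivlMr // -rnM mulrBl mul1r.
by rewrite -cexpD subrK.
Qed.

(** With q = H (y + k) - H y, continuity makes q small, so q and T = exp q - 1 = g (y + k) / g y - 1
    agree to first order; and T is linear in k to first order. *)
Lemma differentiable_log N (H : 'rV[C]_N -> C) y : {for y, continuous H} ->
  differentiable (fun x => cexp (H x)) y -> differentiable H y.
Proof.
move=> cH; pose g (x : 'rV[C]_N) : C := cexp (H x).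
move=> dg; have {}dg : differentiable g y := dg.
have gy0 : g y != 0 by exact: cexp_neq0.
have gy1 : 0 < rn (g y) by rewrite rn_gt0.
pose a j := 'd g y (dirv j) / g y.
have aE (k : 'rV[C]_N) : \sum_j k 0 j *: a j = 'd g y k / g y.
  by rewrite diff_sum mulr_suml; apply: eq_bigr => j _; rewrite -mulrA.
pose S := \sum_j rn (a j); have S0 : 0 <= S by apply: sumr_ge0 => j _; exact: rn_ge0.
suff [] : differentiable H y /\ forall k, 'd H y k = \sum_j k 0 j *: a j by [].
apply: diff_intro_eps => e e0.
(* [e1] measures T against its linear part. The bound 1 / 2 on [e2] gives |q| <= 2 |T|, and the
   other one turns this into |T - q| <= e / 2 |k|. *)
pose e1 := Num.min 1 (e / 2); pose e2 := Num.min (1 / 2) (e / (4 * (S + 1))).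
have S1 : 0 < S + 1 by rewrite ltr_wpDl.
have e10 : 0 < e1 by rewrite lt_min ltr01 divr_gt0.
have e20 : 0 < e2 by rewrite lt_min !divr_gt0 // mulr_gt0.
have [d2 d20 h2] := cexp_eps e20.
have eg0 : 0 < e1 * rn (g y) by rewrite mulr_gt0.
have [d1 d10 h1] := diffE_eps dg eg0.
have /ctsP/(_ _ d20)/nbhs_rnP[d3 d30 h3] := cH.
exists (Num.min d1 d3); first by rewrite lt_min d10.
move=> k; rewrite lt_min => /andP[kd1 kd3]; rewrite aE.
have := h3 (y + k); rewrite addrAC subrr add0r => /(_ kd3).
set q := H (y + k) - H y => qd; have := h2 q qd.
have -> : cexp q = g (y + k) / g y by rewrite /q cexpD cexpN.
set T := _ / g y - 1 => qT.
have TL : rn (T - 'd g y k / g y) <= e1 * rn k.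
  have -> : T - 'd g y k / g y = (g (y + k) - g y - 'd g y k) / g y.
    by rewrite /T -[X in _ - X - _](divff gy0) -!mulrBl.
  rewrite rnM rnV ler_pdivrMr // mulrAC; exact: h1.
have Lk : rn ('d g y k / g y) <= S * rn k.
  have -> : 'd g y k / g y = \sum_j k 0 j * a j by rewrite -aE.
  apply: le_trans (@ler_rn_sum R C 'I_N (index_enum _) predT (fun j => k 0 j * a j)) _.
  rewrite mulr_suml.
  apply: ler_sum => j _; rewrite rnM mulrC; apply: ler_wpM2l; first exact: rn_ge0.
  exact: rn_coord.
have k0 := rn_ge0 k.
have Tk : rn T <= (S + 1) * rn k.
  have := ler_rnD (T - 'd g y k / g y) ('d g y k / g y); rewrite subrK.
  have : e1 * rn k <= 1 * rn k by apply: ler_wpM2r => //; rewrite ge_min lexx.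
  by clear -TL Lk; lra.
have e2h : e2 <= 1 / 2 by rewrite ge_min lexx.
have q2T : rn q <= 2 * rn T.
  have := ler_rn_sub q (q - T); rewrite subKr (rnB q).
  have : e2 * rn q <= 1 / 2 * rn q by apply: ler_wpM2r => //; exact: rn_ge0.
  by clear -qT; lra.
have qT2 : rn (T - q) <= e / 2 * rn k.
  apply: le_trans qT _; apply: (@le_trans _ _ (e2 * (2 * ((S + 1) * rn k)))).
    by apply: ler_wpM2l; [exact: ltW|apply: le_trans q2T _; rewrite ler_pM2l].
  have : e2 <= e / (4 * (S + 1)) by rewrite ge_min lexx orbT.
  rewrite ler_pdivlMr ?mulr_gt0 // => h.
  have : e2 * (4 * (S + 1)) * rn k <= e * rn k by exact: ler_wpM2r.
  by set w := (S + 1); clear; lra.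
have e1h : e1 * rn k <= e / 2 * rn k by apply: ler_wpM2r => //; rewrite ge_min lexx orbT.
have := ler_rnD (q - T) (T - 'd g y k / g y); rewrite addrA subrK (rnB q T).
by clear -qT2 TL e1h; lra.
Qed.

Lemma hol_at_log N (H : 'rV[C]_N -> C) z : (\forall y \near z, {for y, continuous H}) ->
  hol_at z (fun x => cexp (H x)) -> hol_at z H.
Proof. by apply: filterS2 => y; exact: differentiable_log. Qed.

(** The principal branch on the right half-plane, the only region where it is used. *)
Definition clog (w : C) : C := ln (rn w) +i* atan (complex.Im w / complex.Re w).

Lemma clog1 : clog 1 = 0.
Proof. by rewrite /clog rn1 ln1 /= mul0r atan0. Qed.

Lemma clogK w : 0 < complex.Re w -> cexp (clog w) = w.
Proof.
move=> w0; have r0 : 0 < rn w.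
  by apply: lt_le_trans w0 _; apply: le_trans (ler_norm _) (ler_Re_rn _).
rewrite /cexp /clog /= lnK ?posrE //.
set t := _ / _; have ct : cos (atan t) = complex.Re w / rn w.
  rewrite cos_atan; have -> : 1 + t ^+ 2 = (rn w / complex.Re w) ^+ 2.
    rewrite /t !expr_div_n rn_sqr; field; exact: lt0r_neq0.
  by rewrite sqrtr_sqr ger0_norm ?invf_div // divr_ge0 // ltW.
have st : sin (atan t) = complex.Im w / rn w.
  have := atanK t; rewrite /tan => E.
  have c0 : cos (atan t) != 0 by rewrite ct mulf_neq0 ?invr_eq0 // lt0r_neq0.
  rewrite -[LHS](divfK c0) E ct /t; field; rewrite !lt0r_neq0 //.
by rewrite ct st; apply: eq_ReIm => /=; rewrite mulrC divfK // lt0r_neq0.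
Qed.

Lemma clog_cts w : 0 < complex.Re w -> {for w, continuous clog}.
Proof.
move=> w0; have r0 : 0 < rn w.
  by apply: lt_le_trans w0 _; apply: le_trans (ler_norm _) (ler_Re_rn _).
have cRe : {for w, continuous (@complex.Re R : C -> R)}.
  apply/ctsRP => e e0; apply/nbhs_rnP; exists e => // y; apply: le_lt_trans.
  by rewrite -cReB; exact: ler_Re_rn.
have cIm : {for w, continuous (@complex.Im R : C -> R)}.
  apply/ctsRP => e e0; apply/nbhs_rnP; exists e => // y; apply: le_lt_trans.
  by rewrite -cImB; exact: ler_Im_rn.
apply: (continuous_comp (f := fun w : C => (ln (rn w), atan (complex.Im w / complex.Re w)))
  (g := fun p : R * R => p.1 +i* p.2 : C)); last exact: mkC_cts.
have c1 : {for w, continuous (fun w : C => ln (rn w))}.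
  apply: (continuous_comp (f := fun w : C => rn w) (g := @ln R)); last exact: continuous_ln.
  by apply: (@ctsR_rn R C^o); exact: differentiable_continuous (differentiable_idfun _).
have c2 : {for w, continuous (fun w : C => atan (complex.Im w / complex.Re w))}.
  apply: (continuous_comp (f := fun w : C => complex.Im w / complex.Re w) (g := @atan R));
    last exact: continuous_atan.
  by apply: continuousM => //; apply: continuousV => //; exact: lt0r_neq0.
exact: cvg_pair c1 c2.
Qed.

End CExp.

(** * Extension of continuous functions *)

Section Tietze.
Context {R : realType}.
Local Notation C := R[i].
Variable N : nat.

Lemma rV_normal : normal_space 'rV[C]_N.
Proof.
apply/(@normal_openP R) => A B cA cB AB.
pose U (A B : set 'rV[C]_N) := [set x | exists a (e : R), [/\ A a,
  forall y, rn (y - a) < e + e -> ~ B y & rn (x - a) < e]].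
have oU A' B' : open (U A' B').
  rewrite openE => x [a [e [Aa h xa]]].
  suff k : \forall y \near x, U A' B' y by exact: k.
  apply/nbhs_rnP; exists (e - rn (x - a)).
    by rewrite subr_gt0.
  move=> y yx; exists a, e; split => //; have := ler_rnD (y - x) (x - a).
  by rewrite addrA subrK => k; apply: le_lt_trans k _; clear -yx; lra.
have sU (A' B' : set 'rV[C]_N) : closed B' -> A' `&` B' = set0 -> A' `<=` U A' B'.
  move=> cB' E a Aa; have nB : ~ B' a by move=> Ba; have : (A' `&` B') a by []; rewrite E.
  have /nbhs_rnP[e e0 he] := near_setC cB' nB.
  exists a, (e / 2); split => //; first by rewrite -splitr.
  by rewrite subrr rn0 divr_gt0.
exists (U A B), (U B A); split => //; [exact: sU|by apply: sU; rewrite // setIC|].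
apply/seteqP; split => // x [[a [e [Aa h xa]]] [b [d [Bb k xb]]]].
have := ler_rnD (a - x) (x - b); rewrite addrA subrK (rnB a x) => ab.
have [ed|de] := leP e d.
  by apply: (k a) => //; apply: le_lt_trans ab _; clear -ed xa xb; lra.
apply: (h b) => //; rewrite rnB; apply: le_lt_trans ab _; clear -de xa xb; lra.
Qed.

Section compactemb.
Context {X : topologicalType} (L : set X) (F : X -> 'rV[C]_N).
Hypotheses (cL : compact L) (cF : forall x, L x -> {for x, continuous F}).

Lemma image_compact : compact (F @` L).
Proof.
apply: continuous_compact => //; apply: continuous_in_subspaceT => x.
by rewrite inE; exact: cF.
Qed.

Lemma image_closed : closed (F @` L).
Proof. by apply: compact_closed; [exact: rV_haus|exact: image_compact]. Qed.

Hypothesis injF : forall x y, L x -> L y -> F x = F y -> x = y.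

(** A continuous injection on a compact set is a homeomorphism onto its image: points of L other
    than x have images at positive distance from F x. *)
Lemma inj_nbhd x V : L x -> nbhs x V ->
  exists2 r : R, 0 < r & forall y, L y -> rn (F y - F x) < r -> V y.
Proof.
move=> Lx xV.
have [||r r0 hr] := @compact_unif R _ L (fun y d => rn (F y - F x) < d -> V y) cL.
- by move=> y d d' h /andP[_ dd] yd; apply: h; exact: lt_le_trans dd.
- move=> y Ly; have [->|yx] := pselect (y = x).
    by exists 1 => //; apply: filterS xV => y' Vy _ _.
  have d0 : 0 < rn (F y - F x) / 2.
    rewrite divr_gt0 // rn_gt0 subr_eq0; apply/eqP => E; apply: yx; exact: injF.
  exists (rn (F y - F x) / 2) => //.
  have /ctsP/(_ _ d0) := cF Ly; apply: filterS => y' h _ h'; exfalso.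
  have := ler_rnD (F y - F y') (F y' - F x); rewrite addrA subrK (rnB (F y) (F y')) => k.
  by move: k; rewrite leNgt (splitr (rn (F y - F x))) ltrD.
by exists r.
Qed.

(** The function is transported to the closed set F(L) by the inverse of F, continuous by
    [inj_nbhd], and extended from there; compactness supplies the bound that the extension theorem
    asks for. *)
Lemma tietzeR (r : X -> R) : (forall x, L x -> {for x, continuous r}) ->
  exists2 g : 'rV[C]_N -> R, continuous g & forall x, L x -> g (F x) = r x.
Proof.
move=> cr.
have [[x0 Lx0]|L0] := pselect (exists x, L x); last first.
  by exists (fun=> 0) => [z|x Lx]; [apply/ctsRP => e e0; apply/nbhs_rnP;
    exists 1 => // y _; rewrite subrr normr0|exfalso; apply: L0; exists x].
have [d d0 hd] : exists2 d : R, 0 < d & forall x, L x -> `|r x| <= d^-1.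
  apply: compact_unif cL _ _.
    move=> x e e' h /andP[e'0 ee]; apply: le_trans h _.
    by rewrite lef_pV2 ?posrE // (lt_le_trans e'0).
  move=> x Lx; exists (`|r x| + 1)^-1; first by rewrite invr_gt0 ltr_wpDl.
  have /ctsRP/(_ _ ltr01) := cr x Lx; apply: filterS => y h _; rewrite invrK.
  have := ler_normD (r y - r x) (r x); rewrite subrK addrC => k.
  by apply: le_trans k _; rewrite lerD2l ltW.
have [i hi] : exists i : 'rV[C]_N -> X, forall x, L x -> i (F x) = x.
  have H z : exists x, (exists2 y, L y & F y = z) -> L x /\ F x = z.
    have [[y Ly yz]|n] := pselect (exists2 y, L y & F y = z); first by exists y.
    by exists x0 => /n.
  have [i hi] := choice H; exists i => x Lx.
  have [|l1 l2] := hi (F x); first by exists x.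
  exact: injF.
have [|||g [g1 g2 _]] := @continuous_bounded_extension _ _ rV_normal (F @` L) image_closed
    (r \o i) (d^-1) _ _ _.
- by rewrite invr_gt0.
- apply/subspace_continuousP => _ [x Lx <-]; apply/cvgrPdist_lt => e e0.
  have /ctsRP/(_ _ e0) h := cr x Lx.
  have [q q0 hq] := inj_nbhd Lx h.
  have k : \forall z \near F x, (F @` L) z -> `|r (i (F x)) - r (i z)| < e.
    apply/nbhs_rnP; exists q => // z zq [y Ly E]; rewrite -E in zq *.
    by rewrite !hi // distrC; exact: hq.
  exact: k.
- by move=> _ [x Lx <-] /=; rewrite hi // hd.
exists g => // x Lx; rewrite -g1 /= ?hi // inE; by exists x.
Qed.

Lemma tietzeC (h : X -> C) : (forall x, L x -> {for x, continuous h}) ->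
  exists2 H : 'rV[C]_N -> C, continuous H & forall x, L x -> H (F x) = h x.
Proof.
move=> ch.
have cRe x : L x -> {for x, continuous (fun y => complex.Re (h y))}.
  move=> /ch/ctsP k; apply/ctsRP => e e0; apply: filterS (k e e0) => y.
  by apply: le_lt_trans; rewrite -cReB; exact: ler_Re_rn.
have cIm x : L x -> {for x, continuous (fun y => complex.Im (h y))}.
  move=> /ch/ctsP k; apply/ctsRP => e e0; apply: filterS (k e e0) => y.
  by apply: le_lt_trans; rewrite -cImB; exact: ler_Im_rn.
have [g1 c1 E1] := tietzeR cRe; have [g2 c2 E2] := tietzeR cIm.
exists (fun z => g1 z +i* g2 z).
  move=> z; apply: (continuous_comp (f := fun z => (g1 z, g2 z))
    (g := fun p : R * R => p.1 +i* p.2 : C)); last exact: mkC_cts.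
  exact: cvg_pair (c1 z) (c2 z).
by move=> x Lx; rewrite E1 // E2 //; case: (h x).
Qed.

End compactemb.
End Tietze.

(** * Stein manifolds *)

Section Resel.
Context {R : realType}.
Local Notation C := R[i].

Definition resel (a b : nat) (s : 'I_a -> 'I_b) (w : 'rV[C]_b) : 'rV[C]_a :=
  \row_i w 0 (s i).

Lemma differentiable_row (V : normedModType C) (a : nat) (F : V -> 'rV[C]_a) z :
  (forall i, differentiable (fun y => F y 0 i : C) z) -> differentiable F z.
Proof.
move=> dF; have := @differentiable_sum _ _ _ a
  (fun i y => F y 0 i *: (dirv i : 'rV[C]_a)) z.
rewrite (_ : \sum_i _ = F); first by apply => i; exact: differentiableZl.
by apply/funext => y; rewrite fct_sumE -row_sum_dirv.
Qed.

Lemma differentiable_resel a b (s : 'I_a -> 'I_b) w : differentiable (resel s) w.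
Proof.
apply: differentiable_row => i.
rewrite (_ : (fun _ => _) = fun y : 'rV[C]_b => y 0 (s i)).
  exact: differentiable_coordE.
by apply/funext => y; rewrite mxE.
Qed.

Lemma resel_cts a b (s : 'I_a -> 'I_b) w : {for w, continuous (resel s)}.
Proof. exact/differentiable_continuous/differentiable_resel. Qed.

End Resel.

Section Manifold.
Context {R : realType} {n : nat} {X : complexManifold R n}.
Local Notation C := R[i].
Implicit Types (f : X -> C) (fs gs ps : seq (X -> C)) (c : chart R X n).

Lemma chart_cts c x : chart_dom c x -> {for x, continuous c}.
Proof.
have := @chart_fun_continuous _ _ _ c.
rewrite continuous_open_subspace; last exact: chart_dom_open.
by move=> h cx; apply: h; rewrite inE.
Qed.

Lemma chart_inv_cts c z : chart_cod c z -> {for z, continuous (chart_inv c)}.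
Proof.
have := @chart_inv_continuous _ _ _ c.
rewrite continuous_open_subspace; last exact: chart_cod_open.
by move=> h cx; apply: h; rewrite inE.
Qed.

Lemma near_dom c x : chart_dom c x -> \forall y \near x, chart_dom c y.
Proof. by move=> cx; apply: open_nbhs_nbhs; split => //; exact: chart_dom_open. Qed.

Lemma near_cod c z : chart_cod c z -> \forall y \near z, chart_cod c y.
Proof. by move=> cx; apply: open_nbhs_nbhs; split => //; exact: chart_cod_open. Qed.

Lemma holomorphic_cts f x : holomorphic f -> {for x, continuous f}.
Proof.
move=> hf; have [c ac cx] := atlas_cover x.
have d := hf c ac (c x) (chart_funS cx).
have /ctsP k := differentiable_continuous d.
apply/ctsP => e /k h; have h' := chart_cts cx h.
apply: filterS2 (near_dom cx) h' => y cy.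
by rewrite /= !chart_funK.
Qed.

(** Stated for charts that may lie outside the atlas, as those of [local_coordinates] do. *)
Lemma hol_chart c f z : (forall c', atlas c' -> compatible c c') -> holomorphic f ->
  chart_cod c z -> differentiable (f \o chart_inv c) z.
Proof.
move=> cc hf cz; have [c' ac cx] := atlas_cover (chart_inv c z).
have [t _] := cc c' ac.
have dt : differentiable (c' \o chart_inv c) z.
  apply: t; exists (chart_inv c z); last exact: chart_invK.
  by split => //; exact: chart_invS.
have df : differentiable (f \o chart_inv c') ((c' \o chart_inv c) z).
  by apply: hf => //; exact: chart_funS.
have := differentiable_comp dt df; apply: near_eq_differentiable.
have h : \forall y \near z, chart_dom c' (chart_inv c y) := chart_inv_cts cz (near_dom cx).
by apply: filterS h => y cy /=; rewrite chart_funK.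
Qed.

Fixpoint mems f fs : Prop := if fs is g :: gs then g = f \/ mems f gs else False.

Lemma mems_cat f fs gs : mems f (fs ++ gs) <-> mems f fs \/ mems f gs.
Proof. by elim: fs => [|g fs IH] /=; [split; [right|case]|rewrite IH; tauto]. Qed.

Lemma mems_nth fs i : (i < size fs)%N -> mems (nth (fun=> 0) fs i) fs.
Proof. by elim: fs i => [|g fs IH] [|i] //= h; [left|right; exact: IH]. Qed.

Lemma memsP f fs : mems f fs -> exists i : 'I_(size fs), nth (fun=> 0) fs i = f.
Proof.
elim: fs => [|g fs IH] //= [->|/IH[i E]]; first by exists ord0.
by exists (lift ord0 i).
Qed.

Definition allhol fs := forall f, mems f fs -> holomorphic f.

Lemma allhol_cat fs gs : allhol fs -> allhol gs -> allhol (fs ++ gs).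
Proof. by move=> h k f /mems_cat[/h|/k]. Qed.

Definition tup fs (x : X) : 'rV[C]_(size fs) := \row_i nth (fun=> 0) fs i x.

Lemma tup_mems f fs : mems f fs -> exists i, forall x, tup fs x 0 i = f x.
Proof. by move=> /memsP[i <-]; exists i => x; rewrite mxE. Qed.

Lemma tup_inj fs x y : tup fs x = tup fs y -> forall f, mems f fs -> f x = f y.
Proof. by move=> E f /tup_mems[i h]; rewrite -!h E. Qed.

Lemma tup_cts fs x : allhol fs -> {for x, continuous (tup fs)}.
Proof.
move=> hfs; apply/ctsP => e e0; have e2 : 0 < e / 2 by rewrite divr_gt0.
have H (i : 'I_(size fs)) : \forall y \near x,
    rn (nth (fun=> 0) fs i y - nth (fun=> 0) fs i x) < e / 2.
  have /(holomorphic_cts (x := x))/ctsP/(_ _ e2) : holomorphic (nth (fun=> 0) fs i).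
    by apply: hfs; exact: mems_nth.
  exact.
apply: filterS (filter_forall _ H) => y hy.
apply: (@le_lt_trans _ _ (e / 2)); last by rewrite ltr_pdivrMr // ltr_pMr // ltr1n.
apply: rn_le_coord => [|i]; first exact: ltW.
by rewrite coordB !mxE ltW.
Qed.

Lemma tup_chart c fs z : (forall c', atlas c' -> compatible c c') -> allhol fs ->
  chart_cod c z -> differentiable (fun y => tup fs (chart_inv c y)) z.
Proof.
move=> cc hfs cz; apply: differentiable_row => i.
rewrite (_ : (fun _ => _) = nth (fun=> 0) fs i \o chart_inv c).
  by apply: hol_chart => //; apply: hfs; exact: mems_nth.
by apply/funext => y; rewrite mxE.
Qed.

(** Passing to a longer list of functions amounts to a linear map between the ambient spaces; thus
    several representations can be brought into one C^N. *)
Lemma tup_resel fs gs : (forall f, mems f fs -> mems f gs) ->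
  exists s, forall x, tup fs x = resel s (tup gs x).
Proof.
move=> sub.
have H (i : 'I_(size fs)) : exists j : 'I_(size gs), nth (fun=> 0) gs j = nth (fun=> 0) fs i.
  by apply: memsP; apply: sub; exact: mems_nth.
have [s hs] := choice H; exists s => x.
by apply/rowP => i; rewrite !mxE hs.
Qed.

Definition repF (K : set X) fs (h : X -> C) (G : 'rV[C]_(size fs) -> C) :=
  (forall x, K x -> hol_at (tup fs x) G) /\
  (forall x, K x -> \forall y \near x, h y = G (tup fs y)).

(* Near K, h is the pullback of a function holomorphic near the image of K under
   some tuple of global holomorphic functions. *)
Definition rep (K : set X) (h : X -> C) := exists fs G, allhol fs /\ @repF K fs h G.

Lemma repF_incl K fs gs h G : (forall f, mems f fs -> mems f gs) ->
  @repF K fs h G -> exists G', @repF K gs h G'.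
Proof.
move=> /tup_resel[s hs] [h1 h2]; exists (fun w => G (resel s w)); split.
  move=> x Kx; apply: hol_at_compW; first exact: differentiable_resel.
  by rewrite -hs; exact: h1.
by move=> x /h2; apply: filterS => y ->; rewrite hs.
Qed.

Lemma rep_chart K h c x : (forall c', atlas c' -> compatible c c') -> rep K h ->
  chart_dom c x -> K x -> hol_at (c x) (h \o chart_inv c).
Proof.
move=> cc [fs [G [hfs [h1 h2]]]] cx Kx; have cz := chart_funS cx.
have : hol_at (c x) (fun z => G (tup fs (chart_inv c z))).
  apply: (hol_at_comp (F := fun z => tup fs (chart_inv c z))).
    by apply: filterS (near_cod cz) => z; exact: tup_chart.
  by rewrite chart_funK //; exact: h1.
apply: hol_at_eq; have := h2 x Kx; rewrite -{1}(chart_funK cx) => k.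
have k' : \forall z \near c x, h (chart_inv c z) = G (tup fs (chart_inv c z)) :=
  chart_inv_cts cz k.
by apply: filterS k' => z /= ->.
Qed.

Definition sep fs (L : set X) :=
  forall x y, L x -> L y -> (forall f, mems f fs -> f x = f y) -> x = y.

Definition coords fs (K : set X) := forall x, K x ->
  exists2 g : 'I_n -> X -> C, forall k, mems (g k) fs & local_coordinates g x.

(* An analytic polyhedron K relatively compact in the interior of L, for functions
   among fs, which separate the points of L and give coordinates on K. *)
Definition good (K : set X) fs := [/\ allhol fs, coords fs K & exists L ps,
  [/\ compact L, K `<=` interior L, sep fs L, forall p, mems p ps -> mems p fs &
    K = [set x | L x /\ forall p, mems p ps -> rn (p x) <= 1]]].

Lemma good_incl K fs gs : allhol gs -> (forall f, mems f fs -> mems f gs) ->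
  good K fs -> good K gs.
Proof.
move=> hg sub [_ co [L [ps [h1 h2 h3 h4 h5]]]]; split => //.
  by move=> x /co[g h k]; exists g => // i; exact: sub.
exists L, ps; split => //; last by move=> p /h4/sub.
by move=> x y Lx Ly E; apply: h3 => // f /sub/E.
Qed.

Lemma good_compact K fs : good K fs -> compact K.
Proof.
move=> [hf _ [L [ps [cL _ _ sub ->]]]].
apply: (@subclosed_compact _ _ L) => // [|x []//].
have Xh := @manifold_hausdorff _ _ X.
have clL : closed L by exact: compact_closed.
rewrite (_ : [set _ | _] = L `&` [set x | forall p, mems p ps -> rn (p x) <= 1]) //.
apply: closedI => //.
rewrite (_ : [set _ | _] = \bigcap_(p in [set p | mems p ps])
  (fun x => rn (p x)) @^-1` [set t | t <= 1]) //.
apply: closed_bigI => p /= /sub/hf hp; apply: preimage_closed; last exact: closed_le.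
by move=> x _; apply: (@ctsR_rn R C); exact: holomorphic_cts.
Qed.

(** Near the image of x, n of the coordinates of C^N form a chart c, and T recomputes all
    coordinates from these n. The image of K satisfies w = T w there; conversely a hull point with w
    = T w is the image of a point of L, and the inequalities defining K pass to it. *)
Lemma good_hull K fs a b : good K fs -> tup fs @` K `<=` box a b ->
  hull a b (tup fs @` K) `<=` tup fs @` K.
Proof.
move=> gK Yb; have cK := good_compact gK.
have [hf co [L [ps [cL KL inj sub KE]]]] := gK.
have KsL : K `<=` L by move=> x /KL/interior_subset.
have injK x y : K x -> K y -> tup fs x = tup fs y -> x = y.
  move=> Kx Ky E; apply: inj; [exact: KsL|exact: KsL|exact: tup_inj].
apply: hull_eq => //.
  apply: continuous_compact => //; apply: continuous_in_subspaceT => x _.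
  exact: tup_cts.
move=> _ [x Kx <-]; have [g gfs [c [cx cc cE]]] := co x Kx.
have [s hs] := choice (fun k => tup_mems (gfs k)).
have PE y : chart_dom c y -> resel s (tup fs y) = c y.
  by move=> cy; rewrite cE //; apply/rowP => j; rewrite !mxE -hs mxE.
pose T w := tup fs (chart_inv c (resel s w)).
exists 'I_(size fs), (fun i (w : 'rV[C]_(size fs)) => w 0 i - T w 0 i).
have cz := chart_funS cx.
have cod1 : \forall w \near tup fs x, chart_cod c (resel s w).
  by apply: (resel_cts (s := s) (w := tup fs x)); rewrite PE //; exact: near_cod.
have int1 : \forall w \near tup fs x, interior L (chart_inv c (resel s w)).
  have nL : \forall y \near x, interior L y.
    by apply: open_nbhs_nbhs; split; [exact: open_interior|exact: KL].
  rewrite -(chart_funK cx) in nL; have k := chart_inv_cts cz nL.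
  rewrite -(PE x cx) in k; exact: (resel_cts k).
have both : \forall w \near tup fs x, chart_cod c (resel s w) /\
    interior L (chart_inv c (resel s w)) by exact: filterI cod1 int1.
have [r1 r10 h1] := (nbhs_rnP _ _).1 both.
(* Points of K with image close to that of x are close to x, hence in the domain of c; no other
   sheet of K comes near. *)
have [r2 r20 h2] := @inj_nbhd R _ X K (tup fs) cK (fun y _ => tup_cts hf) injK
  x _ Kx (near_dom cx).
exists (Num.min r1 r2); split.
- by rewrite lt_min r10.
- move=> i w; rewrite lt_min => /andP[/h1[cw _] _].
  apply: differentiableB; first exact: differentiable_coordE.
  rewrite (_ : (fun _ => _) = (fun y => T y 0 i)) //.
  apply: (differentiable_comp (f := T) (g := fun v : 'rV[C]_(size fs) => v 0 i)).
    apply: (differentiable_comp (f := resel s) (g := fun v => tup fs (chart_inv c v))).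
      exact: differentiable_resel.
    exact: tup_chart.
  exact: differentiable_coordE.
- move=> i _ [y Ky <-]; rewrite lt_min => /andP[_ /(h2 y Ky) cy].
  by rewrite /T PE // chart_funK // subrr.
- move=> w hw; rewrite lt_min => /andP[/h1[cw Lw] _] E.
  have wE : T w = w.
    by apply/rowP => i; apply/eqP; rewrite eq_sym -subr_eq0; apply/eqP.
  exists (chart_inv c (resel s w)) => //.
  rewrite KE; split; first exact: interior_subset.
  (* Every p of [ps] is a coordinate of C^N, so its bound 1 on K holds on the hull as well. *)
  move=> p pp; have [i hi] := tup_mems (sub p pp).
  rewrite -hi -/(T w) wE; have [_ H] := hw.
  apply: (H (fun v => v 0 i) 1) => //.
    by move=> y _; apply: hol_atW => ?; exact: differentiable_coordE.
  by move=> _ [y Ky <-]; rewrite hi; move: Ky; rewrite KE => -[_]; exact.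
Qed.

End Manifold.

Section CexpHol.
Context {R : realType}.
Local Notation C := R[i].

Lemma differentiable_cexp (z : C) : differentiable cexp z.
Proof.
pose L (k : C) : C := k * cexp z.
have Llin : linear L by move=> c u v; rewrite /L mulrDl -mulrA.
pose LL : {linear C -> C} := HB.pack L (GRing.isLinear.Build _ _ _ _ L Llin).
have p0 : 0 < rn (cexp z) by rewrite rn_gt0 cexp_neq0.
suff [] : differentiable cexp z /\ forall k, 'd cexp z k = LL k by [].
apply: diff_intro_lin.
  move=> x; apply: hol_at_cts; apply: hol_atM; last exact: hol_at_cst.
  by apply: hol_atW => y; exact: differentiable_idfun.
move=> e e0; have [|d d0 hd] := @cexp_eps R (e / rn (cexp z)); first by rewrite divr_gt0.
exists d => // k /hd h; rewrite /LL /= /L cexpD.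
have -> : cexp z * cexp k - cexp z - k * cexp z = (cexp k - 1 - k) * cexp z by ring.
by rewrite rnM -ler_pdivlMr // mulrAC.
Qed.

Lemma hol_at_cexp (V : normedModType C) (h : V -> C) z : hol_at z h ->
  hol_at z (fun x => cexp (h x)).
Proof.
apply: filterS => y dh; apply: (differentiable_comp (g := cexp)) => //.
exact: differentiable_cexp.
Qed.

Lemma ball_compact N (p : 'rV[C]_N) (r : R) : compact [set z | rn (z - p) <= r].
Proof.
apply: (@subclosed_compact _ _ (box (fun d => co p d - r) (fun d => co p d + r))).
- exact: ball_closed.
- exact: box_compact.
- move=> z /= h d; have := le_trans (co_lip z p d) h.
  by rewrite ler_norml => /andP[? ?]; apply/andP; split; lra.
Qed.

Lemma near_Re_gt0 (T : topologicalType) (h : T -> C) x : {for x, continuous h} ->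
  0 < complex.Re (h x) -> \forall y \near x, 0 < complex.Re (h y).
Proof.
move=> /ctsP k x0; apply: filterS (k _ x0) => y hy.
have h1 := ler_Re_rn (h y - h x); have h2 := le_lt_trans h1 hy.
by move: h2; rewrite cReB ltr_norml => /andP[h2 _]; clear -h2; lra.
Qed.

Lemma ctsM (T : topologicalType) (f g : T -> C) x : {for x, continuous f} ->
  {for x, continuous g} -> {for x, continuous (fun y => f y * g y)}.
Proof. exact: continuousM. Qed.

Lemma ctsB (T : topologicalType) (f g : T -> C) x : {for x, continuous f} ->
  {for x, continuous g} -> {for x, continuous (fun y => f y - g y)}.
Proof. exact: continuousB. Qed.

Lemma ctsD (T : topologicalType) (f g : T -> C) x : {for x, continuous f} ->
  {for x, continuous g} -> {for x, continuous (fun y => f y + g y)}.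
Proof. exact: continuousD. Qed.

Lemma cts_cst (T : topologicalType) (c : C) (x : T) : {for x, continuous (fun=> c)}.
Proof. exact: cvg_cst. Qed.

Lemma cts_cexp (T : topologicalType) (f : T -> C) x : {for x, continuous f} ->
  {for x, continuous (fun y => cexp (f y))}.
Proof.
by move=> cf; exact: (continuous_comp (f := f) (g := @cexp R) cf (@cexp_cts R (f x))).
Qed.

Lemma cts_clog (T : topologicalType) (f : T -> C) x : {for x, continuous f} ->
  0 < complex.Re (f x) -> {for x, continuous (fun y => clog (f y))}.
Proof. by move=> cf h; exact: (continuous_comp (f := f) (g := @clog R) cf (clog_cts h)). Qed.

Lemma cts_eq (T : topologicalType) (f g : T -> C) x : (forall y, f y = g y) ->
  {for x, continuous f} -> {for x, continuous g}.
Proof. by move=> /funext ->. Qed.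

End CexpHol.

(** * Logarithms of f modulo holomorphic factors, near one polyhedron *)

Section Solve.
Context {R : realType} {n : nat} {X : complexManifold R n}.
Local Notation C := R[i].
Implicit Types (f phi : X -> C) (fs gs : seq (X -> C)) (K : set X).

Lemma point_nbhd (x : X) (V : set X) : nbhs x V ->
  exists2 L : set X, compact L & L `<=` V /\ nbhs x L.
Proof.
move=> xV; have [c _ cx] := atlas_cover x; have cz := chart_funS cx.
have k : \forall w \near c x, chart_cod c w /\ V (chart_inv c w).
  rewrite -{1}(chart_funK cx) in xV.
  have h : \forall w \near c x, V (chart_inv c w) := chart_inv_cts cz xV.
  exact: filterI (near_cod cz) h.
have [r r0 hr] := (nbhs_rnP _ _).1 k.
have r2 : 0 < r / 2 by rewrite divr_gt0.
have rr w : rn (w - c x) <= r / 2 -> rn (w - c x) < r.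
  by move=> h; apply: le_lt_trans h _; clear -r0; lra.
exists (chart_inv c @` [set w | rn (w - c x) <= r / 2]).
  apply: continuous_compact; last exact: ball_compact.
  apply: continuous_in_subspaceT => w; rewrite inE => /= /rr/hr[cw _].
  exact: chart_inv_cts.
split; first by move=> _ [w /= /rr/hr[_ Vw] <-].
have := chart_cts cx; move/ctsP => /(_ _ r2) h.
apply: filterS2 (near_dom cx) h => y cy hy.
by exists (c y); [exact: ltW|exact: chart_funK].
Qed.

Lemma compact_nbhd K (V : set X) : compact K -> (forall x, K x -> nbhs x V) ->
  exists L, [/\ compact L, L `<=` V & forall x, K x -> nbhs x L].
Proof.
move=> cK hV.
apply: (@compact_ind X K
  (fun A => exists L, [/\ compact L, L `<=` V & forall x, A x -> nbhs x L]) cK).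
- by exists set0; split; [exact: compact0|move=> x []|move=> x []].
- by move=> A B AB [L [h1 h2 h3]]; exists L; split => // x /AB; exact: h3.
- move=> A B [L [h1 h2 h3]] [M [k1 k2 k3]]; exists (L `|` M); split.
  + exact: compactU.
  + by move=> x [/h2|/k2].
  + by move=> x [/h3|/k3]; apply: filterS => y; [left|right].
- move=> x /hV/point_nbhd[L cL [LV xL]].
  exists (interior L); first exact: nbhs_interior.
  by exists L; split => // y.
Qed.

Definition nearcts K phi :=
  forall x, K x -> \forall y \near x, {for y, continuous phi}.

Definition solves f K phi := nearcts K phi /\ rep K (fun x => f x * cexp (- phi x)).

(* The Cousin data are local logarithms of a continuous extension [H] of f from
   [tup fs @` L]; their differences are logarithms of constants. *)
Lemma good_solve f K fs : continuous f -> (forall x, f x != 0) -> good K fs ->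
  exists phi, solves f K phi.
Proof.
move=> cf f0 gK; have cK := good_compact gK.
have [hf _ [L [ps [cL KL inj _ _]]]] := gK.
have ct x : {for x, continuous (tup fs)} by exact: tup_cts.
have [H cH HE] := @tietzeC R _ X L (tup fs) cL (fun x _ => ct x)
  (fun x y Lx Ly E => inj x y Lx Ly (tup_inj E)) f (fun x _ => cf x).
pose Y := tup fs @` K.
have [M M0 hM] : exists2 M : R, 0 < M & forall x, K x -> rn (tup fs x) <= M.
  by apply: compact_bnd cK _ => x _; exact: ct.
pose a := fun _ : dir (size fs) => - M; pose b := fun _ : dir (size fs) => M.
have Yb : Y `<=` box a b.
  by move=> _ [x Kx <-]; apply: box_rn; exact: hM.
have HY x : K x -> H (tup fs x) = f x by move=> /KL/interior_subset/HE.
pose q z w := H w / H z.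
pose s z w := clog (q z w).
have cq z w : {for w, continuous (q z)} by apply: ctsM; [exact: cH|exact: cts_cst].
have q1 z : H z != 0 -> q z z = 1 by move=> h; rewrite /q divff.
have nq z : H z != 0 -> \forall w \near z, 0 < complex.Re (q z w).
  by move=> h; apply: near_Re_gt0; [exact: cq|rewrite q1 //= ltr01].
have cs z w : 0 < complex.Re (q z w) -> {for w, continuous (s z)}.
  by move=> h; apply: cts_clog.
have sub : Y `<=` hull a b Y by exact: sub_hull.
have [||u hu] := @hull_cousin R _ a b Y [set z | H z != 0] s.
- move=> z /(good_hull gK Yb)[x Kx <-]; have Hz : H (tup fs x) != 0 by rewrite HY.
  exact: near_neq0 (cH _) Hz.
- move=> z /= Hz; apply: filterS (near_near (nq z Hz)) => y h1 Hy.
  apply: hol_at_log.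
    apply: filterS2 (nq y Hy) h1 => w k1 k2.
    by apply: ctsB; apply: cs.
  apply: hol_at_eq (hol_at_cst y (H y / H z)).
  apply: filterS2 (nq y Hy) h1 => w k1 k2.
  rewrite cexpD cexpN !clogK //.
  have Hw : H w != 0.
    by apply: contraTneq k1 => E; rewrite /q E mul0r /= ltxx.
  by rewrite /q invf_div [RHS]mulrC mulrA divfK.
have uz x : K x -> hol_at (tup fs x) (fun w => u w - s (tup fs x) w).
  by move=> Kx; apply: hu; apply: sub; exists x.
exists (fun x => u (tup fs x)); split.
  move=> x Kx; set z := tup fs x; have Hz : H z != 0 by rewrite HY.
  have k : \forall w \near z, {for w, continuous u}.
    apply: filterS2 (nq z Hz) (uz x Kx) => w k1 k2.
    apply: (@cts_eq R _ (fun w => u w - s z w + s z w)); first by move=> ?; rewrite subrK.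
    by apply: ctsD; [exact: differentiable_continuous k2|exact: cs].
  have k' : \forall y \near x, {for tup fs y, continuous u} by exact: (ct x _ k).
  by apply: filterS k' => y cu; exact: (continuous_comp (f := tup fs) (g := u) (ct y) cu).
exists fs, (fun w => H w * cexp (- u w)); split => //; split.
  move=> x Kx; set z := tup fs x; have Hz : H z != 0 by rewrite HY.
  (* Near z one has H w = H z exp (s z w), so H exp (- u) = H z exp (- (u - s z)), whose exponent is
     holomorphic. *)
  apply: hol_at_eq (hol_atM (hol_at_cst z (H z)) (hol_at_cexp (hol_atN (uz x Kx)))).
  apply: filterS (nq z Hz) => w k.
  have Eq : H z * q z w = H w by rewrite /q mulrC divfK.
  by rewrite opprB addrC cexpD clogK // mulrCA Eq mulrC.
move=> x Kx; have nL : \forall y \near x, L y by exact: KL.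
by apply: filterS nL => y Ly; rewrite HE.
Qed.

(** Any solution [phi0] near K' may be changed by a function holomorphic near K'. The difference
    phi0 - phi on K is holomorphic in the ambient coordinates, and its approximant A, holomorphic
    near a box containing the image of K', is what gets subtracted. *)
Lemma solves_step f K K' fs fs' phi phi0 e : (forall x, f x != 0) ->
  good K fs -> good K' fs' -> K `<=` K' ->
  solves f K phi -> solves f K' phi0 -> 0 < e ->
  exists2 phi', solves f K' phi' & forall x, K x -> rn (phi' x - phi x) <= e.
Proof.
move=> f0 gK gK' KK [c1 [g1 [G1 [hg1 r1]]]] [c2 [g2 [G2 [hg2 r2]]]] e0.
(* One list for both polyhedra and both representations, so that everything lives in a single
   C^N. *)
pose F := (fs ++ g1) ++ (fs' ++ g2).
have hF : allhol F.
  by case: gK => h _ _; case: gK' => h' _ _; do !apply: allhol_cat.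
have i1 q : mems q fs -> mems q F by move=> h; do !(apply/mems_cat; left).
have i2 q : mems q g1 -> mems q F.
  by move=> h; apply/mems_cat; left; apply/mems_cat; right.
have i3 q : mems q g2 -> mems q F.
  by move=> h; apply/mems_cat; right; apply/mems_cat; right.
have gF : good K F by exact: good_incl i1 gK.
have {i2 r1} [P1 [p1 p1']] := repF_incl i2 r1.
have {i3 r2} [P2 [p2 p2']] := repF_incl i3 r2.
have cK := good_compact gF; have cK' := good_compact gK'.
have [_ _ [L [ps [cL KL inj _ _]]]] := gF.
have ct x : {for x, continuous (tup F)} by exact: tup_cts.
pose dl x := phi0 x - phi x.
have [|L' [cL' L'V KL']] := @compact_nbhd K [set y | L y /\ {for y, continuous dl}] cK.
  move=> x Kx; have nL : \forall y \near x, L y by exact: KL.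
  have k : \forall y \near x, {for y, continuous dl}.
    by apply: filterS2 (c1 x Kx) (c2 x (KK x Kx)) => y ? ?; exact: ctsB.
  exact: filterI nL k.
have [D cD DE] := @tietzeC R _ X L' (tup F) cL' (fun x _ => ct x)
  (fun x y Lx Ly E => inj x y (L'V x Lx).1 (L'V y Ly).1 (tup_inj E)) dl
  (fun x Lx => (L'V x Lx).2).
have KL2 x : K x -> L' x by move=> /KL'/nbhs_singleton.
have DK x : K x -> D (tup F x) = dl x by move=> /KL2/DE.
have P1K x : K x -> P1 (tup F x) = f x * cexp (- phi x).
  by move=> /p1'/nbhs_singleton.
have P2K x : K' x -> P2 (tup F x) = f x * cexp (- phi0 x).
  by move=> /p2'/nbhs_singleton.
have P20 x : K' x -> P2 (tup F x) != 0.
  by move=> Kx; rewrite P2K // mulf_neq0 // cexp_neq0.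
(* On the image of K, Q is exp (phi0 - phi). D is a continuous extension of phi0 - phi, so E is 1
   there and lies in the domain of [clog] nearby. *)
pose Q w := P1 w / P2 w; pose E w := Q w * cexp (- D w).
have hQ x : K x -> hol_at (tup F x) Q.
  by move=> Kx; apply: hol_atM; [exact: p1|apply: hol_atV; [apply: p2|apply: P20]; exact: KK].
have E1 x : K x -> E (tup F x) = 1.
  move=> Kx; rewrite /E /Q P1K // P2K; last exact: KK.
  rewrite DK // invfM mulrACA divff // mul1r -!cexpN -!cexpD /dl.
  have -> : - phi x - - phi0 x - (phi0 x - phi x) = 0 by ring.
  exact: cexp0.
have cE x : K x -> \forall w \near tup F x, {for w, continuous E}.
  move=> Kx; apply: filterS (hQ x Kx) => w dQ; apply: ctsM.
    exact: differentiable_continuous dQ.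
  by apply: cts_cexp; apply: continuousN; exact: cD.
have E0 x : K x -> \forall w \near tup F x, 0 < complex.Re (E w).
  move=> Kx; apply: near_Re_gt0; first exact: nbhs_singleton (cE x Kx).
  by rewrite E1 //= ltr01.
(* A holomorphic logarithm of [Q] restricting to phi0 - phi on K. *)
pose Dl w := D w + clog (E w).
have hDl x : K x -> hol_at (tup F x) Dl.
  move=> Kx; apply: hol_at_log.
    apply: filterS2 (cE x Kx) (E0 x Kx) => w k1 k2.
    by apply: ctsD; [exact: cD|exact: cts_clog].
  apply: hol_at_eq (hQ x Kx); apply: filterS (E0 x Kx) => w k.
  by rewrite cexpD clogK // /E mulrCA cexpN divff ?mulr1 // cexp_neq0.
have DlK x : K x -> Dl (tup F x) = dl x.
  by move=> Kx; rewrite /Dl E1 // clog1 addr0 DK.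
have [M M0 hM] : exists2 M : R, 0 < M & forall x, K' x -> rn (tup F x) <= M.
  by apply: compact_bnd cK' _ => x _; exact: ct.
pose a := fun _ : dir (size F) => - M; pose b := fun _ : dir (size F) => M.
have Yb' x : K' x -> box a b (tup F x).
  by move=> /hM; exact: box_rn.
have Yb : tup F @` K `<=` box a b by move=> _ [x /KK/Yb' ? <-].
have [|A hA AE] := @hull_approx R _ a b (tup F @` K) Dl e _ e0.
  by move=> z /(good_hull gF Yb)[x Kx <-]; exact: hDl.
exists (fun x => phi0 x - A (tup F x)); last first.
  move=> x Kx; have -> : phi0 x - A (tup F x) - phi x = Dl (tup F x) - A (tup F x).
    by rewrite DlK // /dl addrAC.
  by apply: AE; apply: sub_hull => //; exists x.
split.
  move=> x Kx; have k := hA _ (Yb' x Kx).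
  have k' : \forall y \near x, differentiable A (tup F y) by exact: (ct x _ k).
  apply: filterS2 (c2 x Kx) k' => y k1 k2; apply: (ctsB k1).
  exact: (continuous_comp (f := tup F) (g := A) (ct y) (differentiable_continuous k2)).
exists F, (fun w => P2 w * cexp (A w)); split => //; split.
  move=> x Kx; apply: hol_atM; first exact: p2.
  by apply: hol_at_cexp; apply: hA; exact: Yb'.
move=> x Kx; apply: filterS (p2' x Kx) => y <-.
by rewrite opprB addrC cexpD mulrA.
Qed.

End Solve.

(** * Exhaustion of a Stein manifold by analytic polyhedra *)

Section Exhaust.
Context {R : realType} {n : nat} {X : complexManifold R n}.
Local Notation C := R[i].
Implicit Types (f : X -> C) (fs gs ps : seq (X -> C)) (K M : set X).
Hypothesis steinX : stein X.

Lemma rn_normc (z : C) : Normc.normc z = rn z.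
Proof. by []. Qed.

Lemma holomorphicZ f (a : C) : holomorphic f -> holomorphic (fun x => f x * a).
Proof.
move=> hf c ac z cz; apply: differentiableM; first exact: hf ac z cz.
exact: differentiable_cst.
Qed.

Lemma hol_hull_sep M x : compact M -> ~ holomorphic_hull M x ->
  exists g, [/\ holomorphic g, forall y, M y -> rn (g y) < 1 & 1 < rn (g x)].
Proof.
move=> cM /existsNP[f /not_implyP[hf /negP]]; rewrite -ltNge.
set S := [set _ | _ in _]; set s := sup S; rewrite rn_normc => sx.
have [B B0 hB] : exists2 B : R, 0 < B & forall y, M y -> rn (f y) <= B.
  by apply: compact_bnd cM _ => y _; exact: holomorphic_cts.
have Ss y : M y -> rn (f y) <= s.
  move=> My; apply: sup_upper_bound; last by exists y.
  split; first by exists (rn (f y)), y.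
  by exists B => _ [y' My' <-]; exact: hB.
have s0 : 0 <= s.
  have [[y My]|nM] := pselect (exists y, M y).
    by apply: le_trans (Ss y My); exact: rn_ge0.
  rewrite /s (_ : S = set0) ?sup0 //; apply/seteqP; split => // t [y My _].
  by apply: nM; exists y.
pose M' := (s + rn (f x)) / 2.
have [M'0 sM' M'x] : [/\ 0 < M', s < M' & M' < rn (f x)].
  by clearbody s; rewrite /M'; split; lra.
exists (fun y => f y * (M'^-1)%:C); split; first exact: holomorphicZ.
  move=> y /Ss h; rewrite rnM rnR gtr0_norm ?invr_gt0 // ltr_pdivrMr // mul1r.
  exact: le_lt_trans sM'.
by rewrite rnM rnR gtr0_norm ?invr_gt0 // ltr_pdivlMr // mul1r.
Qed.

Lemma sub_hol_hull M : compact M -> M `<=` holomorphic_hull M.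
Proof.
move=> cM x Mx; apply: contrapT => /(hol_hull_sep cM)[g [_ h1 h2]].
by have := lt_trans h2 (h1 x Mx); rewrite ltxx.
Qed.

Definition glist (g : 'I_n -> X -> C) := [seq g i | i <- enum 'I_n].

Lemma mems_map (I : eqType) (g : I -> X -> C) s i : i \in s -> mems (g i) [seq g j | j <- s].
Proof.
by elim: s => //= j s IH; rewrite inE => /orP[/eqP->|/IH]; [left|right].
Qed.

Lemma mems_mapE (I : eqType) (g : I -> X -> C) s f :
  mems f [seq g j | j <- s] -> exists i, f = g i.
Proof. by elim: s => //= j s IH [<-|//]; exists j. Qed.

Lemma mems_glist g i : mems (g i) (glist g).
Proof. by apply: mems_map; rewrite mem_enum. Qed.

Lemma allhol_glist g : (forall i, holomorphic (g i)) -> allhol (glist g).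
Proof. by move=> hg f /mems_mapE[i ->]. Qed.

Lemma coords_ex K : compact K -> exists2 fs, allhol fs & coords fs K.
Proof.
move=> cK; have [_ co _] := steinX.
apply: (@compact_ind X K (fun A => exists2 fs, allhol fs & coords fs A) cK).
- by exists [::] => // x [].
- by move=> A B AB [fs h1 h2]; exists fs => // x /AB; exact: h2.
- move=> A B [fs h1 h2] [gs k1 k2]; exists (fs ++ gs); first exact: allhol_cat.
  by move=> x [/h2|/k2] [g h k]; exists g => // i; apply/mems_cat; [left|right].
- move=> x _; have [g hg [c [cx cc cE]]] := co x.
  exists (chart_dom c); first exact: near_dom.
  exists (glist g); first exact: allhol_glist.
  move=> y cy; exists g; first by move=> k; exact: mems_glist.
  by exists c.
Qed.

(** Compactness of L x L: near a diagonal point local coordinates are injective, near any other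
    point one separating function keeps separating. *)
Lemma sep_ex (L : set X) : compact L -> exists2 fs, allhol fs & sep fs L.
Proof.
move=> cL; have [sp co _] := steinX.
pose P (A : set (X * X)) := exists2 fs, allhol fs &
  forall p, A p -> (forall f, mems f fs -> f p.1 = f p.2) -> p.1 = p.2.
suff [fs h1 h2] : P (L `*` L) by exists fs => // x y Lx Ly; exact: (h2 (x, y)).
apply: compact_ind (compact_setX cL cL) _ _ _ _.
- by exists [::] => // x [].
- by move=> A B AB [fs h1 h2]; exists fs => // x /AB; exact: h2.
- move=> A B [fs h1 h2] [gs k1 k2]; exists (fs ++ gs); first exact: allhol_cat.
  move=> p [Ap|Bp] h; [apply: h2 => // f ff|apply: k2 => // f ff]; apply: h; apply/mems_cat.
    by left.
  by right.
- move=> [x y] _; have [->|xy] := pselect (x = y).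
    have [g hg [c [cx cc cE]]] := co y.
    exists (chart_dom c `*` chart_dom c).
      by exists (chart_dom c, chart_dom c) => //; split; exact: near_dom.
    exists (glist g); first exact: allhol_glist.
    move=> [u v] [/= cu cv] E; rewrite -(chart_funK cu) -(chart_funK cv).
    congr (chart_inv c _); rewrite !cE //; apply/rowP => j; rewrite !mxE.
    by apply: E; exact: mems_glist.
  have [f hf fxy] := sp x y xy.
  have e0 : 0 < rn (f x - f y) / 2 by rewrite divr_gt0 // rn_gt0 subr_eq0; apply/eqP.
  have /ctsP/(_ _ e0) h1 := holomorphic_cts (x := x) hf.
  have /ctsP/(_ _ e0) h2 := holomorphic_cts (x := y) hf.
  exists [set p | rn (f p.1 - f x) < rn (f x - f y) / 2 /\
    rn (f p.2 - f y) < rn (f x - f y) / 2].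
    by exists ([set u | rn (f u - f x) < rn (f x - f y) / 2],
      [set v | rn (f v - f y) < rn (f x - f y) / 2]).
  exists [:: f]; first by move=> g [<-|[]].
  move=> [u v] /= [k1 k2] /(_ f (or_introl erefl)) E; exfalso.
  have := ler_rnD (f x - f u) (f u - f y); rewrite addrA subrK (rnB (f x) (f u)).
  rewrite {2}E => k; have := le_lt_trans k (ltrD k1 k2).
  by rewrite -splitr ltxx.
Qed.

(** Take a compact neighbourhood L of the hull of M. Its rim B misses the hull, so finitely many
    functions, less than 1 on M, exceed 1 somewhere at each point of B; the polyhedron they cut out
    of L stays in the interior. *)
Lemma good_ex M : compact M ->
  exists K fs, good K fs /\ forall x, M x -> nbhs x K.
Proof.
move=> cM; have [_ _ /(_ M cM) cH] := steinX.
have [L [cL _ HL]] := @compact_nbhd _ _ _ _ setT cH (fun x _ => filterT).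
have clL : closed L by apply: compact_closed cL; exact: manifold_hausdorff.
pose B := L `&` ~` interior L.
have cB : compact B.
  by apply: compact_closedI => //; apply: open_closedC; exact: open_interior.
have [ps [hps1 hps2 hps3]] : exists ps, [/\ allhol ps,
    forall p, mems p ps -> forall y, M y -> rn (p y) < 1 &
    forall x, B x -> exists2 p, mems p ps & 1 < rn (p x)].
  apply: (@compact_ind X B (fun A => exists ps, [/\ allhol ps,
    forall p, mems p ps -> forall y, M y -> rn (p y) < 1 &
    forall x, A x -> exists2 p, mems p ps & 1 < rn (p x)]) cB).
  - by exists [::]; split => // x [].
  - by move=> A A' AB [ps [h1 h2 h3]]; exists ps; split => // x /AB; exact: h3.
  - move=> A A' [ps [h1 h2 h3]] [qs [k1 k2 k3]]; exists (ps ++ qs); split.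
    + exact: allhol_cat.
    + by move=> p /mems_cat[/h2|/k2].
    + by move=> x [/h3|/k3] [p pp px]; exists p => //; apply/mems_cat; [left|right].
  - move=> x [_ nx]; have nH : ~ holomorphic_hull M x by move=> /HL.
    have [g [hg1 hg2 hg3]] := hol_hull_sep cM nH.
    have e0 : 0 < rn (g x) - 1 by rewrite subr_gt0.
    exists [set y | 1 < rn (g y)].
      have /ctsP/(_ _ e0) := holomorphic_cts (x := x) hg1; apply: filterS => y hy /=.
      have := ler_rn_sub (g x) (g y); rewrite (rnB (g x)) => k.
      by have := le_lt_trans k hy; rewrite ltrD2l ltrN2.
    exists [:: g]; split => [f [<-//|[]]|p [<-//|[]]|y gy].
    by exists g => //; left.
have [fs1 h1 s1] := sep_ex cL; have [fs2 h2 s2] := coords_ex cL.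
pose K := [set x | L x /\ forall p, mems p ps -> rn (p x) <= 1].
exists K, (ps ++ fs1 ++ fs2); split; last first.
  move=> x Mx; have nL : nbhs x L by apply: HL; exact: sub_hol_hull.
  have np : \forall y \near x, forall p, mems p ps -> rn (p y) <= 1.
    elim: (ps) hps1 hps2 => [|p qs IH] k1 k2.
      by apply: filterS nL => y _ p [].
    have e0 : 0 < 1 - rn (p x) by rewrite subr_gt0; apply: (k2 p) => //; left.
    have hp : holomorphic p by apply: k1; left.
    have /ctsP/(_ _ e0) n1 := holomorphic_cts (x := x) hp.
    have := IH (fun q qq => k1 q (or_intror qq)) (fun q qq => k2 q (or_intror qq)).
    apply: filterS2 n1 => y hy h q [<-|]; last exact: h.
    have := ler_rn_sub (p y) (p x) => k; have := le_lt_trans k hy.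
    by rewrite ltrD2r => /ltW.
  by apply: filterS2 nL np => y Ly hy; split.
split.
- by do !apply: allhol_cat.
- move=> x [Lx _]; have [g k1 k2] := s2 x Lx; exists g => // k.
  by apply/mems_cat; right; apply/mems_cat; right.
- exists L, ps; split => //.
  + move=> x [Lx xp]; apply: contrapT => nx.
    have [p pp px] := hps3 x (conj Lx nx).
    by have := xp p pp; rewrite leNgt px.
  + move=> x y Lx Ly E; apply: s1 => // f ff; apply: E.
    by apply/mems_cat; right; apply/mems_cat; left.
  + by move=> p pp; apply/mems_cat; left.
Qed.

(** Local compactness and a countable base: every point lies in a basic open set with a compact
    superset, and Q j is one such superset for the basic set of index j. *)
Lemma compact_cover_seq : exists Q : nat -> set X,
  (forall j, compact (Q j)) /\ forall x, exists j, Q j x.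
Proof.
have [B /countable_injP[i inj] [_ bB]] := @manifold_second_countable _ _ X.
have H (j : nat) : exists L : set X, compact L /\
    forall U L', B U -> i U = j -> compact L' -> U `<=` L' -> U `<=` L.
  have [[U [L [BU iU cL UL]]]|h] :=
      pselect (exists U L, [/\ B U, i U = j, compact L & U `<=` L]).
    exists L; split => // U' L' BU' iU' _ _.
    by rewrite (_ : U' = U) //; apply: inj; rewrite ?inE // iU iU'.
  exists set0; split; first exact: compact0.
  by move=> U L' BU iU cL' UL'; exfalso; apply: h; exists U, L'.
have [Q hQ] := choice H; exists Q; split => [j|x]; first by have [] := hQ j.
have [L cL [_ xL]] := @point_nbhd _ _ _ x setT filterT.
have [U [BU Ux] UL] := bB x L xL.
by exists (i U); have [_ h] := hQ (i U); exact: (h U L).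
Qed.

End Exhaust.

(** * Convergence of the logarithms *)

Section Limit.
Context {R : realType}.
Local Notation C := R[i].

(** The limit is the supremum of the lower bounds v m - e m. P holds from some index on; it will say
    that the point already lies in the m-th polyhedron. *)
Lemma real_limit (v e : nat -> R) (P : nat -> Prop) : (forall m, 0 <= e m) ->
  (exists m, P m) -> (forall m k, P m -> P (m + k)%N /\ `|v (m + k)%N - v m| <= e m) ->
  exists l, forall m, P m -> `|l - v m| <= e m.
Proof.
move=> e0 [m0 P0] h.
pose S := [set v m - e m | m in P].
have ub m m' : P m -> P m' -> v m - e m <= v m' + e m'.
  move=> Pm Pm'; have [mm|mm] := leqP m m'.
    have [_] := h m (m' - m)%N Pm; rewrite subnKC // ler_norml => /andP[k _].
    by have := e0 m'; clear -k; lra.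
  have [_] := h m' (m - m')%N Pm'; rewrite subnKC ?(ltnW mm) // ler_norml => /andP[_ k].
  by have := e0 m; clear -k; lra.
have hS : has_sup S.
  split; first by exists (v m0 - e m0), m0.
  by exists (v m0 + e m0) => _ [m Pm <-]; exact: ub.
exists (sup S) => m Pm; rewrite ler_norml; apply/andP; split.
  have : v m - e m <= sup S by apply: sup_upper_bound => //; exists m.
  by lra.
have : sup S <= v m + e m.
  by apply: ge_sup; [exists (v m0 - e m0), m0|move=> _ [k Pk <-]; exact: ub].
by lra.
Qed.

Lemma complex_limit (v : nat -> C) (e : nat -> R) (P : nat -> Prop) :
  (forall m, 0 <= e m) -> (exists m, P m) ->
  (forall m k, P m -> P (m + k)%N /\ rn (v (m + k)%N - v m) <= e m) ->
  exists l, forall m, P m -> rn (l - v m) <= 2 * e m.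
Proof.
move=> e0 P0 h.
have [|x hx] := @real_limit (fun m => complex.Re (v m)) e P e0 P0.
  move=> m k /(h m k)[Pk hk]; split => //; apply: le_trans hk.
  by rewrite -cReB; exact: ler_Re_rn.
have [|y hy] := @real_limit (fun m => complex.Im (v m)) e P e0 P0.
  move=> m k /(h m k)[Pk hk]; split => //; apply: le_trans hk.
  by rewrite -cImB; exact: ler_Im_rn.
exists (x +i* y) => m Pm; apply: le_trans (rn_le_ReIm _) _.
rewrite cReB cImB /= mulrDl mul1r; apply: lerD; [exact: hx|exact: hy].
Qed.

End Limit.

Section Oka.
Context {R : realType} {n : nat} {X : complexManifold R n}.
Local Notation C := R[i].
Hypothesis steinX : stein X.
Variable f : X -> C.
Hypotheses (cf : continuous f) (f0 : forall x, f x != 0).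

Definition okpair (p : set X * (X -> C)) := exists2 fs, good p.1 fs & solves f p.1 p.2.

Lemma ok_step (Q : set X) (e : R) p : compact Q -> 0 < e -> okpair p -> exists2 q, okpair q &
  [/\ forall x, p.1 x -> nbhs x q.1, Q `<=` q.1 &
    forall x, p.1 x -> rn (q.2 x - p.2 x) <= e].
Proof.
move=> cQ e0 [fs gK sK]; have cK := good_compact gK.
have [K' [fs' [gK' hK']]] := good_ex steinX (compactU cK cQ).
have [phi0 s0] := good_solve cf f0 gK'.
have KK : p.1 `<=` K' by move=> x px; apply: nbhs_singleton; apply: hK'; left.
have [phi' s' h'] := solves_step f0 gK gK' KK sK s0 e0.
exists (K', phi'); first by exists fs'.
split => //= x Qx; first by apply: hK'; left.
by apply: nbhs_singleton; apply: hK'; right.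
Qed.

Lemma ok_seq : exists (K : nat -> set X) (phi : nat -> X -> C), [/\
  forall m, okpair (K m, phi m), forall m x, K m x -> nbhs x (K m.+1),
  forall x, exists m, K m x &
  forall m x, K m x -> rn (phi m.+1 x - phi m x) <= 2^-1 ^+ m].
Proof.
have [Q [cQ hQ]] := @compact_cover_seq R n X.
pose S := {p | okpair p}.
have H (j : nat) (p : S) : exists q : S, [/\ forall x, (sval p).1 x -> nbhs x (sval q).1,
    Q j `<=` (sval q).1 &
    forall x, (sval p).1 x -> rn ((sval q).2 x - (sval p).2 x) <= 2^-1 ^+ j].
  have e0 : 0 < 2^-1 ^+ j :> R by rewrite exprn_gt0.
  have [q oq hq] := ok_step (cQ j) e0 (svalP p).
  by exists (exist _ q oq).
(* The polyhedron around the empty set starts the recursion. *)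
have [K0 [fs [gK _]]] := good_ex steinX (@compact0 X).
have [phi0 s0] := good_solve cf f0 gK.
have ok0 : okpair (K0, phi0) by exists fs.
pose F j p := sval (cid (H j p)).
pose st := fix st j : S := if j is k.+1 then F k (st k) else exist _ (K0, phi0) ok0.
have hF j : [/\ forall x, (sval (st j)).1 x -> nbhs x (sval (st j.+1)).1,
    Q j `<=` (sval (st j.+1)).1 &
    forall x, (sval (st j)).1 x -> rn ((sval (st j.+1)).2 x - (sval (st j)).2 x) <= 2^-1 ^+ j].
  exact: svalP (cid (H j (st j))).
exists (fun j => (sval (st j)).1), (fun j => (sval (st j)).2); split.
- by move=> m; have := svalP (st m); case: (sval (st m)).
- by move=> m; have [] := hF m.
- by move=> x; have [j Qx] := hQ x; exists j.+1; have [_ h _] := hF j; exact: h.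
- by move=> m; have [] := hF m.
Qed.

Lemma oka_log : exists2 phi : X -> C, continuous phi &
  holomorphic (fun x => f x * cexp (- phi x)).
Proof.
have [K [phi [ok KK Kx hphi]]] := ok_seq.
have e0 m : 0 <= 2 * 2^-1 ^+ m :> R by rewrite mulr_ge0 // exprn_ge0 // invr_ge0.
have up m k x : K m x -> K (m + k)%N x.
  move=> Km; elim: k => [|k IH]; first by rewrite addn0.
  by rewrite addnS; apply: nbhs_singleton; apply: KK; exact: IH.
(* The bound is the exact geometric sum, which makes the induction on k go through. *)
have bnd m k x : K m x ->
    rn (phi (m + k)%N x - phi m x) <= 2 * 2^-1 ^+ m - 2 * 2^-1 ^+ (m + k).
  move=> Km; elim: k => [|k IH]; first by rewrite addn0 !subrr rn0.
  have h := hphi _ x (up m k x Km); rewrite addnS.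
  have := ler_rnD (phi (m + k).+1 x - phi (m + k)%N x) (phi (m + k)%N x - phi m x).
  rewrite addrA subrK exprS => h'; apply: le_trans h' _.
  by move: h IH; set t := 2^-1 ^+ (m + k); set t' := 2^-1 ^+ m; lra.
have lim x : exists l, forall m, K m x -> rn (l - phi m x) <= 2 * (2 * 2^-1 ^+ m).
  apply: (@complex_limit R (fun m => phi m x) (fun m => 2 * 2^-1 ^+ m) (fun m => K m x)) => //.
  move=> m k Km; split; first exact: up.
  by apply: le_trans (bnd m k x Km) _; rewrite gerBl.
have [psi hpsi] := choice lim.
have cpsi : continuous psi.
  move=> x; have [j Kj] := Kx x; apply/ctsP => e ep.
  have e3 : 0 < e / 3 by rewrite divr_gt0.
  have [k hk] := pow_half_small (2 * (2 * 2^-1 ^+ j.+1)) e3.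
  have small y : K j.+1 y -> rn (psi y - phi (j.+1 + k)%N y) <= e / 3.
    move=> Ky; apply: le_trans (hpsi y _ (up _ k y Ky)) _.
    by rewrite exprD !mulrA in hk *.
  have Kjx : K j.+1 x by exact: nbhs_singleton (KK j x Kj).
  have [_ _ [nc _]] := ok (j.+1 + k)%N.
  have /ctsP/(_ _ e3) h := nbhs_singleton (nc x (up _ k x Kjx)).
  apply: filterS2 h (KK j x Kj) => y hy Ky.
  have h1 := small y Ky; have h2 := small x Kjx; rewrite rnB in h2.
  have := ler_rnD (psi y - phi (j.+1 + k)%N y) (phi (j.+1 + k)%N y - phi (j.+1 + k)%N x).
  have := ler_rnD (psi y - phi (j.+1 + k)%N x) (phi (j.+1 + k)%N x - psi x).
  rewrite !addrA !subrK => k1 k2.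
  by clear -h1 h2 hy k1 k2; lra.
exists psi => // c ac z cz; pose x := chart_inv c z.
have cc : forall c', atlas c' -> compatible c c' by move=> c'; exact: atlas_compatible.
pose g y := f y * cexp (- psi y).
have cg : {for x, continuous g}.
  by apply: ctsM; [exact: cf|apply: cts_cexp; apply: continuousN; exact: cpsi].
pose M := rn (g x) + 1; have M0 : 0 < M by rewrite ltr_wpDl ?rn_ge0.
have [j Kj] := Kx x.
have near1 : \forall y \near x, K j.+1 y /\ rn (g y) <= M.
  have /ctsP/(_ _ ltr01) h := cg; apply: filterS2 (KK j x Kj) h => y Ky hy; split => //.
  have := ler_rn_sub (g y) (g x) => k; have := le_lt_trans k hy.
  by rewrite ltrBlDr addrC => /ltW.
have near2 : \forall w \near z, chart_cod c w /\
    (K j.+1 (chart_inv c w) /\ rn (g (chart_inv c w)) <= M).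
  have h : \forall w \near z, K j.+1 (chart_inv c w) /\ rn (g (chart_inv c w)) <= M :=
    chart_inv_cts cz near1.
  exact: filterI (near_cod cz) h.
have [r r0 hr] := (nbhs_rnP _ _).1 near2.
apply: (@hol_closure R n (g \o chart_inv c) z r (M + 1) r0) => e ep.
(* The bound 1 keeps every approximant below M + 1, the common bound that [hol_closure] requires. *)
pose e' := Num.min e 1; have e'0 : 0 < e' by rewrite lt_min ep ltr01.
have eM0 : 0 < e' / M by rewrite divr_gt0.
have /ctsP/(_ _ eM0)/nbhs_rnP[d d0 hd] := @cexp_cts R 0.
have d2 : 0 < d / 2 by rewrite divr_gt0.
have [k hk] := pow_half_small (2 * (2 * 2^-1 ^+ j.+1)) d2.
pose m := (j.+1 + k)%N.
exists (fun w => f (chart_inv c w) * cexp (- phi m (chart_inv c w))) => w /hr[cw [Kw gw]].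
set y := chart_inv c w in Kw gw *; have Km := up _ k y Kw.
have [_ _ [_ rm]] := ok m.
have dm : differentiable (fun w => f (chart_inv c w) * cexp (- phi m (chart_inv c w))) w.
  have cy : chart_dom c y by exact: chart_invS.
  have h : hol_at (c y) ((fun x => f x * cexp (- phi m x)) \o chart_inv c).
    exact: rep_chart cc rm cy Km.
  have cyw : c y = w by exact: chart_invK.
  rewrite cyw in h; exact: hol_at_diff h.
(* Factoring out the bounded g reduces the estimate to continuity of [cexp] at 0. *)
have E : g y - f y * cexp (- phi m y) = g y * - (cexp (psi y - phi m y) - 1).
  rewrite opprB mulrBr mulr1 /g -mulrA -cexpD.
  by congr (_ - _ * cexp _); rewrite addrA addNr add0r.
have close : rn (g y - f y * cexp (- phi m y)) <= e'.
  rewrite E rnM rnN; have h : rn (psi y - phi m y) < d.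
    apply: le_lt_trans (hpsi y m Km) _; rewrite exprD !mulrA in hk *.
    by apply: le_lt_trans hk _; rewrite ltr_pdivrMr // ltr_pMr // ltr1n.
  have := hd (psi y - phi m y); rewrite subr0 cexp0 => /(_ h)/ltW h'.
  apply: (@le_trans _ _ (M * (e' / M))); last by rewrite mulrCA divff ?mulr1 // lt0r_neq0.
  by apply: ler_pM; rewrite ?rn_ge0.
split => //; last by apply: le_trans close _; rewrite ge_min lexx.
have := ler_rnB (g y) (g y - f y * cexp (- phi m y)); rewrite subKr => k1.
apply: le_trans k1 _; apply: lerD => //; apply: le_trans close _.
by rewrite ge_min lexx orbT.
Qed.

End Oka.

Theorem theorem1p1 (R : realType) (n : nat) (X : complexManifold R n)
    (steinX : stein X) (f : X -> R[i]) (f_continuous : continuous f)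
    (f_neq0 : forall x, f x != 0) :
  exists F : X * R -> R[i],
    [/\ {within [set: X] `*` `[0, 1], continuous F},
        forall x t, 0 <= t <= 1 -> F (x, t) != 0,
        forall x, F (x, 0) = f x &
        holomorphic (fun x => F (x, 1))].
Proof.
have [phi cphi hphi] := oka_log steinX f_continuous f_neq0.
exists (fun p => f p.1 * cexp (- (p.2%:C * phi p.1))); split.
- apply: continuous_subspaceT => p.
  have c1 : {for p, continuous (@fst X R)} by exact: cvg_fst.
  have c2 : {for p, continuous (@snd X R)} by exact: cvg_snd.
  have c3 : {for p, continuous (fun q : X * R => f q.1)}.
    exact: (continuous_comp (g := f) c1 (f_continuous _)).
  have c4 : {for p, continuous (fun q : X * R => phi q.1)}.
    exact: (continuous_comp (g := phi) c1 (cphi _)).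
  have c5 : {for p, continuous (fun q : X * R => q.2%:C)}.
    apply/ctsP => e e0; move/ctsRP: c2 => /(_ e e0); apply: filterS => q.
    by rewrite -rmorphB rnR.
  exact: (ctsM c3 (cts_cexp (continuousN (ctsM c5 c4)))).
- by move=> x t _; rewrite mulf_neq0 // cexp_neq0.
- by move=> x; rewrite /= mul0r oppr0 cexp0 mulr1.
- have -> : (fun x => f (x, 1 : R).1 * cexp (- ((x, 1 : R).2%:C * phi (x, 1 : R).1))) =
      (fun x => f x * cexp (- phi x)).
    by apply/funext => x /=; rewrite mul1r.
  exact: hphi.
Qed.
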